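(* Let $K$ and $\varkappa$ be real functions defined in a domain $\mathcal D\subset\mathbb R^2$, satisfying $K^2-\varkappa^2>0$, and let the pair $(K,\varkappa)$ be a solution in $\mathcal D$ of the system \[ \sqrt[4]{|K^2-\varkappa^2|}\;\Delta^h\ln|K^2-\varkappa^2|=-8K,\qquad \sqrt[4]{|K^2-\varkappa^2|}\;\Delta^h\ln\left|\frac{K+\varkappa}{K-\varkappa}\right|=-4\varkappa , \] where $\Delta^h=\frac{\partial^2}{\partial u^2}-\frac{\partial^2}{\partial v^2}$. Then in a neighborhood of any point $t_0\in\mathcal D$ there exists a minimal time-like surface $\mathcal M$ of the second type in $\mathbb R^4_2$, unique up to a proper motion in $\mathbb R^4_2$, given in canonical coordinates $(u,v)$, for which the given functions $K$ and $\varkappa$ are the Gauss curvature and the curvature of the normal connection, respectively.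
   Context: All maps are smooth and domains are open and connected. $\mathbb R^4_2$ is $\mathbb R^4$ with scalar product $a\cdot b=-a_1b_1+a_2b_2-a_3b_3+a_4b_4$ and its standard orientation; $a^2=a\cdot a$. A proper motion is $x\mapsto Ax+b$ with $A\in\mathbf{SO}(2,2,\mathbb R)$ (linear, preserving the scalar product, $\det A=1$), $b\in\mathbb R^4_2$. Double numbers: $\mathbb D=\{t=u+\mathrm jv:u,v\in\mathbb R\}$, $\mathrm j^2=1$, $\bar t=u-\mathrm jv$, $|t|^2=t\bar t=u^2-v^2$; $\mathbb D_+=\{t:|t|^2>0,\ \mathrm{Re}\,t>0\}$; $\mathbb R^2$ is identified with $\mathbb D$; $\frac{\partial}{\partial t}=\frac12(\frac{\partial}{\partial u}+\mathrm j\frac{\partial}{\partial v})$. $\mathbb D^4_2$ is $\mathbb D^4$ with the $\mathbb D$-bilinear extension of the scalar product. A time-like surface $\mathcal M=(\mathcal D,x)$ in $\mathbb R^4_2$ is an immersion $x:\mathcal D\to\mathbb R^4_2$ whose induced scalar product on tangent planes is indefinite (signature $(1,1)$). Coordinates $(u,v)$ are isothermal if $x_u^2=-x_v^2$ and $x_u\cdot x_v=0$; always with $E=x_u^2<0$. Let $\sigma$ be the second fundamental form, $(X_1,X_2)$ an orthonormal tangent frame with $X_1^2=-1$, $X_2^2=1$, and $(n_1,n_2)$ an orthonormal normal frame with $n_1^2=-1$, $n_2^2=1$ such that $(X_1,X_2,n_1,n_2)$ is right (positively) oriented in $\mathbb R^4_2$. The surface is minimal if $H=\frac12(-\sigma(X_1,X_1)+\sigma(X_2,X_2))=0$.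 Gauss curvature: $K=-R(X_1,X_2)X_2\cdot X_1$; curvature of the normal connection: $\varkappa=R^N(X_1,X_2)n_2\cdot n_1$, where $R,R^N$ are the curvature tensors of the Levi-Civita and the normal connections, with $R(X,Y)=\nabla_X\nabla_Y-\nabla_Y\nabla_X-\nabla_{[X,Y]}$ (similarly $R^N$). For isothermal $t=u+\mathrm jv$ put $\Phi=x_u+\mathrm jx_v$ and $\Phi'=\partial\Phi/\partial t$; $\Phi'^\bot$ is the projection of $\Phi'$ to the complexified normal space (the $\mathbb D$-span of the normal space), along the complexified tangent space, and ${\Phi'^\bot}^2=\Phi'^\bot\cdot\Phi'^\bot\in\mathbb D$. A minimal time-like surface is of the second type if $-{\Phi'^\bot}^2\in\mathbb D_+$ at all points (this does not depend on the isothermal coordinates). For such a surface, isothermal coordinates with $E<0$ are canonical if ${\Phi'^\bot}^2=-1$. *)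

(* Defs.v *)
From HB Require Import structures.
From mathcomp Require Import all_boot all_order all_algebra.
From mathcomp Require Import all_classical all_reals all_analysis.
From mathcomp Require Import ring.

Set Implicit Arguments.
Unset Strict Implicit.
Unset Printing Implicit Defensive.

Import Order.TTheory GRing.Theory Num.Theory.
Import numFieldNormedType.Exports.

Local Open Scope classical_set_scope.
Local Open Scope ring_scope.

Record dnum (R : realType) := DNum { dre : R; dim : R }.

Section DoubleNumbers.
Variable R : realType.
Implicit Types s t : dnum R.

Definition dnum_pair t : R * R := (dre t, dim t).
Definition pair_dnum (z : R * R) : dnum R := DNum z.1 z.2.
Lemma dnum_pairK : cancel dnum_pair pair_dnum.
Proof. by case. Qed.

HB.instance Definition _ := Choice.copy (dnum R) (can_type dnum_pairK).

Definition dadd s t := DNum (dre s + dre t) (dim s + dim t).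
Definition dopp t := DNum (- dre t) (- dim t).
Definition dmul s t :=
  DNum (dre s * dre t + dim s * dim t) (dre s * dim t + dim s * dre t).

Lemma daddA : associative dadd.
Proof. by move=> a b c; rewrite /dadd /= !addrA. Qed.
Lemma daddC : commutative dadd.
Proof. by move=> a b; rewrite /dadd addrC [dim a + _]addrC. Qed.
Lemma dadd0 : left_id (DNum 0 0) dadd.
Proof. by case=> a b; rewrite /dadd /= !add0r. Qed.
Lemma daddN : left_inverse (DNum 0 0) dopp dadd.
Proof. by case=> a b; rewrite /dadd /= !addNr. Qed.

HB.instance Definition _ :=
  GRing.isZmodule.Build (dnum R) daddA daddC dadd0 daddN.

Lemma dmulA : associative dmul.
Proof. by move=> a b c; rewrite /dmul /=; congr DNum; ring. Qed.
Lemma dmulC : commutative dmul.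
Proof. by move=> a b; rewrite /dmul /=; congr DNum; ring. Qed.
Lemma dmul1 : left_id (DNum 1 0) dmul.
Proof. by case=> a b; rewrite /dmul /=; congr DNum; ring. Qed.
Lemma dmulDl : left_distributive dmul dadd.
Proof. by move=> a b c; rewrite /dmul /dadd /=; congr DNum; ring. Qed.
Lemma done_neq0 : DNum 1 0 != 0 :> dnum R.
Proof. by apply/eqP=> -[] /eqP; rewrite oner_eq0. Qed.

HB.instance Definition _ := GRing.Zmodule_isComNzRing.Build (dnum R)
  dmulA dmulC dmul1 dmulDl done_neq0.

Definition dj : dnum R := DNum 0 1.
Definition dreal (a : R) : dnum R := DNum a 0.
Definition dnorm2 t : R := dre t ^+ 2 - dim t ^+ 2.
Definition Dplus : set (dnum R) := [set t | 0 < dnorm2 t /\ 0 < dre t].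

End DoubleNumbers.

Arguments dj {R}.

(* Used with S = R for R^4_2 and with S = dnum R for its D-bilinear
   extension; the coordinates are numbered from 0. *)
Definition dot (S : comNzRingType) (a b : 'cV[S]_4) : S :=
  \sum_(i < 4) (-1) ^+ i.+1 * a i 0 * b i 0.

Definition SO22 (R : realType) (A : 'M[R]_4) : Prop :=
  (forall a b : 'cV[R]_4, dot (A *m a) (A *m b) = dot a b) /\ \det A = 1.

(* The point (u, v) of R * R is identified with u + j v. *)
Definition domain (R : realType) (U : set (R * R)) : Prop :=
  open U /\ connected U.

Section Calculus.
Variable R : realType.
Implicit Types (U : set (R * R)) (p q : R * R).

Definition du (W : normedModType R) (f : R * R -> W) (p : R * R) : W :=
  'D_((1, 0) : R * R) f p.
Definition dv (W : normedModType R) (f : R * R -> W) (p : R * R) : W :=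
  'D_((0, 1) : R * R) f p.

Fixpoint Ck_on (W : normedModType R) (k : nat) U (f : R * R -> W) : Prop :=
  if k is k'.+1 then
    [/\ forall p, U p -> differentiable f p,
        Ck_on k' U (du f) & Ck_on k' U (dv f)]
  else forall p, U p -> {for p, continuous f}.

Definition smooth_on (W : normedModType R) U (f : R * R -> W) : Prop :=
  forall k, Ck_on k U f.

Definition hlaplacian (f : R * R -> R) p : R := du (du f) p - dv (dv f) p.

(* A vector field is given by its coordinates X : R * R -> R * R in the
   parameters (u, v). *)
Definition lie_bracket (X Y : R * R -> R * R) p : R * R :=
  'D_(X p) Y p - 'D_(Y p) X p.

End Calculus.

(* The projection of w to N along T. It is the intended vector whenever N and T
   are complementary, and the junk value 0 if no decomposition exists. *)
Definition proj (V : zmodType) (N T : set V) (w : V) : V :=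
  xget 0 [set n | N n /\ T (w - n)].

Section Surfaces.
Variables (R : realType) (x : R * R -> 'cV[R]_4).
Implicit Types (U V : set (R * R)) (p q : R * R) (X Y : R * R -> R * R).

Definition push X p : 'cV[R]_4 := 'D_(X p) x p.

Definition tangent_space p : set 'cV[R]_4 :=
  [set w | exists a : R * R, w = 'D_a x p].
Definition normal_space p : set 'cV[R]_4 :=
  [set n | forall w, tangent_space p w -> dot n w = 0].

Definition tproj p : 'cV[R]_4 -> 'cV[R]_4 :=
  proj (tangent_space p) (normal_space p).
Definition nproj p : 'cV[R]_4 -> 'cV[R]_4 :=
  proj (normal_space p) (tangent_space p).

Definition immersion U : Prop :=
  smooth_on U x /\ forall p, U p -> forall a : R * R, 'D_a x p = 0 -> a = 0.

Definition timelike_surface U : Prop :=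
  [/\ domain U, immersion U &
      forall p, U p -> exists a b : 'cV[R]_4,
        [/\ tangent_space p a, tangent_space p b, dot a a < 0 & 0 < dot b b]].

Definition isothermal U : Prop := forall p, U p ->
  [/\ dot (du x p) (du x p) = - dot (dv x p) (dv x p),
      dot (du x p) (dv x p) = 0 &
      dot (du x p) (du x p) < 0].

Definition tangent_frame V X1 X2 : Prop :=
  [/\ smooth_on V X1, smooth_on V X2 &
      forall p, V p ->
        [/\ dot (push X1 p) (push X1 p) = -1,
            dot (push X2 p) (push X2 p) = 1 &
            dot (push X1 p) (push X2 p) = 0]].

Definition normal_frame V (n1 n2 : R * R -> 'cV[R]_4) : Prop :=
  [/\ smooth_on V n1, smooth_on V n2 &
      forall p, V p ->
        [/\ normal_space p (n1 p), normal_space p (n2 p),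
            dot (n1 p) (n1 p) = -1, dot (n2 p) (n2 p) = 1 &
            dot (n1 p) (n2 p) = 0]].

Definition right_oriented (a b c d : 'cV[R]_4) : Prop :=
  0 < \det (\matrix_(i < 4, k < 4) ([:: a; b; c; d]`_k) i 0).

Definition second_form X Y p : 'cV[R]_4 := nproj p ('D_(X p) (push Y) p).

Definition mean_curvature X1 X2 p : 'cV[R]_4 :=
  2^-1 *: (- second_form X1 X1 p + second_form X2 X2 p).

(* With pr = tproj and pr = nproj the following is the Levi-Civita connection
   (Gauss formula), resp. the normal connection (Weingarten formula). *)
Definition nabla (pr : R * R -> 'cV[R]_4 -> 'cV[R]_4)
    X (Z : R * R -> 'cV[R]_4) p : 'cV[R]_4 :=
  pr p ('D_(X p) Z p).

Definition curvature pr X Y (Z : R * R -> 'cV[R]_4) p : 'cV[R]_4 :=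
  nabla pr X (nabla pr Y Z) p - nabla pr Y (nabla pr X Z) p
  - nabla pr (lie_bracket X Y) Z p.

(* The quantities below do not depend on the frame, so they are evaluated in
   some frame defined near the given point. *)
Definition minimal U : Prop := forall p, U p ->
  exists V X1 X2,
    [/\ open V, V p, V `<=` U, tangent_frame V X1 X2 &
        mean_curvature X1 X2 p = 0].

Definition gauss_curvature U (K : R * R -> R) : Prop := forall p, U p ->
  exists V X1 X2,
    [/\ open V, V p, V `<=` U, tangent_frame V X1 X2 &
        K p = - dot (curvature tproj X1 X2 (push X2) p) (push X1 p)].

Definition normal_curvature U (kappa : R * R -> R) : Prop := forall p, U p ->
  exists V X1 X2 n1 n2,
    [/\ open V /\ V p, V `<=` U,
        tangent_frame V X1 X2 /\ normal_frame V n1 n2,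
        forall q, V q ->
          right_oriented (push X1 q) (push X2 q) (n1 q) (n2 q) &
        kappa p = dot (curvature nproj X1 X2 n2 p) (n1 p)].

Definition toD (a : 'cV[R]_4) : 'cV[dnum R]_4 := map_mx (@dreal R) a.

Definition dspan (S : set 'cV[R]_4) : set 'cV[dnum R]_4 :=
  [set w | exists n (c : 'I_n -> dnum R) (s : 'I_n -> 'cV[R]_4),
     (forall i, S (s i)) /\ w = \sum_(i < n) c i *: toD (s i)].

(* Partial derivatives of a D^4-valued map act on its real and imaginary
   parts. *)
Definition dpartial (e : R * R) (F : R * R -> 'cV[dnum R]_4) p :
    'cV[dnum R]_4 :=
  toD ('D_e (fun q => map_mx (@dre R) (F q)) p)
  + dj *: toD ('D_e (fun q => map_mx (@dim R) (F q)) p).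

Definition d_dt (F : R * R -> 'cV[dnum R]_4) p : 'cV[dnum R]_4 :=
  dreal 2^-1 *: (dpartial (1, 0) F p + dj *: dpartial (0, 1) F p).

Definition Phi p : 'cV[dnum R]_4 := toD (du x p) + dj *: toD (dv x p).

Definition Phi'perp p : 'cV[dnum R]_4 :=
  proj (dspan (normal_space p)) (dspan (tangent_space p)) (d_dt Phi p).

Definition second_type U : Prop := forall p, U p ->
  Dplus (- dot (Phi'perp p) (Phi'perp p)).

Definition canonical U : Prop :=
  isothermal U /\ forall p, U p -> dot (Phi'perp p) (Phi'perp p) = -1.

(* The type is read off in the parameters of x, which are isothermal by
   canonicity. *)
Definition canonical_minimal_surface_with U (K kappa : R * R -> R) : Prop :=
  [/\ timelike_surface U /\ minimal U, second_type U, canonical U,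
      gauss_curvature U K & normal_curvature U kappa].

End Surfaces.

(* Main.v *)
Require Import Defs.
From HB Require Import structures.
From mathcomp Require Import all_boot all_order all_algebra.
From mathcomp Require Import all_classical all_reals all_analysis.
From mathcomp Require Import ring lra.
Import Order.TTheory GRing.Theory Num.Theory.
Import numFieldNormedType.Exports.
Set Implicit Arguments.
Unset Strict Implicit.
Unset Printing Implicit Defensive.
Local Open Scope classical_set_scope.
Local Open Scope ring_scope.

(** In the null coordinates xi = (u + v) / 2 and eta = (u - v) / 2 a minimal surface
    is a sum of two null curves: x_{xi eta} = 0. Write P = x_xi, Q = x_eta and
    h = P . Q, so that P and Q are null vectors and h < 0. The coordinates are
    canonical when the normal parts of x_{xi xi} and x_{eta eta} both have scalar
    square -4 ([Phi'perp_dot]), and the formulas of Gauss and Ricci express K and kappa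
    by P, Q and their derivatives ([gauss_formula], [normal_formula]). The resulting
    [canonical_equations] are equivalent to the geometric conditions
    ([canonical_surface_equations], [canonical_surface_intro]).

    Uniqueness. Let n be half the normal part of x_{xi xi}, a unit time-like vector, and
    complete P, Q, n by a unit vector l, its sign fixed by the orientation. Half the normal
    part of x_{eta eta} is another unit vector m, and K = - 4 n.m / h^2,
    kappa = - 4 l.m / h^2. Since the components of m lie on a hyperbola,
    K^2 - kappa^2 = 16 / h^4. So K and kappa determine h, hence m in the frame, hence
    all the coefficients of the equations for the derivatives of the frame
    ([structure_equations]). The linear map between the frames of two such surfaces
    is then constant, and it is the linear part of a proper motion
    ([canonical_surface_rigid]).

    Existence. The operator [hlaplacian] is the mixed derivative in xi and eta. With the
    common sign k of K + kappa and K - kappa, the substitution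
    K + kappa = k / (f1^3 f2), K - kappa = k / (f1 f2^3) decouples the system into two
    copies of Liouville's equation f f_{xi eta} - f_xi f_eta = k
    ([curvature_liouville]). Its solutions are f = a1 b1 + a2 b2, where the a's depend
    on xi and the b's on eta, with Wronskians k and 1 ([liouville_factor]). Now R^4_2 is
    the space of 2 by 2 matrices with the determinant as quadratic form, up to a
    factor, and its null vectors are the matrices of rank one. The factors of f1
    and of f2 give two curves of such matrices P(xi) and Q(eta) with
    P . Q = - 2 f1 f2, whose other invariants are Wronskians ([tens_null_curves]);
    integrating them yields the surface ([liouville_surface]). *)

(** * Smooth functions of two variables *)

Section Locality.
Variables (R : realType) (V W : normedModType R).
Implicit Types (f g : V -> W) (U : set V).

Lemma near_open U f g p : open U -> U p -> (forall q, U q -> f q = g q) ->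
  \near p, f p = g p.
Proof.
move=> oU Up fg; have : nbhs p U by apply: open_nbhs_nbhs.
by apply: filterS => q Uq; apply: fg.
Qed.

Lemma differentiable_near0 f p :
  (\near p, f p = 0) -> differentiable f p.
Proof.
move=> f0.
have E : f \o shift p = cst (f p) + (\0 : V -> W) +o_ 0 id.
  apply/eqaddoP => e e0; rewrite (nbhs_singleton f0).
  have : \forall q \near (0 : V), f (q + p) = 0.
    by move: f0; rewrite (near_shift 0 p) subr0.
  apply: filterS => q fq.
  rewrite /= !fctE /= fq !addr0 subrr normr0 mulr_ge0 //; exact: ltW.
apply: (diff_locallyP _ _).2.
have D : 'd f p = \0 :> (V -> W).
  by apply: diff_unique E; exact: cst_continuous.
by split; rewrite D //; exact: cst_continuous.
Qed.

Lemma near_eq_differentiable f g p : (\near p, f p = g p) ->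
  differentiable f p -> differentiable g p.
Proof.
move=> fg df; have -> : g = f + (g - f) by rewrite addrC subrK.
apply: differentiableD; first exact: df.
apply: differentiable_near0.
by apply: filterS fg => q; rewrite !fctE => ->; rewrite subrr.
Qed.

End Locality.

Section Calculus.
Variable R : realType.
Implicit Types (W : normedModType R) (U : set (R * R)) (p q v : R * R).

Lemma derive_eq_on W U (f g : R * R -> W) p v : open U -> U p ->
  (forall q, U q -> f q = g q) -> 'D_v f p = 'D_v g p.
Proof. by move=> oU Up fg; apply: near_eq_derive; apply: near_open fg. Qed.

Lemma Ck_onSP W k U (f : R * R -> W) : Ck_on k.+1 U f <->
  [/\ forall p, U p -> differentiable f p, Ck_on k U (du f) & Ck_on k U (dv f)].
Proof. by []. Qed.

Lemma Ck_onS W k U V (f : R * R -> W) : V `<=` U -> Ck_on k U f -> Ck_on k V f.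
Proof.
move=> VU; elim: k f => [|k IHk] f /=; first by move=> cf p /VU /cf.
by case=> df duf dvf; split=> [p /VU /df||]; [|exact: IHk..].
Qed.

Lemma Ck_on_eq W k U (f g : R * R -> W) : open U ->
  (forall q, U q -> f q = g q) -> Ck_on k U f -> Ck_on k U g.
Proof.
move=> oU; elim: k f g => [|k IHk] f g fg /=.
  move=> cf p Up; rewrite /prop_for /continuous_at -(fg p Up).
  by apply: cvg_trans (cf p Up); apply: near_eq_cvg; apply: near_open fg.
case=> df duf dvf; split.
- by move=> p Up; apply: near_eq_differentiable (df p Up); apply: near_open fg.
- by apply: IHk duf => q Uq; apply: derive_eq_on fg.
- by apply: IHk dvf => q Uq; apply: derive_eq_on fg.
Qed.

Lemma Ck_onW W k U (f : R * R -> W) : Ck_on k.+1 U f -> Ck_on k U f.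
Proof.
elim: k f => [|k IHk] f.
  by case=> df _ _ p /df /differentiable_continuous.
by move/Ck_onSP => [df duf dvf]; apply/Ck_onSP; split;
  [exact df|exact: IHk|exact: IHk].
Qed.

Lemma smooth_onS W U V (f : R * R -> W) :
  V `<=` U -> smooth_on U f -> smooth_on V f.
Proof. by move=> VU sf k; apply: Ck_onS VU _. Qed.

Lemma smooth_on_eq W U (f g : R * R -> W) : open U ->
  (forall q, U q -> f q = g q) -> smooth_on U f -> smooth_on U g.
Proof. by move=> oU fg sf k; apply: Ck_on_eq fg _. Qed.

Lemma smooth_differentiable W U (f : R * R -> W) p :
  smooth_on U f -> U p -> differentiable f p.
Proof. by move=> /(_ 1) [+ _ _]; apply. Qed.

Lemma smooth_derivable W U (f : R * R -> W) p v :
  smooth_on U f -> U p -> derivable f p v.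
Proof. by move=> sf /(smooth_differentiable sf); apply: diff_derivable. Qed.

Lemma smooth_du W U (f : R * R -> W) : smooth_on U f -> smooth_on U (du f).
Proof. by move=> sf k; have [_ + _] := sf k.+1. Qed.

Lemma smooth_dv W U (f : R * R -> W) : smooth_on U f -> smooth_on U (dv f).
Proof. by move=> sf k; have [_ _] := sf k.+1. Qed.

Lemma smooth_intro W U (f : R * R -> W) :
  (forall p, U p -> differentiable f p) ->
  smooth_on U (du f) -> smooth_on U (dv f) -> smooth_on U f.
Proof.
by move=> df su sv [|k]; [move=> p /df /differentiable_continuous|split].
Qed.

Lemma pair_addE (a b c d : R) : (a, b) + (c, d) = (a + c, b + d).
Proof. by []. Qed.

Lemma pair_scaleE (c a b : R) : c *: ((a, b) : R * R) = (c * a, c * b).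
Proof. by []. Qed.

Lemma derive_uv W (f : R * R -> W) p v : differentiable f p ->
  'D_v f p = v.1 *: du f p + v.2 *: dv f p.
Proof.
move=> df; rewrite /du /dv !deriveE // -!linearZ -linearD /=; congr ('d f p _).
by case: v => a b; rewrite !pair_scaleE pair_addE !mulr1 !mulr0 addr0 add0r.
Qed.

Lemma Ck_cst W k U (a : W) : Ck_on k U (fun=> a).
Proof.
elim: k a => [|k IHk] a /=; first by move=> p _; exact: cst_continuous.
split; first by move=> p _; exact: differentiable_cst.
- rewrite (_ : du _ = fun=> 0) //; apply/funext => p; exact: derive_cst.
- rewrite (_ : dv _ = fun=> 0) //; apply/funext => p; exact: derive_cst.
Qed.

Lemma CkD W k U (f g : R * R -> W) : open U ->
  Ck_on k U f -> Ck_on k U g -> Ck_on k U (fun p => f p + g p).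
Proof.
move=> oU; elim: k f g => [|k IHk] f g.
  by move=> cf cg p Up; apply: continuousD; [exact: cf|exact: cg].
move=> /Ck_onSP[df duf dvf] /Ck_onSP[dg dug dvg]; apply/Ck_onSP; split.
- by move=> p Up; apply: differentiableD; [exact: df|exact: dg].
- apply: Ck_on_eq oU _ (IHk _ _ duf dug) => q Uq.
  by rewrite [RHS]deriveD //; apply: diff_derivable; [exact: df|exact: dg].
- apply: Ck_on_eq oU _ (IHk _ _ dvf dvg) => q Uq.
  by rewrite [RHS]deriveD //; apply: diff_derivable; [exact: df|exact: dg].
Qed.

Lemma CkZ W k U (c : R) (f : R * R -> W) : open U ->
  Ck_on k U f -> Ck_on k U (fun p => c *: f p).
Proof.
move=> oU; elim: k f => [|k IHk] f.
  by move=> cf p Up; exact: continuousZl_tmp (cf p Up).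
move=> /Ck_onSP[df duf dvf]; apply/Ck_onSP; split.
- by move=> p Up; apply: differentiableZ; exact: df.
- apply: Ck_on_eq oU _ (IHk _ duf) => q Uq.
  by rewrite [RHS]deriveZ //; apply: diff_derivable; exact: df.
- apply: Ck_on_eq oU _ (IHk _ dvf) => q Uq.
  by rewrite [RHS]deriveZ //; apply: diff_derivable; exact: df.
Qed.

Lemma CkM k U (f g : R * R -> R) : open U ->
  Ck_on k U f -> Ck_on k U g -> Ck_on k U (fun p => f p * g p).
Proof.
move=> oU; elim: k f g => [|k IHk] f g.
  by move=> cf cg p Up; apply: continuousM; [exact: cf|exact: cg].
move=> Cf Cg; have [cf cg] := (Ck_onW Cf, Ck_onW Cg).
move: Cf Cg => /Ck_onSP[df duf dvf] /Ck_onSP[dg dug dvg]; apply/Ck_onSP; split.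
- by move=> p Up; apply: differentiableM; [exact: df|exact: dg].
- apply: Ck_on_eq oU _ (CkD oU (IHk _ _ cf dug) (IHk _ _ cg duf)) => q Uq.
  by rewrite [RHS]deriveM //; apply: diff_derivable; [exact: df|exact: dg].
- apply: Ck_on_eq oU _ (CkD oU (IHk _ _ cf dvg) (IHk _ _ cg dvf)) => q Uq.
  by rewrite [RHS]deriveM //; apply: diff_derivable; [exact: df|exact: dg].
Qed.

Lemma differentiable_mx m n (F : R * R -> 'M[R]_(m, n)) p :
  (forall i j, differentiable (fun q => F q i j) p) -> differentiable F p.
Proof.
move=> dF.
have -> : F = \sum_(i < m) \sum_(j < n) (fun q => F q i j *: delta_mx i j).
  apply/funext => q; rewrite {1}(matrix_sum_delta (F q)) fct_sumE.
  by apply: eq_bigr => i _; rewrite fct_sumE.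
apply: differentiable_sum => i; apply: differentiable_sum => j.
exact: differentiableZl (dF i j).
Qed.

Lemma derive_coord m n (F : R * R -> 'M[R]_(m, n)) p v i j :
  derivable F p v -> ('D_v F p) i j = 'D_v (fun q => F q i j) p.
Proof. by move=> dF; rewrite derive_mx // mxE. Qed.

Lemma differentiable_coordf m n (F : R * R -> 'M[R]_(m, n)) p i j :
  differentiable F p -> differentiable (fun q => F q i j) p.
Proof.
move=> dF.
exact: (differentiable_comp dF (differentiable_coord (F p) i j)).
Qed.

(** Giving up one order costs nothing for smooth maps, and lets the continuity of F
    follow from the differentiability of its entries. *)
Lemma Ck_mx m n k U (F : R * R -> 'M[R]_(m, n)) : open U ->
  (forall i j, Ck_on k.+1 U (fun p => F p i j)) -> Ck_on k U F.
Proof.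
move=> oU; elim: k F => [|k IHk] F CF.
  move=> p Up; apply: differentiable_continuous; apply: differentiable_mx => i j.
  by have /Ck_onSP[+ _ _] := CF i j; apply.
have dF p : U p -> differentiable F p.
  by move=> Up; apply: differentiable_mx => i j; have /Ck_onSP[+ _ _] := CF i j; apply.
split; first exact: dF.
- apply: IHk => i j; have /Ck_onSP[_ Cu _] := CF i j.
  apply: Ck_on_eq oU _ Cu => q Uq; rewrite /du derive_coord //.
  by apply: diff_derivable; exact: dF.
- apply: IHk => i j; have /Ck_onSP[_ _ Cv] := CF i j.
  apply: Ck_on_eq oU _ Cv => q Uq; rewrite /dv derive_coord //.
  by apply: diff_derivable; exact: dF.
Qed.

Lemma smooth_mx m n U (F : R * R -> 'M[R]_(m, n)) : open U ->
  (forall i j, smooth_on U (fun p => F p i j)) -> smooth_on U F.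
Proof. by move=> oU sF k; apply: Ck_mx => // i j; exact: sF. Qed.

Lemma smooth_coord m n U (F : R * R -> 'M[R]_(m, n)) i j : open U ->
  smooth_on U F -> smooth_on U (fun p => F p i j).
Proof.
move=> oU sF k; elim: k F sF => [|k IHk] F sF.
  move=> p Up; apply: differentiable_continuous.
  by apply: differentiable_coordf; exact: smooth_differentiable sF Up.
split.
- by move=> p Up; apply: differentiable_coordf; exact: smooth_differentiable sF Up.
- apply: Ck_on_eq oU _ (IHk _ (smooth_du sF)) => q Uq.
  by rewrite /du derive_coord //; exact: smooth_derivable sF Uq.
- apply: Ck_on_eq oU _ (IHk _ (smooth_dv sF)) => q Uq.
  by rewrite /dv derive_coord //; exact: smooth_derivable sF Uq.
Qed.

Lemma smooth_cst W U (a : W) : smooth_on U (fun=> a).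
Proof. by move=> k; exact: Ck_cst. Qed.

Lemma smoothD W U (f g : R * R -> W) : open U ->
  smooth_on U f -> smooth_on U g -> smooth_on U (fun p => f p + g p).
Proof. by move=> oU sf sg k; exact: CkD. Qed.

Lemma smoothM U (f g : R * R -> R) : open U ->
  smooth_on U f -> smooth_on U g -> smooth_on U (fun p => f p * g p).
Proof. by move=> oU sf sg k; exact: CkM. Qed.

Lemma smoothN U (f : R * R -> R) : open U ->
  smooth_on U f -> smooth_on U (fun p => - f p).
Proof.
move=> oU sf; apply: (@smooth_on_eq _ _ (fun p => -1 * f p)) => //.
  by move=> q _; rewrite mulN1r.
by apply: smoothM => //; exact: smooth_cst.
Qed.

Lemma smoothB U (f g : R * R -> R) : open U ->
  smooth_on U f -> smooth_on U g -> smooth_on U (fun p => f p - g p).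
Proof. by move=> oU sf sg; apply: smoothD => //; exact: smoothN. Qed.

Lemma smoothZ m n U (a : R * R -> R) (F : R * R -> 'M[R]_(m, n)) : open U ->
  smooth_on U a -> smooth_on U F -> smooth_on U (fun p => a p *: F p).
Proof.
move=> oU sa sF; apply: smooth_mx => // i j.
apply: (@smooth_on_eq _ _ (fun p => a p * F p i j)) => // [p _|].
  by rewrite mxE.
by apply: smoothM => //; exact: smooth_coord.
Qed.

Lemma smooth_derive W U (f : R * R -> W) v : open U ->
  smooth_on U f -> smooth_on U (fun p => 'D_v f p).
Proof.
move=> oU sf.
apply: (@smooth_on_eq _ _ (fun p => v.1 *: du f p + v.2 *: dv f p)) => //.
  by move=> q Uq; rewrite -derive_uv //; exact: smooth_differentiable sf Uq.
apply: smoothD => // k; apply: CkZ => //; [exact: smooth_du|exact: smooth_dv].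
Qed.

Lemma smooth_sum U n (f : 'I_n -> R * R -> R) : open U ->
  (forall i, smooth_on U (f i)) -> smooth_on U (fun p => \sum_i f i p).
Proof.
move=> oU; elim: n f => [|n IHn] f sf.
  apply: (@smooth_on_eq _ _ (fun=> 0)) => // [p _|]; first by rewrite big_ord0.
  exact: smooth_cst.
apply: (@smooth_on_eq _ _ (fun p => f ord0 p + \sum_i f (lift ord0 i) p)) => //.
  by move=> p _; rewrite big_ord_recl.
apply: smoothD => //; exact: IHn.
Qed.

Lemma smooth_dot U (F G : R * R -> 'cV[R]_4) : open U ->
  smooth_on U F -> smooth_on U G -> smooth_on U (fun p => dot (F p) (G p)).
Proof.
move=> oU sF sG; apply: smooth_sum => // i; apply: smoothM => //.
  by apply: smoothM => //; [exact: smooth_cst|exact: smooth_coord].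
exact: smooth_coord.
Qed.

Lemma differentiable_chain (phi : R -> R) (g : R * R -> R) p dphi :
  is_derive (g p) 1 phi dphi -> differentiable g p ->
  differentiable (phi \o g) p.
Proof.
move=> dphi' dg; apply: differentiable_comp => //.
by apply/derivable1_diffP; exact: ex_derive.
Qed.

Lemma derive_chain (phi : R -> R) (g : R * R -> R) p v dphi :
  is_derive (g p) 1 phi dphi -> differentiable g p ->
  'D_v (phi \o g) p = dphi * 'D_v g p.
Proof.
move=> dphi' dg; rewrite deriveE; last exact: differentiable_chain dphi' dg.
have dph : differentiable phi (g p) by apply/derivable1_diffP; exact: ex_derive.
rewrite diff_comp //= [RHS]mulrC -[in RHS](@derive_val _ _ _ _ _ _ _ dphi').
by rewrite !deriveE // -[RHS]linearZ /= [_ *: 1]mulr1.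
Qed.

(** A bootstrap: when the derivative of phi is an expression in phi, as for exp and
    the inverse, regularity of phi \o g up to some order gives that of dphi \o g,
    and hence regularity of phi \o g one order higher. *)
Lemma smooth_chain (phi dphi : R -> R) U (g : R * R -> R) : open U ->
  (forall p, U p -> is_derive (g p) 1 phi (dphi (g p))) ->
  (forall k, Ck_on k U (phi \o g) -> Ck_on k U (dphi \o g)) ->
  smooth_on U g -> smooth_on U (phi \o g).
Proof.
move=> oU phiP Cdphi sg; have df p : U p -> differentiable (phi \o g) p.
  move=> Up; apply: differentiable_chain (phiP p Up) _.
  exact: smooth_differentiable sg Up.
elim=> [|k IHk]; first by move=> p /df /differentiable_continuous.
split; first exact: df.
- apply: Ck_on_eq oU _ (CkM oU (Cdphi _ IHk) (smooth_du sg k)) => q Uq.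
  by rewrite /du (derive_chain _ (phiP q Uq)) //; exact: smooth_differentiable sg Uq.
- apply: Ck_on_eq oU _ (CkM oU (Cdphi _ IHk) (smooth_dv sg k)) => q Uq.
  by rewrite /dv (derive_chain _ (phiP q Uq)) //; exact: smooth_differentiable sg Uq.
Qed.

Lemma smooth_exp U (g : R * R -> R) : open U ->
  smooth_on U g -> smooth_on U (fun p => expR (g p)).
Proof.
by move=> oU sg; apply: (@smooth_chain expR expR) => // p Up; exact: is_derive_expR.
Qed.

Lemma smoothV U (g : R * R -> R) : open U -> (forall p, U p -> g p != 0) ->
  smooth_on U g -> smooth_on U (fun p => (g p)^-1).
Proof.
move=> oU g0 sg.
apply: (@smooth_chain (fun y => y^-1) (fun y => - y^-1 * y^-1)) => //.
- move=> p Up.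
  apply: is_derive_eq; first by apply: is_deriveV; exact: g0.
  by rewrite [LHS]mulr1 expr2 invfM mulNr.
- move=> k Ck.
  apply: (@Ck_on_eq _ _ _ (fun p => -1 * (g p)^-1 * (g p)^-1)) => //.
    by move=> q _ /=; rewrite mulN1r.
  by apply: CkM => //; apply: CkM => //; exact: Ck_cst.
Qed.

Lemma smooth_ln U (g : R * R -> R) : open U -> (forall p, U p -> 0 < g p) ->
  smooth_on U g -> smooth_on U (fun p => ln (g p)).
Proof.
move=> oU g0 sg; apply: (@smooth_chain (@ln R) (fun y => y^-1)) => //.
  by move=> p Up; apply: is_derive1_ln; exact: g0.
by move=> k _; apply: smoothV => // p /g0; exact: lt0r_neq0.
Qed.

End Calculus.

(** * Mean values and mixed derivatives *)

Section MeanValue.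
Variable R : realType.
Implicit Types (U : set (R * R)) (p q v : R * R).

Lemma is_derive_line (f : R * R -> R) p v (s : R) :
  differentiable f (p + s *: v) ->
  is_derive s 1 (fun t : R => f (p + t *: v)) ('D_v f (p + s *: v)).
Proof.
move=> df.
have dv : is_diff s (fun t : R => t *: v) (fun t => t *: v).
  exact: is_diff_scalel.
have dl : is_diff s (fun t : R => p + t *: v) (0 + (fun t => t *: v)).
  exact: (@is_diffD _ _ _ (cst p) (fun t : R => t *: v)).
have dfl : differentiable (f \o (fun t : R => p + t *: v)) s.
  by apply: differentiable_comp; [exact: ex_diff|exact: df].
apply: DeriveDef; first by apply: diff_derivable.
rewrite deriveE; last exact: dfl.
rewrite diff_comp; [|exact: ex_diff|exact: df].
by rewrite diff_val /= fctE add0r scale1r deriveE.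
Qed.

Lemma mean_value_line (f : R * R -> R) p v (t : R) : 0 < t ->
  (forall s, 0 <= s <= t -> differentiable f (p + s *: v)) ->
  exists2 s, 0 <= s <= t & f (p + t *: v) - f p = t * 'D_v f (p + s *: v).
Proof.
move=> t0 df.
have dl s : 0 <= s <= t ->
    is_derive s 1 (fun t : R => f (p + t *: v)) ('D_v f (p + s *: v)).
  by move=> st; apply: is_derive_line; exact: df.
have [||s st E] := @MVT R (fun t => f (p + t *: v))
    (fun s => 'D_v f (p + s *: v)) 0 t t0.
- by move=> s; rewrite in_itv /= => /andP[s0 st]; apply: dl; rewrite !ltW.
- apply: derivable_within_continuous => s; rewrite in_itv /= => /dl ?.
  exact: ex_derive.
exists s; first by move: st; rewrite in_itv /= => /andP[? ?]; rewrite !ltW.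
by move: E; rewrite scale0r addr0 subr0 mulrC.
Qed.

Lemma constant_segment (f : R * R -> R) p q :
  (forall s, 0 <= s <= 1 -> differentiable f (p + s *: (q - p))) ->
  (forall s, 0 <= s <= 1 -> 'D_(q - p) f (p + s *: (q - p)) = 0) ->
  f q = f p.
Proof.
move=> df D0; have [s s01] := mean_value_line (@ltr01 R) df.
by rewrite scale1r (addrC p) subrK D0 // mulr0 => /eqP; rewrite subr_eq0 => /eqP.
Qed.

Lemma second_difference U (f : R * R -> R) p v w (t : R) : open U ->
  smooth_on U f -> 0 < t ->
  (forall a b, 0 <= a <= t -> 0 <= b <= t -> U (p + a *: v + b *: w)) ->
  exists a b, [/\ 0 <= a <= t, 0 <= b <= t &
    f (p + t *: v + t *: w) - f (p + t *: v) - (f (p + t *: w) - f p) =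
    t * (t * 'D_w (fun q => 'D_v f q) (p + a *: v + b *: w))].
Proof.
move=> oU sf t0 Uab; have t00 : 0 <= t <= t by rewrite lexx ltW.
have z0 : 0 <= (0 : R) <= t by rewrite lexx ltW.
pose phi s := f (p + t *: w + s *: v) - f (p + s *: v).
pose dphi s := 'D_v f (p + t *: w + s *: v) - 'D_v f (p + s *: v).
have Dphi s : 0 <= s <= t -> is_derive s 1 phi (dphi s).
  move=> st; apply: is_deriveB; apply: is_derive_line.
    by rewrite addrAC; apply: (smooth_differentiable sf); exact: Uab.
  rewrite -[p + _]addr0 -[X in _ + X](scale0r w).
  by apply: (smooth_differentiable sf); exact: Uab.
have [||a at_ E] := @MVT R phi dphi 0 t t0.
- by move=> s; rewrite in_itv /= => /andP[s0 st]; apply: Dphi; rewrite !ltW.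
- apply: derivable_within_continuous => s; rewrite in_itv /= => /Dphi ?.
  exact: ex_derive.
have {}at_ : 0 <= a <= t by move: at_; rewrite in_itv /= => /andP[? ?]; rewrite !ltW.
have [b b1 b2] := @mean_value_line (fun q => 'D_v f q) (p + a *: v) w t t0
   (fun b bt => smooth_differentiable (smooth_derive v oU sf) (Uab a b at_ bt)).
exists a, b; split=> //; rewrite -b2.
move: E; rewrite /phi /dphi subr0 !scale0r !addr0 => E.
by rewrite [RHS]mulrC [p + t *: v + _]addrAC E [p + t *: w + _]addrAC.
Qed.

Lemma continuous_dist (f : R * R -> R) p e : {for p, continuous f} -> 0 < e ->
  \forall q \near p, `|f p - f q| < e.
Proof. move=> cf; exact: (@cvgrPdist_lt _ _ _ _ _ _ _).1 cf e. Qed.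

Lemma dist_le_halves (a b a' b' e : R) : a' = b' ->
  `|a - a'| < e / 2 -> `|b - b'| < e / 2 -> `|a - b| <= e.
Proof.
move=> <- aa bb; have -> : a - b = (a - a') - (b - a') by ring.
apply: le_trans (ler_normB _ _) _; rewrite [leRHS](splitr e).
by rewrite lerD // ltW.
Qed.

(** Clairaut's theorem: the two mixed derivatives are limits of the same second
    difference of f over small parallelograms. *)
Lemma derive_swap U (f : R * R -> R) p v w : open U -> U p ->
  smooth_on U f ->
  'D_v (fun q => 'D_w f q) p = 'D_w (fun q => 'D_v f q) p.
Proof.
move=> oU Up sf.
pose A := fun q => 'D_v (fun q => 'D_w f q) q.
pose B := fun q => 'D_w (fun q => 'D_v f q) q.
have cA : {for p, continuous A}.
  apply: differentiable_continuous; apply: smooth_differentiable Up.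
  by apply: smooth_derive => //; exact: smooth_derive.
have cB : {for p, continuous B}.
  apply: differentiable_continuous; apply: smooth_differentiable Up.
  by apply: smooth_derive => //; exact: smooth_derive.
apply/eqP; rewrite -subr_eq0 -normr_le0; apply/ler_addgt0Pr => e e0.
rewrite add0r.
have e20 : 0 < e / 2 by rewrite divr_gt0.
have nU : nbhs p U by apply: open_nbhs_nbhs.
have nV : nbhs p [set q | U q /\ `|A p - A q| < e / 2 /\ `|B p - B q| < e / 2].
  exact: (filterI nU
    (filterI (continuous_dist cA e20) (continuous_dist cB e20))).
have /nbhs_ballP[d /= d0 dP] := nV.
pose M := `|v| + `|w| + 1.
have M0 : 0 < M by rewrite ltr_wpDl // addr_ge0.
pose t := d / M / 2; have t0 : 0 < t by rewrite !divr_gt0.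
have ball_ab a b : 0 <= a <= t -> 0 <= b <= t -> ball p d (p + a *: v + b *: w).
  move=> /andP[a0 at_] /andP[b0 bt]; rewrite -ball_normE /ball_ /=.
  rewrite -addrA opprD addrA subrr add0r normrN.
  apply: le_lt_trans (ler_normD _ _) _; rewrite !normrZ !ger0_norm //.
  have : a * `|v| + b * `|w| <= t * M.
    rewrite /M !mulrDr mulr1 ler_wpDr ?(ltW t0) //.
    by apply: lerD; apply: ler_wpM2r.
  move=> /le_lt_trans; apply.
  by rewrite /t mulrAC divfK ?gt_eqF // ltr_pdivrMr // ltr_pMr // ltr1n.
have [|a [b [a1 b1 E1]]] := @second_difference U f p v w t oU sf t0.
  by move=> a b a1 b1; have [] := dP _ (ball_ab a b a1 b1).
have [|b' [a' [b2 a2 E2]]] := @second_difference U f p w v t oU sf t0.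
  move=> b' a' b2 a2; rewrite addrAC.
  by have [] := dP _ (ball_ab a' b' a2 b2).
have := dP _ (ball_ab a b a1 b1); have := dP _ (ball_ab a' b' a2 b2).
set q1 := p + a *: v + b *: w; set q2 := p + a' *: v + b' *: w.
have {E1 E2} AB : A q2 = B q1.
  have : t * (t * A q2) = t * (t * B q1).
    apply: etrans E1; rewrite /q2 [X in A X]addrAC; apply: etrans (esym E2) _.
    by rewrite [X in f X - _ - _ = _]addrAC; ring.
  by do 2!move/(mulfI (lt0r_neq0 t0)).
move=> [_ [Aq2 _]] [_ [_ Bq1]]; exact: (dist_le_halves AB Aq2 Bq1).
Qed.

Lemma convex_ball_segment p e q (s : R) : 0 <= s <= 1 ->
  ball p e q -> ball p e (p + s *: (q - p)).
Proof.
move=> /andP[s0 s1].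
rewrite -ball_normE /ball_ /= opprD addrA subrr add0r normrN => pq.
rewrite normrZ ger0_norm // -normrN opprB; apply: le_lt_trans pq.
by rewrite ler_piMl.
Qed.

(** By the mean value theorem f is constant on balls, so that the points of U where f
    takes a given value form a set that is open and closed in U. *)
Lemma constant_connected U (f : R * R -> R) : open U -> connected U ->
  (forall p, U p -> differentiable f p) ->
  (forall p v, U p -> 'D_v f p = 0) ->
  forall p q, U p -> U q -> f q = f p.
Proof.
move=> oU cU df D0 p q Up Uq.
have loc r : U r -> \forall z \near r, U z /\ f z = f r.
  move=> Ur; have : nbhs r U by apply: open_nbhs_nbhs.
  move=> /nbhs_ballP[e /= e0 reU]; apply/nbhs_ballP; exists e => //= z rz.
  split; first exact: reU.
  apply: constant_segment => s s01.
    by apply/df/reU/convex_ball_segment.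
  by apply/D0/reU/convex_ball_segment.
pose B := [set r | U r /\ f r = f p].
have -> : f q = f p; last by [].
suff BU : B = U by move: Uq; rewrite -BU => -[].
apply: cU; first by exists p.
- exists B; last by rewrite setIidr // => r [].
  rewrite openE => r [Ur rp]; rewrite /interior.
  by apply: filterS (loc r Ur) => z [Uz zr]; split=> //; rewrite zr.
- exists (~` [set r | U r /\ f r <> f p]).
    rewrite closedC openE => r [Ur rp]; rewrite /interior.
    by apply: filterS (loc r Ur) => z [Uz zr]; split=> //; rewrite zr.
  apply/seteqP; split => r /=; first by move=> [Ur rp]; split=> // -[].
  by move=> [Ur nr]; split=> //; apply: contrapT => np; apply: nr.
Qed.

End MeanValue.

(** * The scalar product and the determinant *)

Definition i40 : 'I_4 := @Ordinal 4 0 isT.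
Definition i41 : 'I_4 := @Ordinal 4 1 isT.
Definition i42 : 'I_4 := @Ordinal 4 2 isT.
Definition i43 : 'I_4 := @Ordinal 4 3 isT.

Lemma sum_ord4 (V : nmodType) (F : 'I_4 -> V) :
  \sum_i F i = F i40 + F i41 + F i42 + F i43.
Proof.
rewrite !big_ord_recl big_ord0 addr0 !addrA.
by do 3?[congr (_ + _)]; congr F; apply: val_inj.
Qed.

Section Dot.
Variable S : comNzRingType.
Implicit Types (a b c : 'cV[S]_4) (k : S).

Lemma dotE a b : dot a b = - (a i40 0 * b i40 0) + a i41 0 * b i41 0
  - a i42 0 * b i42 0 + a i43 0 * b i43 0.
Proof. by rewrite /dot sum_ord4 /=; ring. Qed.

Lemma dotC a b : dot a b = dot b a.
Proof. by rewrite !dotE; ring. Qed.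

Lemma dotDl a b c : dot (a + b) c = dot a c + dot b c.
Proof. by rewrite !dotE !mxE; ring. Qed.

Lemma dotDr a b c : dot a (b + c) = dot a b + dot a c.
Proof. by rewrite !dotE !mxE; ring. Qed.

Lemma dotZl k a b : dot (k *: a) b = k * dot a b.
Proof. by rewrite !dotE !mxE; ring. Qed.

Lemma dotZr k a b : dot a (k *: b) = k * dot a b.
Proof. by rewrite !dotE !mxE; ring. Qed.

Lemma dotNl a b : dot (- a) b = - dot a b.
Proof. by rewrite !dotE !mxE; ring. Qed.

Lemma dotNr a b : dot a (- b) = - dot a b.
Proof. by rewrite !dotE !mxE; ring. Qed.

Lemma dotBl a b c : dot (a - b) c = dot a c - dot b c.
Proof. by rewrite dotDl dotNl. Qed.

Lemma dotBr a b c : dot a (b - c) = dot a b - dot a c.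
Proof. by rewrite dotDr dotNr. Qed.

Lemma dot0l a : dot 0 a = 0.
Proof. by rewrite dotE !mxE; ring. Qed.

Lemma dot0r a : dot a 0 = 0.
Proof. by rewrite dotC dot0l. Qed.

Lemma dot_eq a b : (forall c, dot a c = dot b c) -> a = b.
Proof.
move=> ab; apply/colP => i.
have dotd c : dot c (delta_mx i 0) = (-1) ^+ i.+1 * c i 0.
  rewrite /dot (bigD1 i) //= big1 ?addr0 ?mxE ?eqxx ?mulr1 // => j ji.
  by rewrite mxE (negPf ji) mulr0.
have := ab (delta_mx i 0); rewrite !dotd => /(congr1 (fun y => (-1) ^+ i.+1 * y)).
by rewrite !mulrA -!expr2 !sqrr_sign !mul1r.
Qed.

End Dot.

Section Det4.
Variable R : realType.
Implicit Types a b c d w : 'cV[R]_4.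

Definition det4 a b c d : R :=
  \det (\matrix_(i < 4, k < 4) ([:: a; b; c; d]`_k) i 0).

Lemma det_mx22 (f : nat -> nat -> R) :
  \det (\matrix_(i < 2, j < 2) f i j) = f 0 0 * f 1 1 - f 0 1 * f 1 0.
Proof.
rewrite (expand_det_row _ ord0) !big_ord_recl big_ord0 /cofactor !det_mx11 !mxE /=.
rewrite !expr0 /bump /=; ring.
Qed.

Definition det3f (f : nat -> nat -> R) : R :=
  f 0 0 * (f 1 1 * f 2 2 - f 1 2 * f 2 1)
  - f 0 1 * (f 1 0 * f 2 2 - f 1 2 * f 2 0)
  + f 0 2 * (f 1 0 * f 2 1 - f 1 1 * f 2 0).

Lemma det_mx33 (f : nat -> nat -> R) :
  \det (\matrix_(i < 3, j < 3) f i j) = det3f f.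
Proof.
rewrite (expand_det_row _ ord0) !big_ord_recl big_ord0 /cofactor.
have minor j : \det (row' ord0 (col' j (\matrix_(i < 3, j < 3) f i j))) =
    f 1 (bump j 0) * f 2 (bump j 1) - f 1 (bump j 1) * f 2 (bump j 0).
  rewrite -(det_mx22 (fun i k => f (bump 0 i) (bump j k))); congr (\det _).
  by apply/matrixP => i k; rewrite !mxE.
by rewrite !minor !mxE /= /bump /= /det3f; ring.
Qed.

Lemma det_mx44 (f : nat -> nat -> R) :
  \det (\matrix_(i < 4, j < 4) f i j) =
  \sum_(j < 4) (-1) ^+ j * f 0 j * det3f (fun i k => f (bump 0 i) (bump j k)).
Proof.
rewrite (expand_det_row _ ord0); apply: eq_bigr => j _.
rewrite /cofactor -(det_mx33 (fun i k => f (bump 0 i) (bump j k))) !mxE /= add0n.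
have -> : row' ord0 (col' j (\matrix_(i < 4, j < 4) f i j)) =
    \matrix_(i < 3, k < 3) f (bump 0 i) (bump j k).
  by apply/matrixP => i k; rewrite !mxE.
ring.
Qed.

Lemma det4E a b c d : det4 a b c d =
  \sum_(j < 4) (-1) ^+ j * ([:: a; b; c; d]`_j) i40 0 *
     det3f (fun i k => ([:: a; b; c; d]`_(bump j k)) (inord (bump 0 i)) 0).
Proof.
rewrite /det4.
have -> : \matrix_(i < 4, k < 4) ([:: a; b; c; d]`_k) i 0 =
  \matrix_(i < 4, k < 4) (fun i k => ([:: a; b; c; d]`_k) (inord i) 0) i k.
  by apply/matrixP => i k; rewrite !mxE inord_val.
rewrite (det_mx44 (fun i k => ([:: a; b; c; d]`_k) (inord i) 0)); apply: eq_bigr => j _; congr (_ * _ * _).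
by congr (_ _ 0); apply: val_inj; rewrite /= inordK.
Qed.

Lemma inord4 : ((inord 0 : 'I_4) = i40) * ((inord 1 : 'I_4) = i41) *
  ((inord 2 : 'I_4) = i42) * ((inord 3 : 'I_4) = i43).
Proof. by do ![split]; apply: val_inj; rewrite /= inordK. Qed.

(** The generalized cross product, characterized by [dot_cross4]. *)
Definition cross4 a b c : 'cV[R]_4 :=
  let m i j k := det3f (fun s t => ([:: a; b; c]`_t) ([:: i; j; k]`_s) 0) in
  \col_i [:: m i41 i42 i43; m i40 i42 i43; m i40 i41 i43; m i40 i41 i42]`_i.

Lemma dot_cross4 a b c d : dot (cross4 a b c) d = det4 a b c d.
Proof.
rewrite det4E dotE !mxE /= sum_ord4 /det3f /bump /= !inord4; ring.
Qed.

Lemma cross4_gram a b c : dot (cross4 a b c) (cross4 a b c) =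
  dot a a * (dot b b * dot c c - dot b c ^+ 2)
  - dot a b * (dot a b * dot c c - dot b c * dot a c)
  + dot a c * (dot a b * dot b c - dot b b * dot a c).
Proof. by rewrite !dotE !mxE /= /det3f /=; ring. Qed.

Lemma det4_mul (A : 'M[R]_4) a b c d :
  det4 (A *m a) (A *m b) (A *m c) (A *m d) = \det A * det4 a b c d.
Proof.
rewrite /det4 -det_mulmx; congr (\det _); apply/matrixP => i k; rewrite !mxE.
by case: k => [[|[|[|[|k]]]] Hk] //=; rewrite !mxE; apply: eq_bigr => j _;
  rewrite !mxE.
Qed.

(** In a basis whose first two vectors are fixed, the determinant only sees the
    components along the two others. *)
Lemma det4_shear a b c d (s1 t1 s2 t2 x y z w : R) :
  det4 a b (s1 *: a + t1 *: b + x *: c + y *: d)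
           (s2 *: a + t2 *: b + z *: c + w *: d) = (x * w - y * z) * det4 a b c d.
Proof.
rewrite !det4E !sum_ord4 /det3f /bump /= !inord4 !mxE; ring.
Qed.

Lemma det4_combine a b c d (x y z w : R) :
  det4 (x *: a + y *: b) (z *: a + w *: b) c d = (x * w - y * z) * det4 a b c d.
Proof.
rewrite !det4E !sum_ord4 /det3f /bump /= !inord4 !mxE; ring.
Qed.

Lemma det4_repeat a b c :
  [/\ det4 a b c a = 0, det4 a b c b = 0 & det4 a b c c = 0].
Proof. by split; rewrite det4E sum_ord4 /det3f /bump /= !inord4; ring. Qed.

End Det4.

(** * Null frames and vectors over the double numbers *)

Section Frames.
Variable R : realType.
Implicit Types (P Q n l w : 'cV[R]_4) (h : R).

Notation dot a b := (@Defs.dot R a b : R).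

(** P and Q span a Lorentzian plane along its null directions. *)
Definition null_pair P Q h : Prop :=
  [/\ dot P P = 0, dot Q Q = 0, dot P Q = h & h != 0].

Definition null_frame P Q n l h : Prop :=
  [/\ null_pair P Q h, dot n P = 0 /\ dot n Q = 0, dot l P = 0 /\ dot l Q = 0 &
      [/\ dot n n = -1, dot l l = 1 & dot n l = 0]].

(** Both sides have the same scalar products with the frame; P and Q are exchanged
    because they are null. *)
Lemma frame_expansion P Q n l h w : null_frame P Q n l h ->
  w = (dot w Q / h) *: P + (dot w P / h) *: Q - dot w n *: n + dot w l *: l.
Proof.
move=> [[PP QQ PQ h0] [nP nQ] [lP lQ] [nn ll nl]].
pose F : 'M[R]_4 := \matrix_(i, k) ([:: P; Q; n; l]`_k) i 0.
pose g k := [:: h^-1 *: Q; h^-1 *: P; - n; l]`_k.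
pose L : 'M[R]_4 := \matrix_(k, j) ((-1) ^+ j.+1 * (g k) j 0).
have LF : L *m F = 1%:M.
  apply/matrixP => i k; rewrite !mxE.
  transitivity (dot (g i) ([:: P; Q; n; l]`_k)).
    by apply: eq_bigr => j _; rewrite !mxE.
  case: i k => [[|[|[|[|i]]]] Hi] [[|[|[|[|k]]]] Hk] //=;
   by rewrite /g /= ?dotZl ?dotNl ?[dot Q P]dotC ?[dot P n]dotC ?[dot P l]dotC
     ?[dot Q n]dotC ?[dot Q l]dotC ?[dot l n]dotC
     ?PP ?QQ ?PQ ?nP ?nQ ?lP ?lQ ?nn ?ll ?nl ?mulr0 ?oppr0 ?opprK ?mulVf.
have FL := mulmx1C LF.
rewrite -[LHS]mul1mx -FL -mulmxA.
apply/colP => i.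
have Lw (k : 'I_4) : (L *m w) k 0 = dot (g k) w.
  by rewrite mxE /L; apply: eq_bigr => j _; rewrite mxE.
rewrite [LHS]mxE sum_ord4 !Lw !mxE /g /= !dotZl !dotNl ![dot _ w]dotC; ring.
Qed.

Lemma dot_expansion P Q n l h w w' : null_frame P Q n l h ->
  dot w w' = (dot w Q * dot w' P + dot w P * dot w' Q) / h
     - dot w n * dot w' n + dot w l * dot w' l.
Proof.
move=> fr; rewrite {1}(frame_expansion w fr) !dotDl !dotNl !dotZl.
by rewrite ![dot _ w']dotC; ring.
Qed.

Lemma null_frame_det4 P Q n l h : null_frame P Q n l h -> det4 P Q n l ^+ 2 = h ^+ 2.
Proof.
move=> fr; have [[PP QQ PQ h0] [nP nQ] [lP lQ] [nn ll nl]] := fr.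
have [cP cQ cn] := det4_repeat P Q n.
have := dot_expansion (cross4 P Q n) (cross4 P Q n) fr.
rewrite cross4_gram !dot_cross4 cP cQ cn PP QQ PQ nn [dot P n]dotC [dot Q n]dotC nP nQ.
by move=> E; apply: etrans (etrans _ (esym E)) _; field.
Qed.

Lemma det4_frame P Q n l h w w' : null_frame P Q n l h ->
  det4 P Q w w' = (dot w l * dot w' n - dot w n * dot w' l) * det4 P Q n l.
Proof.
move=> fr; rewrite {1}(frame_expansion w fr) {1}(frame_expansion w' fr) -!scaleNr.
by rewrite det4_shear; congr (_ * _); rewrite /GRing.scale /=; ring.
Qed.

Lemma null_frame_cross4 P Q n h : null_pair P Q h ->
  dot n P = 0 -> dot n Q = 0 -> dot n n = -1 ->
  null_frame P Q n (h^-1 *: cross4 P Q n) h.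
Proof.
move=> [PP QQ PQ h0] nP nQ nn; split=> //.
- have [e1 e2 _] := det4_repeat P Q n.
  by rewrite !dotZl !dot_cross4 e1 e2 mulr0.
- have [_ _ e] := det4_repeat P Q n.
  split=> //; last by rewrite dotZr dotC dot_cross4 e mulr0.
  rewrite dotZl dotZr cross4_gram PP QQ PQ nn [dot P n]dotC [dot Q n]dotC nP nQ.
  by field.
Qed.

Lemma null_pair_orth0 P Q h (a b : R) : null_pair P Q h ->
  dot (a *: P + b *: Q) P = 0 -> dot (a *: P + b *: Q) Q = 0 ->
  a = 0 /\ b = 0.
Proof.
move=> [PP QQ PQ h0]; rewrite !dotDl !dotZl PP QQ PQ [dot Q P]dotC PQ.
rewrite !mulr0 addr0 add0r => /eqP + /eqP.
by rewrite !mulf_eq0 (negPf h0) !orbF => /eqP -> /eqP ->.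
Qed.

Lemma null_pair_dot P Q h (a b c d : R) : null_pair P Q h ->
  dot (a *: P + b *: Q) (c *: P + d *: Q) = h * (a * d + b * c).
Proof.
move=> [PP QQ PQ h0]; rewrite !dotDl !dotDr !dotZl !dotZr PP QQ [dot Q P]dotC PQ.
ring.
Qed.

Definition tangent_part P Q h w := (dot w Q / h) *: P + (dot w P / h) *: Q.
Definition normal_part P Q h w := w - tangent_part P Q h w.

Lemma normal_part_orth P Q h w : null_pair P Q h ->
  dot (normal_part P Q h w) P = 0 /\ dot (normal_part P Q h w) Q = 0.
Proof.
move=> [PP QQ PQ h0]; rewrite /normal_part /tangent_part.
by rewrite !dotBl !dotDl !dotZl PP QQ PQ [dot Q P]dotC PQ; split; field.
Qed.

Lemma normal_part_id P Q h w : dot w P = 0 -> dot w Q = 0 ->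
  normal_part P Q h w = w.
Proof.
by move=> wP wQ; rewrite /normal_part /tangent_part wP wQ mul0r !scale0r addr0 subr0.
Qed.

Lemma tangent_part_lin P Q h a b w : null_pair P Q h ->
  tangent_part P Q h (a *: P + b *: Q + w) =
  a *: P + b *: Q + tangent_part P Q h w.
Proof.
move=> [PP QQ PQ h0]; rewrite /tangent_part !dotDl !dotZl PP QQ PQ [dot Q P]dotC PQ.
by apply/colP => i; rewrite !mxE; field.
Qed.

Lemma normal_part_lin P Q h a b w : null_pair P Q h ->
  normal_part P Q h (a *: P + b *: Q + w) = normal_part P Q h w.
Proof.
move=> nPQ; rewrite /normal_part tangent_part_lin //.
by apply/colP => i; rewrite !mxE; ring.
Qed.

Lemma normal_partD P Q h w w' :
  normal_part P Q h (w + w') = normal_part P Q h w + normal_part P Q h w'.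
Proof.
by rewrite /normal_part /tangent_part !dotDl; apply/colP => i; rewrite !mxE; ring.
Qed.

Lemma normal_partZ P Q h a w :
  normal_part P Q h (a *: w) = a *: normal_part P Q h w.
Proof.
by rewrite /normal_part /tangent_part !dotZl; apply/colP => i; rewrite !mxE; ring.
Qed.

Lemma dot_normal_part P Q h w w' : null_pair P Q h ->
  dot (normal_part P Q h w) (normal_part P Q h w') =
  dot w w' - (dot w P * dot w' Q + dot w Q * dot w' P) / h.
Proof.
move=> [PP QQ PQ h0]; rewrite /normal_part /tangent_part.
rewrite !dotBl !dotBr !dotDl !dotDr !dotZl !dotZr PP QQ PQ [dot Q P]dotC PQ.
by rewrite [dot P w']dotC [dot Q w']dotC; field.
Qed.

End Frames.

Section Projection.

(** The value chosen by [proj] is unique as soon as N and T meet in 0 only. *)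
Lemma proj_eq (V : zmodType) (N T : set V) (n w : V) :
  (forall n n', N n -> N n' -> N (n - n')) ->
  (forall t t', T t -> T t' -> T (t - t')) ->
  (forall v, N v -> T v -> v = 0) ->
  N n -> T (w - n) -> Defs.proj N T w = n.
Proof.
move=> NB TB NT0 Nn Tn; apply: xget_subset1 => // a b [Na Ta] [Nb Tb].
apply/eqP; rewrite -subr_eq0; apply/eqP; apply: NT0; first exact: NB.
have -> : a - b = (w - b) - (w - a) by rewrite opprB [RHS]addrC subrKA.
exact: TB.
Qed.

End Projection.

Section DoubleVectors.
Variable R : realType.
Implicit Types (a b : 'cV[R]_4) (w : 'cV[dnum R]_4).

Definition reD w : 'cV[R]_4 := map_mx (@dre R) w.
Definition imD w : 'cV[R]_4 := map_mx (@Defs.dim R) w.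

Definition mkD a b : 'cV[dnum R]_4 := toD a + dj *: toD b.

Lemma dnum_eq (s t : dnum R) : dre s = dre t -> Defs.dim s = Defs.dim t -> s = t.
Proof. by case: s t => [? ?] [? ?] /= -> ->. Qed.

Lemma dreD (s t : dnum R) : dre (s + t) = dre s + dre t. Proof. by []. Qed.
Lemma dimD (s t : dnum R) : Defs.dim (s + t) = Defs.dim s + Defs.dim t.
Proof. by []. Qed.
Lemma dre0 : dre (0 : dnum R) = 0. Proof. by []. Qed.
Lemma dim0 : Defs.dim (0 : dnum R) = 0. Proof. by []. Qed.
Lemma dreM (s t : dnum R) :
  dre (s * t) = dre s * dre t + Defs.dim s * Defs.dim t. Proof. by []. Qed.
Lemma dimM (s t : dnum R) :
  Defs.dim (s * t) = dre s * Defs.dim t + Defs.dim s * dre t. Proof. by []. Qed.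
Lemma dreN (s : dnum R) : dre (- s) = - dre s. Proof. by []. Qed.
Lemma dimN (s : dnum R) : Defs.dim (- s) = - Defs.dim s. Proof. by []. Qed.

Lemma reD_mkD a b : reD (mkD a b) = a.
Proof. by apply/colP => i; rewrite !mxE dreD dreM /=; ring. Qed.

Lemma imD_mkD a b : imD (mkD a b) = b.
Proof. by apply/colP => i; rewrite !mxE dimD dimM /=; ring. Qed.

Lemma mkDK w : mkD (reD w) (imD w) = w.
Proof.
by apply/colP => i; apply: dnum_eq; rewrite !mxE ?dreD ?dimD ?dreM ?dimM /=; ring.
Qed.

Lemma reDB w w' : reD (w - w') = reD w - reD w'.
Proof. by apply/colP => i; rewrite !mxE. Qed.

Lemma imDB w w' : imD (w - w') = imD w - imD w'.
Proof. by apply/colP => i; rewrite !mxE. Qed.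

Lemma dot_mkD a b : dot (mkD a b) (mkD a b) =
  DNum (dot a a + dot b b) (2 * dot a b).
Proof.
apply: dnum_eq; rewrite !dotE ?dreD ?dreN ?dreM ?dimD ?dimN ?dimM !mxE /=.
  rewrite ?dreD ?dreN ?dreM ?dimD ?dimN ?dimM /=; ring.
rewrite ?dreD ?dreN ?dreM ?dimD ?dimN ?dimM /=; ring.
Qed.

Lemma reDD w w' : reD (w + w') = reD w + reD w'.
Proof. by apply/colP => i; rewrite !mxE. Qed.

Lemma imDD w w' : imD (w + w') = imD w + imD w'.
Proof. by apply/colP => i; rewrite !mxE. Qed.

Lemma reD_dj w : reD (dj *: w) = imD w.
Proof. by apply/colP => i; rewrite !mxE dreM /= mul0r add0r mul1r. Qed.

Lemma imD_dj w : imD (dj *: w) = reD w.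
Proof. by apply/colP => i; rewrite !mxE dimM /= mul0r add0r mul1r. Qed.

Lemma reD_dreal k w : reD (dreal k *: w) = k *: reD w.
Proof. by apply/colP => i; rewrite !mxE dreM /= mul0r addr0. Qed.

Lemma imD_dreal k w : imD (dreal k *: w) = k *: imD w.
Proof. by apply/colP => i; rewrite !mxE dimM /= mul0r addr0. Qed.

Lemma mkD_djD a b c d : mkD a b + dj *: mkD c d = mkD (a + d) (b + c).
Proof.
by rewrite -[LHS]mkDK reDD imDD reD_dj imD_dj 2!reD_mkD 2!imD_mkD.
Qed.

Lemma mkDZ (k : R) a b : dreal k *: mkD a b = mkD (k *: a) (k *: b).
Proof. by rewrite -[LHS]mkDK reD_dreal imD_dreal reD_mkD imD_mkD. Qed.

Definition subspace (S : set 'cV[R]_4) : Prop :=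
  S 0 /\ forall (k : R) a b, S a -> S b -> S (k *: a + b).

Lemma subspaceB (S : set 'cV[R]_4) a b : subspace S -> S a -> S b -> S (a - b).
Proof. by move=> [_ SD] Sa Sb; rewrite addrC -scaleN1r; exact: SD. Qed.

(** Multiplication by j exchanges the real and the imaginary part, so that the double
    span of a real subspace is its complexification. *)
Lemma dspanE (S : set 'cV[R]_4) w : subspace S ->
  dspan S w <-> S (reD w) /\ S (imD w).
Proof.
move=> [S0 SD]; split.
  move=> [n [c [s [Ss ->]]]].
  have Ssum (d : 'I_n -> R) : S (\sum_i d i *: s i).
    by elim/big_ind: _ => [//|x y Sx Sy|i _];
      [rewrite -[x]scale1r; exact: SD|rewrite -[_ *: _]addr0; exact: SD].
  have -> : reD (\sum_i c i *: toD (s i)) = \sum_i dre (c i) *: s i.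
    apply/colP => i; rewrite mxE !summxE.
    by rewrite (big_morph (@dre R) dreD dre0); apply: eq_bigr => k _;
      rewrite !mxE dreM /=; ring.
  have -> : imD (\sum_i c i *: toD (s i)) = \sum_i Defs.dim (c i) *: s i.
    apply/colP => i; rewrite mxE !summxE.
    by rewrite (big_morph (@Defs.dim R) dimD dim0); apply: eq_bigr => k _;
      rewrite !mxE dimM /=; ring.
  by split; exact: Ssum.
move=> [Sr Si].
exists 2, (fun i : 'I_2 => if i == ord0 then 1 else dj),
  (fun i : 'I_2 => if i == ord0 then reD w else imD w); split.
  by move=> i; case: ifP.
by rewrite !big_ord_recl big_ord0 /= addr0 scale1r [RHS]mkDK.
Qed.

End DoubleVectors.

(** * Null coordinates *)

(** The partial derivatives in the null coordinates xi = (u + v) / 2 and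
    eta = (u - v) / 2, in which u = xi + eta and v = xi - eta. They are locked so
    that unification never unfolds a derivative into a limit. *)
HB.lock Definition dxi (R : realType) (W : normedModType R) (f : R * R -> W) p : W :=
  'D_((1, 1) : R * R) f p.
HB.lock Definition deta (R : realType) (W : normedModType R) (f : R * R -> W) p : W :=
  'D_((1, -1) : R * R) f p.

Section NullDerivatives.
Variable R : realType.
Implicit Types (U : set (R * R)) (p q v : R * R).

Lemma pair_scale2 (k : R) v : k *: v = (k * v.1, k * v.2).
Proof. by case: v. Qed.

Lemma is_diff_fst p : is_diff p (fun q : R * R => q.1) (fun q : R * R => q.1).
Proof.
have lin : GRing.linear_for *:%R (fun q : R * R => q.1) by move=> k a b.
pose f : {linear (R * R)%type -> R} := HB.pack (fun q : R * R => q.1)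
  (GRing.isLinear.Build _ _ _ _ _ lin).
have cf : continuous f by move=> q; exact: cvg_fst.
rewrite (_ : (fun _ => _) = f) //; apply: DiffDef.
  exact: linear_differentiable.
exact: diff_lin.
Qed.

Lemma differentiable_fstf (X : R * R -> R * R) p :
  differentiable X p -> differentiable (fun q => (X q).1) p.
Proof.
move=> dX; apply: differentiable_comp; first exact: dX.
by have [] := is_diff_fst (X p).
Qed.

Lemma derive_fst (X : R * R -> R * R) p v : differentiable X p ->
  'D_v (fun q => (X q).1) p = ('D_v X p).1.
Proof.
move=> dX; rewrite !deriveE //; last exact: differentiable_fstf.
have [df E] := is_diff_fst (X p).
by rewrite (diff_comp dX df) /= E.
Qed.

Lemma is_diff_snd p : is_diff p (fun q : R * R => q.2) (fun q : R * R => q.2).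
Proof.
have lin : GRing.linear_for *:%R (fun q : R * R => q.2) by move=> k a b.
pose f : {linear (R * R)%type -> R} := HB.pack (fun q : R * R => q.2)
  (GRing.isLinear.Build _ _ _ _ _ lin).
have cf : continuous f by move=> q; exact: cvg_snd.
rewrite (_ : (fun _ => _) = f) //; apply: DiffDef.
  exact: linear_differentiable.
exact: diff_lin.
Qed.

Lemma differentiable_sndf (X : R * R -> R * R) p :
  differentiable X p -> differentiable (fun q => (X q).2) p.
Proof.
move=> dX; apply: differentiable_comp; first exact: dX.
by have [] := is_diff_snd (X p).
Qed.

Lemma derive_snd (X : R * R -> R * R) p v : differentiable X p ->
  'D_v (fun q => (X q).2) p = ('D_v X p).2.
Proof.
move=> dX; rewrite !deriveE //; last exact: differentiable_sndf.
have [df E] := is_diff_snd (X p).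
by rewrite (diff_comp dX df) /= E.
Qed.

Lemma smooth_fst U (X : R * R -> R * R) : open U -> smooth_on U X ->
  smooth_on U (fun q => (X q).1).
Proof.
move=> oU sX k; elim: k X sX => [|k IHk] X sX.
  move=> p Up; apply: differentiable_continuous.
  by apply: differentiable_fstf; exact: smooth_differentiable sX Up.
apply/Ck_onSP; split.
- move=> p Up.
  by apply: differentiable_fstf; exact: smooth_differentiable sX Up.
- apply: Ck_on_eq oU _ (IHk _ (smooth_du sX)) => q Uq.
  by rewrite /du derive_fst //; exact: smooth_differentiable sX Uq.
- apply: Ck_on_eq oU _ (IHk _ (smooth_dv sX)) => q Uq.
  by rewrite /dv derive_fst //; exact: smooth_differentiable sX Uq.
Qed.

Lemma smooth_snd U (X : R * R -> R * R) : open U -> smooth_on U X ->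
  smooth_on U (fun q => (X q).2).
Proof.
move=> oU sX k; elim: k X sX => [|k IHk] X sX.
  move=> p Up; apply: differentiable_continuous.
  by apply: differentiable_sndf; exact: smooth_differentiable sX Up.
apply/Ck_onSP; split.
- move=> p Up.
  by apply: differentiable_sndf; exact: smooth_differentiable sX Up.
- apply: Ck_on_eq oU _ (IHk _ (smooth_du sX)) => q Uq.
  by rewrite /du derive_snd //; exact: smooth_differentiable sX Uq.
- apply: Ck_on_eq oU _ (IHk _ (smooth_dv sX)) => q Uq.
  by rewrite /dv derive_snd //; exact: smooth_differentiable sX Uq.
Qed.

Lemma smooth_pair U (a b : R * R -> R) : open U ->
  smooth_on U a -> smooth_on U b -> smooth_on U (fun q => (a q, b q)).
Proof.
move=> oU sa sb k; elim: k a b sa sb => [|k IHk] a b sa sb.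
  move=> p Up; apply: differentiable_continuous.
  by apply: differentiable_pair; exact: smooth_differentiable Up.
have dab p : U p -> differentiable (fun q => (a q, b q)) p.
  by move=> Up; apply: differentiable_pair; exact: smooth_differentiable Up.
apply/Ck_onSP; split; first exact: dab.
- apply: Ck_on_eq oU _ (IHk _ _ (smooth_du sa) (smooth_du sb)) => q Uq.
  rewrite [RHS]surjective_pairing /du.
  by rewrite -(derive_fst _ (dab q Uq)) -(derive_snd _ (dab q Uq)).
- apply: Ck_on_eq oU _ (IHk _ _ (smooth_dv sa) (smooth_dv sb)) => q Uq.
  rewrite [RHS]surjective_pairing /dv.
  by rewrite -(derive_fst _ (dab q Uq)) -(derive_snd _ (dab q Uq)).
Qed.

(** The differentials of xi and eta on the direction v. *)
Definition xip v : R := (v.1 + v.2) / 2.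
Definition etap v : R := (v.1 - v.2) / 2.

Lemma dxiE (W : normedModType R) (f : R * R -> W) :
  dxi f = fun p => 'D_((1, 1) : R * R) f p.
Proof. by rewrite dxi.unlock. Qed.

Lemma detaE (W : normedModType R) (f : R * R -> W) :
  deta f = fun p => 'D_((1, -1) : R * R) f p.
Proof. by rewrite deta.unlock. Qed.

Lemma derive_null (W : normedModType R) (f : R * R -> W) p v :
  differentiable f p -> 'D_v f p = xip v *: dxi f p + etap v *: deta f p.
Proof.
move=> df; rewrite dxiE detaE !deriveE // -!linearZ -linearD /=.
congr ('d f p _); rewrite !pair_scale2 /= /xip /etap.
by case: v => a b; rewrite pair_addE /=; congr pair; field.
Qed.

Lemma du_null (W : normedModType R) (f : R * R -> W) p :
  differentiable f p -> du f p = 2^-1 *: dxi f p + 2^-1 *: deta f p.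
Proof.
by move=> df; rewrite /du derive_null // /xip /etap /= addr0 subr0 mul1r.
Qed.

Lemma dv_null (W : normedModType R) (f : R * R -> W) p :
  differentiable f p -> dv f p = 2^-1 *: dxi f p - 2^-1 *: deta f p.
Proof.
by move=> df; rewrite /dv derive_null // /xip /etap /= add0r sub0r mul1r mulN1r scaleNr.
Qed.

Lemma dxi_uv (W : normedModType R) (f : R * R -> W) p :
  differentiable f p -> dxi f p = du f p + dv f p.
Proof. by move=> df; rewrite dxiE derive_uv //= !scale1r. Qed.

Lemma deta_uv (W : normedModType R) (f : R * R -> W) p :
  differentiable f p -> deta f p = du f p - dv f p.
Proof. by move=> df; rewrite detaE derive_uv //= scale1r scaleN1r. Qed.

Lemma dxi_eq_on (W : normedModType R) U (f g : R * R -> W) p : open U -> U p ->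
  (forall q, U q -> f q = g q) -> dxi f p = dxi g p.
Proof. by rewrite !dxiE; exact: derive_eq_on. Qed.

Lemma deta_eq_on (W : normedModType R) U (f g : R * R -> W) p : open U -> U p ->
  (forall q, U q -> f q = g q) -> deta f p = deta g p.
Proof. by rewrite !detaE; exact: derive_eq_on. Qed.

End NullDerivatives.

Section Leibniz.
Variable R : realType.
Implicit Types (U : set (R * R)) (p q v : R * R) (f g : R * R -> R).

Lemma derive_mul f g p v : differentiable f p -> differentiable g p ->
  'D_v (fun q => f q * g q) p = 'D_v f p * g p + f p * 'D_v g p.
Proof.
move=> df dg; rewrite [LHS]deriveM; [|exact: diff_derivable..].
by rewrite addrC [g p *: _]mulrC.
Qed.

Lemma derive_add (W : normedModType R) (f g : R * R -> W) p v :
  differentiable f p -> differentiable g p ->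
  'D_v (fun q => f q + g q) p = 'D_v f p + 'D_v g p.
Proof. by move=> df dg; rewrite [LHS]deriveD //; exact: diff_derivable. Qed.

Lemma derive_sub (W : normedModType R) (f g : R * R -> W) p v :
  differentiable f p -> differentiable g p ->
  'D_v (fun q => f q - g q) p = 'D_v f p - 'D_v g p.
Proof. by move=> df dg; rewrite [LHS]deriveB //; exact: diff_derivable. Qed.

Lemma derive_opp (W : normedModType R) (f : R * R -> W) p v :
  differentiable f p -> 'D_v (fun q => - f q) p = - 'D_v f p.
Proof. by move=> df; rewrite [LHS]deriveN //; exact: diff_derivable. Qed.

Lemma derive_scale n (a : R * R -> R) (F : R * R -> 'cV[R]_n) p v :
  differentiable a p -> differentiable F p ->
  'D_v (fun q => a q *: F q) p = 'D_v a p *: F p + a p *: 'D_v F p.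
Proof.
move=> da dF; have dF' : derivable F p v by exact: diff_derivable.
have daF i j : differentiable (fun q => (a q *: F q) i j) p.
  rewrite (_ : (fun q => _) = (fun q => a q * F q i j)).
    by apply: differentiableM => //; exact: differentiable_coordf.
  by apply/funext => q; rewrite mxE.
apply/colP => i; rewrite derive_coord; last first.
  by apply: diff_derivable; exact: differentiable_mx.
rewrite (_ : (fun q => _) = (fun q => a q * F q i 0)); last first.
  by apply/funext => q; rewrite mxE.
rewrite derive_mul //; last exact: differentiable_coordf.
by rewrite !mxE derive_coord.
Qed.

Lemma differentiable_scale n (a : R * R -> R) (F : R * R -> 'cV[R]_n) p :
  differentiable a p -> differentiable F p ->
  differentiable (fun q => a q *: F q) p.
Proof.
move=> da dF; apply: differentiable_mx => i j.
rewrite (_ : (fun q => _) = (fun q => a q * F q i j)).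
  by apply: differentiableM => //; exact: differentiable_coordf.
by apply/funext => q; rewrite mxE.
Qed.

Lemma differentiable_dot (F G : R * R -> 'cV[R]_4) p :
  differentiable F p -> differentiable G p ->
  differentiable (fun q => dot (F q) (G q)) p.
Proof.
move=> dF dG; rewrite (_ : (fun q => _) = fun q =>
  - (F q i40 0 * G q i40 0) + F q i41 0 * G q i41 0
  - F q i42 0 * G q i42 0 + F q i43 0 * G q i43 0); last first.
  by apply/funext => q; rewrite dotE.
have cF i := differentiable_coordf i 0 dF; have cG i := differentiable_coordf i 0 dG.
apply: differentiableD; last exact: differentiableM.
apply: differentiableB; last exact: differentiableM.
apply: differentiableD; last exact: differentiableM.
by apply: differentiableN; exact: differentiableM.
Qed.

Lemma derive_dot (F G : R * R -> 'cV[R]_4) p v :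
  differentiable F p -> differentiable G p ->
  'D_v (fun q => dot (F q) (G q)) p = dot ('D_v F p) (G p) + dot (F p) ('D_v G p).
Proof.
move=> dF dG; rewrite (_ : (fun q => _) = fun q =>
  - (F q i40 0 * G q i40 0) + F q i41 0 * G q i41 0
  - F q i42 0 * G q i42 0 + F q i43 0 * G q i43 0); last first.
  by apply/funext => q; rewrite dotE.
have cF i := differentiable_coordf i 0 dF; have cG i := differentiable_coordf i 0 dG.
have cFG i : differentiable (fun q => F q i 0 * G q i 0) p by exact: differentiableM.
have E i : 'D_v (fun q => F q i 0 * G q i 0) p =
    ('D_v F p) i 0 * G p i 0 + F p i 0 * ('D_v G p) i 0.
  rewrite (derive_mul _ (cF i) (cG i)).
  by rewrite !derive_coord; [|exact: diff_derivable..].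
have dN : differentiable (fun q => - (F q i40 0 * G q i40 0)) p.
  exact: differentiableN.
have dA : differentiable (fun q => - (F q i40 0 * G q i40 0) + F q i41 0 * G q i41 0) p.
  exact: differentiableD dN (cFG i41).
have dB : differentiable (fun q => - (F q i40 0 * G q i40 0) + F q i41 0 * G q i41 0
    - F q i42 0 * G q i42 0) p.
  exact: differentiableB dA (cFG i42).
rewrite (derive_add _ dB (cFG i43)) (derive_sub _ dA (cFG i42)).
rewrite (derive_add _ dN (cFG i41)) (derive_opp _ (cFG i40)) !E !dotE.
by move: ('D_v F p) ('D_v G p) (F p) (G p) => a b c d; ring.
Qed.

Lemma derive_inv f p v : differentiable f p -> f p != 0 ->
  'D_v (fun q => (f q)^-1) p = - ('D_v f p) / f p ^+ 2.
Proof.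
move=> df f0; rewrite [LHS]deriveV //; last exact: diff_derivable.
by rewrite [LHS]mulrC mulrN mulNr.
Qed.

Lemma derive_swap_vec U n (F : R * R -> 'cV[R]_n) p v w : open U -> U p ->
  smooth_on U F ->
  'D_v (fun q => 'D_w F q) p = 'D_w (fun q => 'D_v F q) p.
Proof.
move=> oU Up sF; apply/colP => i.
have E v' w' : ('D_v' (fun q => 'D_w' F q) p) i 0 =
    'D_v' (fun q => 'D_w' (fun r => F r i 0) q) p.
  rewrite derive_coord; last exact: smooth_derivable (smooth_derive w' oU sF) Up.
  apply: derive_eq_on oU Up _ => q Uq.
  by rewrite derive_coord //; exact: smooth_derivable sF Uq.
apply: etrans (E v w) _; apply: etrans _ (esym (E w v)).
exact: derive_swap oU Up (smooth_coord i 0 oU sF).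
Qed.

End Leibniz.

(** * Surfaces in isothermal coordinates *)

Lemma null_pair_uv (R : realType) (a b : 'cV[R]_4) :
  dot a a = - dot b b -> dot a b = 0 -> dot a a < 0 ->
  null_pair (a + b) (a - b) (dot (a + b) (a - b)) /\
  dot (a + b) (a - b) = 2 * dot a a.
Proof.
move=> aa ab a0; have e : dot (a + b) (a - b) = 2 * dot a a.
  by rewrite dotBr !dotDl [dot b a]dotC aa; ring.
split=> //; split=> //.
- rewrite dotDr !dotDl [dot b a]dotC aa ab; ring.
- rewrite dotBr !dotBl [dot b a]dotC aa ab; ring.
- by rewrite e mulf_neq0 // lt_eqF.
Qed.

Lemma d_dt_mkD (R : realType) (uu uv vu vv a b c d : 'cV[R]_4) :
  uu = 2^-1 *: (2^-1 *: a + 2^-1 *: b) + 2^-1 *: (2^-1 *: c + 2^-1 *: d) ->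
  uv = 2^-1 *: (2^-1 *: a + 2^-1 *: b) - 2^-1 *: (2^-1 *: c + 2^-1 *: d) ->
  vu = 2^-1 *: (2^-1 *: a - 2^-1 *: b) + 2^-1 *: (2^-1 *: c - 2^-1 *: d) ->
  vv = 2^-1 *: (2^-1 *: a - 2^-1 *: b) - 2^-1 *: (2^-1 *: c - 2^-1 *: d) ->
  dreal 2^-1 *: (toD uu + dj *: toD uv + dj *: (toD vu + dj *: toD vv)) =
  mkD (4^-1 *: (a + d)) (4^-1 *: (a - d)).
Proof.
move=> -> -> -> ->; rewrite -!/(mkD _ _) mkD_djD mkDZ.
by congr mkD; apply/colP => i; rewrite !mxE; field.
Qed.

Section SurfaceBasics.
Variables (R : realType) (x : R * R -> 'cV[R]_4) (U : set (R * R)).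
Hypotheses (oU : open U) (sx : smooth_on U x) (iso : isothermal x U).

Notation dot a b := (@Defs.dot R a b : R).
Notation P := (dxi x).
Notation Q := (deta x).
Notation h p := (@Defs.dot R (dxi x p) (deta x p) : R).

Lemma smooth_dxi (W : normedModType R) (V : set (R * R)) (f : R * R -> W) :
  open V -> smooth_on V f -> smooth_on V (dxi f).
Proof. by rewrite dxiE; exact: smooth_derive. Qed.

Lemma smooth_deta (W : normedModType R) (V : set (R * R)) (f : R * R -> W) :
  open V -> smooth_on V f -> smooth_on V (deta f).
Proof. by rewrite detaE; exact: smooth_derive. Qed.

Let dx p (Up : U p) : differentiable x p := smooth_differentiable sx Up.

Lemma isothermal_null p : U p ->
  null_pair (P p) (Q p) (h p) /\ h p = 2 * dot (du x p) (du x p).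
Proof.
move=> Up; have [uv u_v u0] := iso Up.
rewrite (dxi_uv (dx Up)) (deta_uv (dx Up)); exact: null_pair_uv.
Qed.

Lemma isothermal_lt0 p : U p -> h p < 0.
Proof.
move=> Up; have [_ ->] := isothermal_null Up; have [_ _ u0] := iso Up.
by rewrite pmulr_rlt0.
Qed.

Lemma pushE X p : U p -> push x X p = xip (X p) *: P p + etap (X p) *: Q p.
Proof. by move=> Up; exact: derive_null (dx Up). Qed.

Lemma tangent_spaceE p w : U p ->
  tangent_space x p w <-> exists a b, w = a *: P p + b *: Q p.
Proof.
move=> Up; split=> [[v ->]|[a [b ->]]].
  by exists (xip v), (etap v); apply: derive_null; exact: dx.
exists (a + b, a - b); rewrite (derive_null _ (dx Up)) /xip /etap /=.
by congr (_ *: _ + _ *: _); field.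
Qed.

Lemma normal_spaceE p n : U p ->
  Defs.normal_space x p n <-> dot n (P p) = 0 /\ dot n (Q p) = 0.
Proof.
move=> Up; split=> [Nn|[nP nQ] w /(tangent_spaceE _ Up)[a [b ->]]].
  by split; apply: Nn; apply/(tangent_spaceE _ Up); [exists 1, 0|exists 0, 1];
    rewrite scale1r scale0r ?addr0 ?add0r.
by rewrite dotDr !dotZr nP nQ !mulr0 addr0.
Qed.

Lemma tangent_subspace p : U p -> subspace (tangent_space x p).
Proof.
move=> Up; split=> [|k a b].
  by apply/(tangent_spaceE _ Up); exists 0, 0; rewrite !scale0r addr0.
move=> /(tangent_spaceE _ Up)[a1 [a2 ->]] /(tangent_spaceE _ Up)[b1 [b2 ->]].
apply/(tangent_spaceE _ Up); exists (k * a1 + b1), (k * a2 + b2).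
by apply/colP => i; rewrite !mxE; ring.
Qed.

Lemma normal_subspace p : U p -> subspace (Defs.normal_space x p).
Proof.
move=> Up; split=> [|k a b]; first by move=> w _; rewrite dot0l.
by move=> Na Nb w Tw; rewrite dotDl dotZl Na // Nb // mulr0 addr0.
Qed.

Lemma normal_tangent0 p w : U p ->
  Defs.normal_space x p w -> tangent_space x p w -> w = 0.
Proof.
move=> Up /(normal_spaceE _ Up)[wP wQ] /(tangent_spaceE _ Up)[a [b E]].
have [nPQ _] := isothermal_null Up.
by rewrite E in wP wQ *; have [-> ->] := null_pair_orth0 nPQ wP wQ;
  rewrite !scale0r addr0.
Qed.

Lemma tprojE p w : U p -> tproj x p w = tangent_part (P p) (Q p) (h p) w.
Proof.
move=> Up; apply: proj_eq.
- by move=> n n' Tn Tn'; exact: subspaceB (tangent_subspace Up) _ _.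
- by move=> n n' Tn Tn'; exact: subspaceB (normal_subspace Up) _ _.
- by move=> v Tv Nv; exact: normal_tangent0 Up Nv Tv.
- by apply/(tangent_spaceE _ Up); do 2!eexists.
- by apply/(normal_spaceE _ Up); apply: normal_part_orth; have [] := isothermal_null Up.
Qed.

Lemma nprojE p w : U p -> nproj x p w = normal_part (P p) (Q p) (h p) w.
Proof.
move=> Up; apply: proj_eq.
- by move=> n n' Tn Tn'; exact: subspaceB (normal_subspace Up) _ _.
- by move=> n n' Tn Tn'; exact: subspaceB (tangent_subspace Up) _ _.
- by move=> v Tv Nv; exact: normal_tangent0 Up Tv Nv.
- by apply/(normal_spaceE _ Up); apply: normal_part_orth; have [] := isothermal_null Up.
- apply/(tangent_spaceE _ Up).
  exists (dot w (Q p) / h p), (dot w (P p) / h p).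
  by rewrite /normal_part opprB addrC subrK.
Qed.

Lemma derive_du p v : U p ->
  'D_v (du x) p = 2^-1 *: 'D_v P p + 2^-1 *: 'D_v Q p.
Proof.
move=> Up.
have dP : differentiable P p := smooth_differentiable (smooth_dxi oU sx) Up.
have dQ : differentiable Q p := smooth_differentiable (smooth_deta oU sx) Up.
transitivity ('D_v (fun q => 2^-1 *: P q + 2^-1 *: Q q) p).
  by apply: derive_eq_on oU Up _ => q Uq; exact: du_null (dx Uq).
rewrite derive_add; [|exact: differentiableZ..].
by congr (_ + _); apply: deriveZ; exact: diff_derivable.
Qed.

Lemma derive_dv p v : U p ->
  'D_v (dv x) p = 2^-1 *: 'D_v P p - 2^-1 *: 'D_v Q p.
Proof.
move=> Up.
have dP : differentiable P p := smooth_differentiable (smooth_dxi oU sx) Up.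
have dQ : differentiable Q p := smooth_differentiable (smooth_deta oU sx) Up.
transitivity ('D_v (fun q => 2^-1 *: P q - 2^-1 *: Q q) p).
  by apply: derive_eq_on oU Up _ => q Uq; exact: dv_null (dx Uq).
rewrite derive_sub; [|exact: differentiableZ..].
by congr (_ - _); apply: deriveZ; exact: diff_derivable.
Qed.

Lemma d_dt_PhiE p : U p ->
  d_dt (Phi x) p = mkD (4^-1 *: (dxi P p + deta Q p)) (4^-1 *: (dxi P p - deta Q p)).
Proof.
move=> Up.
have dP : differentiable P p := smooth_differentiable (smooth_dxi oU sx) Up.
have dQ : differentiable Q p := smooth_differentiable (smooth_deta oU sx) Up.
have E1 : (fun q => map_mx (@dre R) (Phi x q)) = du x.
  by apply/funext => q; exact: reD_mkD.
have E2 : (fun q => map_mx (@Defs.dim R) (Phi x q)) = dv x.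
  by apply/funext => q; exact: imD_mkD.
rewrite /d_dt /dpartial E1 E2.
apply: d_dt_mkD.
- by apply: etrans (derive_du _ Up) _; congr (_ *: _ + _ *: _); exact: du_null.
- by apply: etrans (derive_dv _ Up) _; congr (_ *: _ - _ *: _); exact: du_null.
- by apply: etrans (derive_du _ Up) _; congr (_ *: _ + _ *: _); exact: dv_null.
- by apply: etrans (derive_dv _ Up) _; congr (_ *: _ - _ *: _); exact: dv_null.
Qed.

Lemma Phi'perpE p : U p ->
  Phi'perp x p = mkD (4^-1 *: (normal_part (P p) (Q p) (h p) (dxi P p)
                               + normal_part (P p) (Q p) (h p) (deta Q p)))
                     (4^-1 *: (normal_part (P p) (Q p) (h p) (dxi P p)
                               - normal_part (P p) (Q p) (h p) (deta Q p))).
Proof.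
move=> Up; rewrite /Phi'perp d_dt_PhiE //.
have sT := tangent_subspace Up; have sN := normal_subspace Up.
have NP w : Defs.normal_space x p (normal_part (P p) (Q p) (h p) w).
  apply/(normal_spaceE _ Up); apply: normal_part_orth; by have [] := isothermal_null Up.
have TP w : tangent_space x p (w - normal_part (P p) (Q p) (h p) w).
  apply/(tangent_spaceE _ Up); exists (dot w (Q p) / h p), (dot w (P p) / h p).
  by rewrite /normal_part opprB addrC subrK.
apply: proj_eq.
- move=> n n' /(dspanE _ sN)[n1 n2] /(dspanE _ sN)[n1' n2'].
  by apply/(dspanE _ sN); rewrite reDB imDB; split;
    [exact: subspaceB sN n1 n1'|exact: subspaceB sN n2 n2'].
- move=> n n' /(dspanE _ sT)[n1 n2] /(dspanE _ sT)[n1' n2'].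
  by apply/(dspanE _ sT); rewrite reDB imDB; split;
    [exact: subspaceB sT n1 n1'|exact: subspaceB sT n2 n2'].
- move=> v /(dspanE _ sN)[n1 n2] /(dspanE _ sT)[t1 t2].
  rewrite -[v]mkDK (normal_tangent0 Up n1 t1) (normal_tangent0 Up n2 t2).
  by rewrite -[RHS]mkDK; congr mkD; apply/colP => i; rewrite !mxE.
- apply/(dspanE _ sN); rewrite reD_mkD imD_mkD.
  by rewrite -scaleN1r -!normal_partZ -!normal_partD -!normal_partZ; split; exact: NP.
- apply/(dspanE _ sT); rewrite reDB imDB !reD_mkD !imD_mkD.
  rewrite -[- normal_part _ _ _ _]scaleN1r -!normal_partZ -!normal_partD -!normal_partZ.
  by rewrite scaleN1r; split; exact: TP.
Qed.

(** With the idempotents (1 + j) / 2 and (1 - j) / 2 the vector Phi' splits into its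
    two null components, and the condition on its square becomes one on each. *)
Lemma Phi'perp_dot p : U p ->
  (Defs.dot (Phi'perp x p) (Phi'perp x p) = -1 <->
   dot (normal_part (P p) (Q p) (h p) (dxi P p))
       (normal_part (P p) (Q p) (h p) (dxi P p)) = -4 /\
   dot (normal_part (P p) (Q p) (h p) (deta Q p))
       (normal_part (P p) (Q p) (h p) (deta Q p)) = -4).
Proof.
move=> Up; rewrite Phi'perpE // dot_mkD.
move: (normal_part _ _ _ _) (normal_part _ _ _ _) => a b.
rewrite !dotZl !dotZr !dotBl !dotBr !dotDl !dotDr [dot b a]dotC.
split=> [[e1 e2]|[-> ->]].
  by split; lra.
by apply: dnum_eq; rewrite /= ?dreN ?dimN /=; field.
Qed.

End SurfaceBasics.

(** * Connections on line bundles *)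

Section VectorFields.
Variables (R : realType) (V : set (R * R)).
Hypothesis oV : open V.
Implicit Types (X Y : R * R -> R * R) (f : R * R -> R) (p v : R * R).

Lemma smooth_xip X : smooth_on V X -> smooth_on V (fun q => xip (X q)).
Proof.
move=> sX; apply: smoothM (smooth_cst _ _) => //.
by apply: smoothD => //; [exact: smooth_fst|exact: smooth_snd].
Qed.

Lemma smooth_etap X : smooth_on V X -> smooth_on V (fun q => etap (X q)).
Proof.
move=> sX; apply: smoothM (smooth_cst _ _) => //.
by apply: smoothB => //; [exact: smooth_fst|exact: smooth_snd].
Qed.

Lemma derive_xip X p v : differentiable X p ->
  'D_v (fun q => xip (X q)) p = xip ('D_v X p).
Proof.
move=> dX; have d1 := differentiable_fstf dX; have d2 := differentiable_sndf dX.
have dD : differentiable (fun q => (X q).1 + (X q).2) p by exact: differentiableD.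
rewrite /xip (derive_mul _ dD (differentiable_cst _ _)) derive_cst mulr0 addr0.
by rewrite (derive_add _ d1 d2) derive_fst // derive_snd.
Qed.

Lemma derive_etap X p v : differentiable X p ->
  'D_v (fun q => etap (X q)) p = etap ('D_v X p).
Proof.
move=> dX; have d1 := differentiable_fstf dX; have d2 := differentiable_sndf dX.
have dD : differentiable (fun q => (X q).1 - (X q).2) p by exact: differentiableB.
rewrite /etap (derive_mul _ dD (differentiable_cst _ _)) derive_cst mulr0 addr0.
by rewrite (derive_sub _ d1 d2) derive_fst // derive_snd.
Qed.

Lemma xip_lie X Y p : differentiable X p -> differentiable Y p ->
  xip (lie_bracket X Y p) =
  'D_(X p) (fun q => xip (Y q)) p - 'D_(Y p) (fun q => xip (X q)) p.
Proof.
move=> dX dY; rewrite !derive_xip // /lie_bracket.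
by move: ('D__ _ _) ('D__ _ _) => a b; rewrite /xip /=; ring.
Qed.

Lemma etap_lie X Y p : differentiable X p -> differentiable Y p ->
  etap (lie_bracket X Y p) =
  'D_(X p) (fun q => etap (Y q)) p - 'D_(Y p) (fun q => etap (X q)) p.
Proof.
move=> dX dY; rewrite !derive_etap // /lie_bracket.
by move: ('D__ _ _) ('D__ _ _) => a b; rewrite /etap /=; ring.
Qed.

Lemma derive_nullR f p v : differentiable f p ->
  'D_v f p = xip v * dxi f p + etap v * deta f p.
Proof. exact: derive_null. Qed.

Lemma dxi_swap f p : V p -> smooth_on V f -> dxi (deta f) p = deta (dxi f) p.
Proof. by move=> Vp sf; rewrite !dxiE !detaE; exact: derive_swap oV Vp sf. Qed.

(** A connection on a line bundle, in a frame in which its form is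
    w1 d(xi) + w2 d(eta): the covariant derivative of the section f along X. *)
Definition line_nabla (w1 w2 : R * R -> R) X f q : R :=
  xip (X q) * dxi f q + etap (X q) * deta f q
  + f q * (xip (X q) * w1 q + etap (X q) * w2 q).

Lemma derive_line_nabla (a b s t f g k : R * R -> R) p v :
  differentiable a p -> differentiable b p -> differentiable s p ->
  differentiable t p -> differentiable f p -> differentiable g p ->
  differentiable k p ->
  'D_v (fun q => a q * g q + b q * k q + f q * (a q * s q + b q * t q)) p =
  'D_v a p * g p + a p * 'D_v g p + ('D_v b p * k p + b p * 'D_v k p)
  + ('D_v f p * (a p * s p + b p * t p)
     + f p * ('D_v a p * s p + a p * 'D_v s p + ('D_v b p * t p + b p * 'D_v t p))).
Proof.
move=> da db ds dt df dg dk.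
have ag := differentiableM da dg; have bk := differentiableM db dk.
have as_ := differentiableM da ds; have bt := differentiableM db dt.
have l1 := differentiableD ag bk; have l2 := differentiableD as_ bt.
have l3 := differentiableM df l2.
rewrite (derive_add _ l1 l3) (derive_add _ ag bk) (derive_mul _ df l2).
by rewrite (derive_add _ as_ bt) !derive_mul.
Qed.

Lemma smooth_line_nabla (w1 w2 : R * R -> R) X f :
  smooth_on V w1 -> smooth_on V w2 -> smooth_on V X -> smooth_on V f ->
  smooth_on V (line_nabla w1 w2 X f).
Proof.
move=> s1 s2 sX sf; have a := smooth_xip sX; have b := smooth_etap sX.
apply: smoothD => //; first apply: smoothD => //; apply: smoothM => //.
- exact: smooth_dxi.
- exact: smooth_deta.
- by apply: smoothD => //; exact: smoothM.
Qed.

(** The curvature of a line bundle is the exterior derivative of the connection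
    form; the second derivatives of f cancel because they commute. *)
Lemma line_curvature (w1 w2 : R * R -> R) X Y f p : V p ->
  smooth_on V w1 -> smooth_on V w2 -> smooth_on V X -> smooth_on V Y ->
  smooth_on V f ->
  line_nabla w1 w2 X (line_nabla w1 w2 Y f) p
  - line_nabla w1 w2 Y (line_nabla w1 w2 X f) p
  - line_nabla w1 w2 (lie_bracket X Y) f p =
  f p * (xip (X p) * etap (Y p) - etap (X p) * xip (Y p))
      * (dxi w2 p - deta w1 p).
Proof.
move=> Vp s1 s2 sX sY sf.
have D g : smooth_on V g -> differentiable g p.
  by move=> sg; exact: smooth_differentiable sg Vp.
have expand Z v (T : (R * R -> R) -> R) : (forall g, T g = 'D_v g p) ->
  smooth_on V Z -> T (line_nabla w1 w2 Z f) =
  T (fun q => xip (Z q)) * dxi f p + xip (Z p) * T (dxi f)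
  + (T (fun q => etap (Z q)) * deta f p + etap (Z p) * T (deta f))
  + (T f * (xip (Z p) * w1 p + etap (Z p) * w2 p)
     + f p * (T (fun q => xip (Z q)) * w1 p + xip (Z p) * T w1
       + (T (fun q => etap (Z q)) * w2 p + etap (Z p) * T w2))).
  move=> TE sZ; rewrite !TE; apply: derive_line_nabla; apply: D => //.
  - exact: smooth_xip.
  - exact: smooth_etap.
  - exact: smooth_dxi.
  - exact: smooth_deta.
have E1 Z g : line_nabla w1 w2 Z g p =
    xip (Z p) * dxi g p + etap (Z p) * deta g p
    + g p * (xip (Z p) * w1 p + etap (Z p) * w2 p) by [].
have dX : differentiable X p := smooth_differentiable sX Vp.
have dY : differentiable Y p := smooth_differentiable sY Vp.
have fxy := dxi_swap Vp sf.
have x1 Z := @expand Z (1, 1) (fun g => dxi g p) (fun g => congr1 (fun F => F p) (dxiE g)).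
have x2 Z := @expand Z (1, -1) (fun g => deta g p) (fun g => congr1 (fun F => F p) (detaE g)).
have ax Z : smooth_on V Z -> differentiable (fun q => xip (Z q)) p.
  by move=> sZ; apply: D; exact: smooth_xip.
have ae Z : smooth_on V Z -> differentiable (fun q => etap (Z q)) p.
  by move=> sZ; apply: D; exact: smooth_etap.
rewrite (E1 X (line_nabla w1 w2 Y f)) (x1 Y sY) (x2 Y sY).
rewrite (E1 Y (line_nabla w1 w2 X f)) (x1 X sX) (x2 X sX).
rewrite (E1 (lie_bracket X Y) f) !(E1 _ f) (xip_lie dX dY) (etap_lie dX dY).
rewrite (derive_nullR _ (ax X sX)) (derive_nullR _ (ax Y sY)).
rewrite (derive_nullR _ (ae X sX)) (derive_nullR _ (ae Y sY)) fxy.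
ring.
Qed.

End VectorFields.

(** * The second fundamental form *)

Section SurfaceCurvature.
Variables (R : realType) (x : R * R -> 'cV[R]_4) (U V : set (R * R)).
Hypotheses (oU : open U) (sx : smooth_on U x) (iso : isothermal x U).
Hypotheses (oV : open V) (VU : V `<=` U).
Implicit Types (X Y : R * R -> R * R) (p q v : R * R).

Notation dot a b := (@Defs.dot R a b : R).
Notation P := (dxi x).
Notation Q := (deta x).
Notation h p := (@Defs.dot R (dxi x p) (deta x p) : R).

Let sP : smooth_on U P. Proof. exact: smooth_dxi. Qed.
Let sQ : smooth_on U Q. Proof. exact: smooth_deta. Qed.
Let dP p (Up : U p) : differentiable P p := smooth_differentiable sP Up.
Let dQ p (Up : U p) : differentiable Q p := smooth_differentiable sQ Up.

Lemma dxi_eta p : U p -> dxi Q p = deta P p.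
Proof. by move=> Up; rewrite !dxiE !detaE; exact: derive_swap_vec oU Up sx. Qed.

Lemma derive_orth (F G : R * R -> 'cV[R]_4) (c : R) p v : U p ->
  differentiable F p -> differentiable G p ->
  (forall q, U q -> dot (F q) (G q) = c) ->
  dot ('D_v F p) (G p) = - dot (F p) ('D_v G p).
Proof.
move=> Up dF dG FG0; apply/eqP; rewrite -addr_eq0 -derive_dot //; apply/eqP.
by rewrite -(derive_cst c p v); apply: derive_eq_on oU Up FG0.
Qed.

Lemma dot_self_derive (F : R * R -> 'cV[R]_4) (c : R) p v : U p ->
  differentiable F p -> (forall q, U q -> dot (F q) (F q) = c) ->
  dot ('D_v F p) (F p) = 0.
Proof.
move=> Up dF F0; have := derive_orth v Up dF dF F0.
by rewrite [X in _ = - X]dotC; move: (dot _ _) => a; lra.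
Qed.

Lemma PP q : U q -> dot (P q) (P q) = 0.
Proof. by move=> Uq; have [[]] := isothermal_null sx iso Uq. Qed.

Lemma QQ q : U q -> dot (Q q) (Q q) = 0.
Proof. by move=> Uq; have [[]] := isothermal_null sx iso Uq. Qed.

Lemma dxiP_P p : U p -> dot (dxi P p) (P p) = 0.
Proof. by move=> Up; rewrite (dxiE P); exact: dot_self_derive Up (dP Up) PP. Qed.

Lemma detaP_P p : U p -> dot (deta P p) (P p) = 0.
Proof. by move=> Up; rewrite (detaE P); exact: dot_self_derive Up (dP Up) PP. Qed.

Lemma detaQ_Q p : U p -> dot (deta Q p) (Q p) = 0.
Proof. by move=> Up; rewrite (detaE Q); exact: dot_self_derive Up (dQ Up) QQ. Qed.

Lemma detaP_Q p : U p -> dot (deta P p) (Q p) = 0.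
Proof.
by move=> Up; rewrite -dxi_eta // (dxiE Q); exact: dot_self_derive Up (dQ Up) QQ.
Qed.

Lemma derive_push (a b : R * R -> R) p v : U p ->
  differentiable a p -> differentiable b p ->
  'D_v (fun q => a q *: P q + b q *: Q q) p =
  ('D_v a p *: P p + 'D_v b p *: Q p) +
  (a p *: (xip v *: dxi P p + etap v *: deta P p) +
   b p *: (xip v *: deta P p + etap v *: deta Q p)).
Proof.
move=> Up da db.
rewrite (derive_add _ (differentiable_scale da (dP Up)) (differentiable_scale db (dQ Up))).
rewrite (derive_scale _ da (dP Up)) (derive_scale _ db (dQ Up)).
rewrite (derive_null _ (dP Up)) (derive_null _ (dQ Up)) dxi_eta //.
by rewrite addrACA.
Qed.

Section Frame.
Variables (X1 X2 : R * R -> R * R).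
Hypothesis fr : tangent_frame x V X1 X2.

Let sX1 : smooth_on V X1. Proof. by case: fr. Qed.
Let sX2 : smooth_on V X2. Proof. by case: fr. Qed.

Lemma frame_null p : V p ->
  [/\ 2 * h p * (xip (X1 p) * etap (X1 p)) = -1,
      2 * h p * (xip (X2 p) * etap (X2 p)) = 1 &
      xip (X1 p) * etap (X2 p) + etap (X1 p) * xip (X2 p) = 0].
Proof.
move=> Vp; have Up := VU Vp; have [_ _ /(_ p Vp) [e1 e2 e3]] := fr.
have [nPQ _] := isothermal_null sx iso Up.
rewrite !(pushE sx) // !(null_pair_dot _ _ _ _ nPQ) in e1 e2 e3.
have [_ _ _ h0] := nPQ; split; [apply: etrans e1; ring|apply: etrans e2; ring|].
by apply: (mulfI h0); rewrite mulr0 -e3; ring.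
Qed.

(** This is the squared area of the frame up to sign; it lets the frame disappear from
    the two curvatures. *)
Lemma frame_area p : V p ->
  (h p * (xip (X1 p) * etap (X2 p) - etap (X1 p) * xip (X2 p))) ^+ 2 = 1.
Proof.
move=> Vp; have [] := frame_null Vp.
move: (h p) (xip (X1 p)) (xip (X2 p)) (etap (X1 p)) (etap (X2 p)) => k a c b d.
move=> e1 e2 e3; have -> : (k * (a * d - b * c)) ^+ 2 =
  k ^+ 2 * (a * d + b * c) ^+ 2 - (2 * k * (a * b)) * (2 * k * (c * d)) by ring.
by rewrite e1 e2 e3; ring.
Qed.

Lemma second_formE X Y p : V p -> smooth_on V Y ->
  second_form x X Y p =
  (xip (X p) * xip (Y p)) *: normal_part (P p) (Q p) (h p) (dxi P p)
  + (xip (X p) * etap (Y p) + etap (X p) * xip (Y p)) *: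
      normal_part (P p) (Q p) (h p) (deta P p)
  + (etap (X p) * etap (Y p)) *: normal_part (P p) (Q p) (h p) (deta Q p).
Proof.
move=> Vp sY; have Up := VU Vp; have [nPQ _] := isothermal_null sx iso Up.
rewrite /second_form (nprojE sx iso) //.
transitivity (normal_part (P p) (Q p) (h p)
   ('D_(X p) (fun q => xip (Y q) *: P q + etap (Y q) *: Q q) p)).
  congr normal_part; apply: derive_eq_on oV Vp _ => q Vq.
  by apply: (pushE sx); exact: VU.
have dx1 := smooth_differentiable (smooth_xip oV sY) Vp.
have dx2 := smooth_differentiable (smooth_etap oV sY) Vp.
rewrite (derive_push _ Up dx1 dx2) (normal_part_lin _ _ _ nPQ).
rewrite normal_partD !normal_partZ !normal_partD !normal_partZ.
move: (normal_part _ _ _ _) (normal_part _ _ _ _) (normal_part _ _ _ _) => a b c.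
by apply/colP => i; rewrite !mxE; ring.
Qed.

(** Only the mixed component of the second fundamental form survives in its trace, and
    x_{xi eta} is normal: it is orthogonal to P and Q because these are null. So
    minimality is the wave equation for x. *)
Lemma mean_curvatureE p : V p ->
  mean_curvature x X1 X2 p = (h p)^-1 *: deta P p.
Proof.
move=> Vp; have Up := VU Vp; have [[_ _ _ h0] _] := isothermal_null sx iso Up.
rewrite /mean_curvature !second_formE //.
rewrite [normal_part _ _ _ (deta P p)]normal_part_id;
  [|exact: detaP_P|exact: detaP_Q].
have [] := frame_null Vp.
move: (normal_part _ _ _ _) (normal_part _ _ _ _) (deta P p) h0.
move: (h p) (xip (X1 p)) (xip (X2 p)) (etap (X1 p)) (etap (X2 p)).
move=> k a c b d A C B k0 e1 e2 e3.
have k20 : 2 * k != 0 by rewrite mulf_neq0.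
have ac : a * a = c * c.
  apply: (mulfI k20); have -> : 2 * k * (a * a) = 2 * k * (c * d) * (2 * k * (a * a)).
    by rewrite e2 mul1r.
  have -> : 2 * k * (c * d) * (2 * k * (a * a)) =
    2 * k * (a * c) * (2 * k * (a * d + b * c)) - 2 * k * (a * b) * (2 * k * (c * c)).
    by ring.
  by rewrite e1 e3; ring.
have bd : b * b = d * d.
  apply: (mulfI k20); have -> : 2 * k * (b * b) = 2 * k * (c * d) * (2 * k * (b * b)).
    by rewrite e2 mul1r.
  have -> : 2 * k * (c * d) * (2 * k * (b * b)) =
    2 * k * (b * d) * (2 * k * (a * d + b * c)) - 2 * k * (a * b) * (2 * k * (d * d)).
    by ring.
  by rewrite e1 e3; ring.
have ab : a * b = - (2 * k)^-1.
  by apply: (mulfI k20); rewrite e1 mulrN divff.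
have cd : c * d = (2 * k)^-1 by apply: (mulfI k20); rewrite e2 divff.
apply/colP => i; rewrite !mxE [b * a]mulrC [d * c]mulrC ab cd ac bd.
by field.
Qed.

End Frame.

End SurfaceCurvature.

(** * The Gauss curvature of a minimal surface *)

(** The induced metric is 2 h d(xi) d(eta) with this function h. *)
Definition null_metric (R : realType) (x : R * R -> 'cV[R]_4) p : R :=
  dot (dxi x p) (deta x p).

Section MinimalCurvature.
Variables (R : realType) (x : R * R -> 'cV[R]_4) (U V : set (R * R)).
Hypotheses (oU : open U) (sx : smooth_on U x) (iso : isothermal x U).
Hypotheses (oV : open V) (VU : V `<=` U).
Implicit Types (X Y : R * R -> R * R) (p q v : R * R).

Notation dot a b := (@Defs.dot R a b : R).
Notation P := (dxi x).
Notation Q := (deta x).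
Notation h p := (@Defs.dot R (dxi x p) (deta x p) : R).

Notation hf := (null_metric x).

Hypothesis mini : forall p, U p -> deta P p = 0.

Let sP : smooth_on U P. Proof. exact: smooth_dxi. Qed.
Let sQ : smooth_on U Q. Proof. exact: smooth_deta. Qed.
Let sh : smooth_on U hf. Proof. exact: smooth_dot. Qed.
Let dP p (Up : U p) : differentiable P p := smooth_differentiable sP Up.
Let dQ p (Up : U p) : differentiable Q p := smooth_differentiable sQ Up.
Let dh p (Up : U p) : differentiable hf p := smooth_differentiable sh Up.
Let h0 p (Up : U p) : hf p != 0.
Proof. by have [[_ _ _]] := isothermal_null sx iso Up. Qed.

Lemma dxi_h p : U p -> dxi hf p = dot (dxi P p) (Q p).
Proof.
move=> Up; rewrite dxiE (derive_dot _ (dP Up) (dQ Up)).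
have := dxi_eta oU sx Up; rewrite mini // (dxiE Q) => ->.
by rewrite dot0r addr0 (dxiE P).
Qed.

Lemma deta_h p : U p -> deta hf p = dot (P p) (deta Q p).
Proof.
move=> Up; rewrite detaE (derive_dot _ (dP Up) (dQ Up)).
have := mini Up; rewrite (detaE P) => ->.
by rewrite dot0l add0r (detaE Q).
Qed.

(** The connection forms of the null lines spanned by P and Q. *)
Let lam q := dxi hf q * (hf q)^-1.
Let mu q := deta hf q * (hf q)^-1.

Let slam : smooth_on U lam.
Proof. by apply: smoothM => //; [exact: smooth_dxi|exact: smoothV]. Qed.
Let smu : smooth_on U mu.
Proof. by apply: smoothM => //; [exact: smooth_deta|exact: smoothV]. Qed.

Lemma deta_lam p : U p -> deta lam p =
  (hf p * deta (dxi hf) p - dxi hf p * deta hf p) / hf p ^+ 2.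
Proof.
move=> Up; have d1 : differentiable (dxi hf) p.
  exact: smooth_differentiable (smooth_dxi oU sh) Up.
have d2 : differentiable (fun q => (hf q)^-1) p.
  exact: smooth_differentiable (smoothV oU h0 sh) Up.
rewrite detaE (derive_mul _ d1 d2) (derive_inv _ (dh Up) (h0 Up)) !detaE.
by move: (h0 Up); move: (hf p) ('D__ _ _) ('D__ hf _) (dxi hf p) => a b c d a0; field.
Qed.

Lemma dxi_mu p : U p -> dxi mu p =
  (hf p * deta (dxi hf) p - dxi hf p * deta hf p) / hf p ^+ 2.
Proof.
move=> Up; have d1 : differentiable (deta hf) p.
  exact: smooth_differentiable (smooth_deta oU sh) Up.
have d2 : differentiable (fun q => (hf q)^-1) p.
  exact: smooth_differentiable (smoothV oU h0 sh) Up.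
rewrite -(dxi_swap oU Up sh).
rewrite dxiE (derive_mul _ d1 d2) (derive_inv _ (dh Up) (h0 Up)) !dxiE.
by move: (h0 Up); move: (hf p) ('D__ _ _) ('D__ hf _) (deta hf p) => a b c d a0; field.
Qed.

Let cst0 : R * R -> R := fun=> 0.

Let nabla_tangent X (a b : R * R -> R) (Z : R * R -> 'cV[R]_4) p : V p ->
  smooth_on V a -> smooth_on V b ->
  (forall q, V q -> Z q = a q *: P q + b q *: Q q) ->
  nabla (tproj x) X Z p =
  line_nabla lam cst0 X a p *: P p + line_nabla cst0 mu X b p *: Q p.
Proof.
move=> Vp sa sb Zab; have Up := VU Vp.
have [nPQ _] := isothermal_null sx iso Up.
have da := smooth_differentiable sa Vp; have db := smooth_differentiable sb Vp.
rewrite /nabla (tprojE sx iso) //.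
transitivity (tangent_part (P p) (Q p) (h p)
   ('D_(X p) (fun q => a q *: P q + b q *: Q q) p)).
  by congr tangent_part; apply: derive_eq_on oV Vp _.
rewrite (derive_push oU sx _ Up da db) mini // (tangent_part_lin _ _ _ nPQ).
rewrite -/(hf p) /tangent_part !dotDl !dotZl !dotDl !dotZl !dot0l.
rewrite (dxiP_P oU sx iso Up) (detaQ_Q oU sx iso Up).
rewrite [Defs.dot (deta Q p) _]dotC -dxi_h // -deta_h //.
rewrite (derive_nullR _ da) (derive_nullR _ db) /line_nabla /lam /mu /cst0.
move: (h0 Up).
move: (hf p) (dxi hf p) (deta hf p) (dxi a p) (deta a p) (dxi b p) (deta b p).
move=> k k1 k2 a1 a2 b1 b2 k0.
by apply/colP => i; rewrite !mxE; field.
Qed.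

(** The null lines spanned by P and by Q are parallel for the Levi-Civita connection,
    so that its curvature acts on each of them as that of a line bundle. *)
Lemma curvature_tangent X Y (a b : R * R -> R) (Z : R * R -> 'cV[R]_4) p : V p ->
  smooth_on V X -> smooth_on V Y -> smooth_on V a -> smooth_on V b ->
  (forall q, V q -> Z q = a q *: P q + b q *: Q q) ->
  curvature (tproj x) X Y Z p =
  (xip (X p) * etap (Y p) - etap (X p) * xip (Y p)) *
   ((hf p * deta (dxi hf) p - dxi hf p * deta hf p) / hf p ^+ 2) *:
   (b p *: Q p - a p *: P p).
Proof.
move=> Vp sX sY sa sb Zab; have Up := VU Vp.
have s1 : smooth_on V lam := smooth_onS VU slam.
have s2 : smooth_on V mu := smooth_onS VU smu.
have s0 : smooth_on V cst0 := smooth_cst _ _.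
have la X' : smooth_on V X' -> smooth_on V (line_nabla lam cst0 X' a).
  by move=> sX'; exact: smooth_line_nabla.
have lb X' : smooth_on V X' -> smooth_on V (line_nabla cst0 mu X' b).
  by move=> sX'; exact: smooth_line_nabla.
rewrite /curvature (nabla_tangent _ Vp sa sb Zab).
rewrite (nabla_tangent X Vp (la Y sY) (lb Y sY)); last first.
  by move=> q Vq; exact: nabla_tangent.
rewrite (nabla_tangent Y Vp (la X sX) (lb X sX)); last first.
  by move=> q Vq; exact: nabla_tangent.
have := line_curvature oV Vp s1 s0 sX sY sa.
have := line_curvature oV Vp s0 s2 sX sY sb.
have -> : dxi cst0 p = 0 by rewrite dxiE derive_cst.
have -> : deta cst0 p = 0 by rewrite detaE derive_cst.
rewrite dxi_mu // deta_lam //.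
set w := _ / _.
move: (line_nabla _ _ X _ p) (line_nabla _ _ Y _ p) (line_nabla _ _ _ b p) =>
  b1 b2 b3 Eb.
move: (line_nabla _ _ X _ p) (line_nabla _ _ Y _ p) (line_nabla _ _ _ a p) =>
  a1 a2 a3 Ea.
have -> : b1 = b2 + b3 + b p * (xip (X p) * etap (Y p) - etap (X p) * xip (Y p)) * w.
  by move: Eb; rewrite subr0 => <-; ring.
have -> : a1 = a2 + a3 - a p * (xip (X p) * etap (Y p) - etap (X p) * xip (Y p)) * w.
  by move: Ea; rewrite sub0r mulrN => /(congr1 -%R); rewrite opprK => <-; ring.
by apply/colP => i; rewrite !mxE; ring.
Qed.

(** Theorema egregium for the metric 2 h d(xi) d(eta): up to the sign and a factor
    1 / h this is the mixed derivative of ln |h|. *)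
Lemma gauss_formula X1 X2 p : V p -> tangent_frame x V X1 X2 ->
  - dot (curvature (tproj x) X1 X2 (push x X2) p) (push x X1 p) =
  - (hf p * deta (dxi hf) p - dxi hf p * deta hf p) / hf p ^+ 3.
Proof.
move=> Vp fr; have Up := VU Vp; have [sX1 sX2 _] := fr.
have [nPQ _] := isothermal_null sx iso Up.
rewrite (curvature_tangent Vp sX1 sX2 (smooth_xip oV sX2) (smooth_etap oV sX2));
  last by move=> q Vq; apply: (pushE sx); exact: VU.
have -> : etap (X2 p) *: Q p - xip (X2 p) *: P p =
    (- xip (X2 p)) *: P p + etap (X2 p) *: Q p by rewrite scaleNr addrC.
rewrite (pushE sx) // dotZl (null_pair_dot _ _ _ _ nPQ).
have := frame_area sx iso VU fr Vp; rewrite -[h p]/(hf p).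
move: (h0 Up) (deta (dxi hf) p) (dxi hf p) (deta hf p).
move: (hf p) (xip (X1 p)) (xip (X2 p)) (etap (X1 p)) (etap (X2 p)).
move=> k a c b d k0 k12 k1 k2 E.
transitivity (- (k * k12 - k1 * k2) / k ^+ 3 * (k * (a * d - b * c)) ^+ 2).
  by field.
by rewrite E mulr1.
Qed.

Lemma deta_dxi_h p : U p -> deta (dxi hf) p = dot (dxi P p) (deta Q p).
Proof.
move=> Up; have sA := smooth_dxi oU sP.
have dA : differentiable (dxi P) p := smooth_differentiable sA Up.
transitivity (deta (fun q => dot (dxi P q) (Q q)) p).
  rewrite (detaE (dxi hf)) (detaE (fun q => dot (dxi P q) (Q q))).
  by apply: derive_eq_on oU Up _ => q Uq; exact: dxi_h.
rewrite (detaE (fun q => _)) (derive_dot _ dA (dQ Up)).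
suff -> : 'D_(1, -1) (dxi P) p = 0 by rewrite dot0l add0r (detaE Q).
rewrite (dxiE P) (derive_swap_vec _ _ oU Up sP).
transitivity ('D_((1, 1) : R * R) (fun=> 0 : 'cV[R]_4) p); last exact: derive_cst.
apply: derive_eq_on oU Up _ => q Uq; have := mini Uq.
by rewrite (detaE P).
Qed.

End MinimalCurvature.

(** * The curvature of the normal connection *)

Section NormalCurvature.
Variables (R : realType) (x : R * R -> 'cV[R]_4) (U V : set (R * R)).
Hypotheses (oU : open U) (sx : smooth_on U x) (iso : isothermal x U).
Hypotheses (oV : open V) (VU : V `<=` U).
Implicit Types (X Y : R * R -> R * R) (p q v : R * R).

Notation dot a b := (@Defs.dot R a b : R).
Notation P := (dxi x).
Notation Q := (deta x).
Notation h p := (null_metric x p).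

Hypothesis mini : forall p, U p -> deta P p = 0.

Let sP : smooth_on U P. Proof. exact: smooth_dxi. Qed.
Let sQ : smooth_on U Q. Proof. exact: smooth_deta. Qed.
Let dP p (Up : U p) : differentiable P p := smooth_differentiable sP Up.
Let dQ p (Up : U p) : differentiable Q p := smooth_differentiable sQ Up.

Variables (n1 n2 : R * R -> 'cV[R]_4).
Hypothesis nf : normal_frame x V n1 n2.

Let s1 : smooth_on V n1. Proof. by case: nf. Qed.
Let s2 : smooth_on V n2. Proof. by case: nf. Qed.
Let d1 p (Vp : V p) : differentiable n1 p := smooth_differentiable s1 Vp.
Let d2 p (Vp : V p) : differentiable n2 p := smooth_differentiable s2 Vp.

Lemma normal_frame_null q : V q ->
  null_frame (P q) (Q q) (n1 q) (n2 q) (h q).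
Proof.
move=> Vq; have Uq := VU Vq; have [_ _ /(_ q Vq)[N1 N2 n11 n22 n12]] := nf.
have [nPQ _] := isothermal_null sx iso Uq.
have e1 := (normal_spaceE sx _ Uq).1 N1.
by have e2 := (normal_spaceE sx _ Uq).1 N2.
Qed.

Lemma nproj_frame p w : V p ->
  nproj x p w = (- dot w (n1 p)) *: n1 p + dot w (n2 p) *: n2 p.
Proof.
move=> Vp; rewrite (nprojE sx iso); last exact: VU.
rewrite /normal_part {1}(frame_expansion w (normal_frame_null Vp)) /tangent_part.
by apply/colP => i; rewrite !mxE; ring.
Qed.

(** The connection form of the normal bundle in the frame (n1, n2). *)
Let psi1 q := - dot (dxi n2 q) (n1 q).
Let psi2 q := - dot (deta n2 q) (n1 q).
Let cst1 : R * R -> R := fun=> 1.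

Let spsi1 : smooth_on V psi1.
Proof. by apply: smoothN => //; apply: smooth_dot => //; exact: smooth_dxi. Qed.
Let spsi2 : smooth_on V psi2.
Proof. by apply: smoothN => //; apply: smooth_dot => //; exact: smooth_deta. Qed.

Let nabla_n2 Y q : V q -> nabla (nproj x) Y n2 q = line_nabla psi1 psi2 Y cst1 q *: n1 q.
Proof.
move=> Vq; rewrite /nabla nproj_frame //.
rewrite (dot_self_derive oV _ Vq (d2 Vq) (c := 1)); last first.
  by move=> r Vr; have [_ _ /(_ r Vr)[]] := nf.
rewrite scale0r addr0 (derive_null _ (d2 Vq)) dotDl !dotZl.
rewrite /line_nabla; have -> : dxi cst1 q = 0 by rewrite dxiE derive_cst.
have -> : deta cst1 q = 0 by rewrite detaE derive_cst.
by congr (_ *: _); rewrite /psi1 /psi2 /cst1; ring.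
Qed.

Let nabla_fn1 X (f : R * R -> R) (Z : R * R -> 'cV[R]_4) p : V p ->
  smooth_on V f -> (forall q, V q -> Z q = f q *: n1 q) ->
  dot (nabla (nproj x) X Z p) (n1 p) = - 'D_(X p) f p.
Proof.
move=> Vp sf ZE; have df := smooth_differentiable sf Vp.
have [_ _ /(_ p Vp)[N1 N2 n11 n22 n12]] := nf.
rewrite /nabla (derive_eq_on _ oV Vp ZE) (derive_scale _ df (d1 Vp)).
rewrite nproj_frame // dotDl !dotZl n11 [Defs.dot (n2 p) _]dotC n12 mulr0 addr0.
rewrite dotDl !dotZl n11 (dot_self_derive oV _ Vp (d1 Vp) (c := -1)).
  by rewrite mulr0 addr0; ring.
by move=> r Vr; have [_ _ /(_ r Vr)[]] := nf.
Qed.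

Let normal_curvature_form X Y p : V p -> smooth_on V X -> smooth_on V Y ->
  dot (curvature (nproj x) X Y n2 p) (n1 p) =
  (xip (X p) * etap (Y p) - etap (X p) * xip (Y p)) *
  (dot (deta n2 p) (dxi n1 p) - dot (dxi n2 p) (deta n1 p)).
Proof.
move=> Vp sX sY.
have [_ _ /(_ p Vp)[N1 N2 n11 n22 n12]] := nf.
have sc : smooth_on V cst1 := smooth_cst _ _.
have sl Z : smooth_on V Z -> smooth_on V (line_nabla psi1 psi2 Z cst1).
  by move=> sZ; exact: smooth_line_nabla.
have EXY := nabla_fn1 X Vp (sl Y sY) (fun q Vq => nabla_n2 Y Vq).
have EYX := nabla_fn1 Y Vp (sl X sX) (fun q Vq => nabla_n2 X Vq).
have EL : dot (nabla (nproj x) (lie_bracket X Y) n2 p) (n1 p) =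
    - line_nabla psi1 psi2 (lie_bracket X Y) cst1 p.
  by rewrite nabla_n2 // dotZl n11 mulrN1.
rewrite /curvature; move: EXY EYX EL.
move: (nabla (nproj x) X (nabla (nproj x) Y n2) p)
  (nabla (nproj x) Y (nabla (nproj x) X n2) p)
  (nabla (nproj x) (lie_bracket X Y) n2 p) => a b c EXY EYX EL.
rewrite !dotBl EXY EYX EL {a b c EXY EYX EL}.
have dY := smooth_differentiable (sl Y sY) Vp.
have dX := smooth_differentiable (sl X sX) Vp.
rewrite (derive_nullR _ dY) (derive_nullR _ dX).
have := line_curvature oV Vp spsi1 spsi2 sX sY sc.
have -> : dxi psi2 p = - (dot (dxi (deta n2) p) (n1 p) + dot (deta n2 p) (dxi n1 p)).
  have de : differentiable (deta n2) p.
    exact: smooth_differentiable (smooth_deta oV s2) Vp.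
  rewrite dxiE derive_opp; last exact: differentiable_dot de (d1 Vp).
  by rewrite (derive_dot _ de (d1 Vp)) !dxiE.
have -> : deta psi1 p = - (dot (dxi (deta n2) p) (n1 p) + dot (dxi n2 p) (deta n1 p)).
  have de : differentiable (dxi n2) p.
    exact: smooth_differentiable (smooth_dxi oV s2) Vp.
  rewrite detaE derive_opp; last exact: differentiable_dot de (d1 Vp).
  rewrite (derive_dot _ de (d1 Vp)) !detaE !dxiE.
  by rewrite (derive_swap_vec _ _ oV Vp s2).
have E Z f : line_nabla psi1 psi2 Z f p = xip (Z p) * dxi f p + etap (Z p) * deta f p
   + f p * line_nabla psi1 psi2 Z cst1 p.
  rewrite /line_nabla; have -> : dxi cst1 p = 0 by rewrite dxiE derive_cst.
  have -> : deta cst1 p = 0 by rewrite detaE derive_cst.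
  by rewrite /cst1; ring.
rewrite (E X (line_nabla _ _ Y _)) (E Y (line_nabla _ _ X _)).
move: (line_nabla psi1 psi2 X cst1 p) (line_nabla psi1 psi2 Y cst1 p) => lx ly.
move: (line_nabla psi1 psi2 (lie_bracket X Y) cst1 p) => lxy.
move: (dxi (line_nabla _ _ _ _) p) (dxi (line_nabla _ _ _ _) p) => a b.
move: (deta (line_nabla _ _ _ _) p) (deta (line_nabla _ _ _ _) p) => c d.
rewrite /cst1 => F; move: F.
move: (xip (X p)) (xip (Y p)) (etap (X p)) (etap (Y p)) => x1 x2 y1 y2.
move: (Defs.dot _ _) (Defs.dot _ _) (Defs.dot _ _) => u v w F.
transitivity (- (1 * (x1 * y2 - y1 * x2) * (- (w + v) - - (w + u)))); last by ring.
by rewrite -F; ring.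
Qed.

Lemma normal_field_derivs n p : V p -> smooth_on V n ->
  (forall q, V q -> dot (n q) (P q) = 0) ->
  (forall q, V q -> dot (n q) (Q q) = 0) ->
  [/\ dot (dxi n p) (P p) = - dot (n p) (dxi P p), dot (dxi n p) (Q p) = 0,
      dot (deta n p) (P p) = 0 &
      dot (deta n p) (Q p) = - dot (n p) (deta Q p)].
Proof.
move=> Vp sn nP nQ; have Up := VU Vp; have dn := smooth_differentiable sn Vp.
have xP := derive_orth oV (1, 1) Vp dn (dP Up) nP.
have xQ := derive_orth oV (1, 1) Vp dn (dQ Up) nQ.
have eP := derive_orth oV (1, -1) Vp dn (dP Up) nP.
have eQ := derive_orth oV (1, -1) Vp dn (dQ Up) nQ.
split.
- by rewrite (dxiE n) (dxiE P).
- rewrite (dxiE n); apply: etrans xQ _.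
  have e : 'D_((1, 1) : R * R) Q p = 0.
    apply: etrans (esym (congr1 (fun F => F p) (dxiE Q))) _.
    exact: etrans (dxi_eta oU sx Up) (mini Up).
  by rewrite e dot0r oppr0.
- rewrite (detaE n); apply: etrans eP _.
  have e : 'D_((1, -1) : R * R) P p = 0.
    exact: etrans (esym (congr1 (fun F => F p) (detaE P))) (mini Up).
  by rewrite e dot0r oppr0.
- by rewrite (detaE n) (detaE Q).
Qed.

(** The Ricci equation. By the orientation of the frame it can be freed of any
    reference to the frame. *)
Lemma normal_formula X1 X2 p : V p -> tangent_frame x V X1 X2 ->
  right_oriented (push x X1 p) (push x X2 p) (n1 p) (n2 p) ->
  dot (curvature (nproj x) X1 X2 n2 p) (n1 p) =
  - det4 (P p) (Q p) (dxi P p) (deta Q p) / h p ^+ 3.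
Proof.
move=> Vp fr ro; have Up := VU Vp; have [sX1 sX2 _] := fr.
rewrite normal_curvature_form //.
have := frame_area sx iso VU fr Vp; rewrite -/(h p).
have nfr := normal_frame_null Vp; have D2 := null_frame_det4 nfr.
have [[_ _ _ h0] _ _ [n11 n22 n12]] := nfr.
move: ro; rewrite /right_oriented -/(det4 _ _ _ _) !(pushE sx) // det4_combine.
have n1P q : V q -> dot (n1 q) (P q) = 0 by move=> /normal_frame_null[_ []].
have n1Q q : V q -> dot (n1 q) (Q q) = 0 by move=> /normal_frame_null[_ []].
have n2P q : V q -> dot (n2 q) (P q) = 0 by move=> /normal_frame_null[_ _ []].
have n2Q q : V q -> dot (n2 q) (Q q) = 0 by move=> /normal_frame_null[_ _ []].
have [a1 a2 a3 a4] := normal_field_derivs Vp s1 n1P n1Q.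
have [b1 b2 b3 b4] := normal_field_derivs Vp s2 n2P n2Q.
have a5 : dot (dxi n1 p) (n1 p) = 0.
  rewrite dxiE; apply: (dot_self_derive oV (1, 1) Vp (d1 Vp) (c := -1)).
  by move=> r /normal_frame_null[_ _ _ []].
have a6 : dot (deta n1 p) (n1 p) = 0.
  rewrite detaE; apply: (dot_self_derive oV (1, -1) Vp (d1 Vp) (c := -1)).
  by move=> r /normal_frame_null[_ _ _ []].
have b5 : dot (dxi n2 p) (n2 p) = 0.
  rewrite dxiE; apply: (dot_self_derive oV (1, 1) Vp (d2 Vp) (c := 1)).
  by move=> r /normal_frame_null[_ _ _ []].
have b6 : dot (deta n2 p) (n2 p) = 0.
  rewrite detaE; apply: (dot_self_derive oV (1, -1) Vp (d2 Vp) (c := 1)).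
  by move=> r /normal_frame_null[_ _ _ []].
have E1 : dot (deta n2 p) (dxi n1 p) =
    dot (n2 p) (deta Q p) * dot (n1 p) (dxi P p) / h p.
  by rewrite (dot_expansion _ _ nfr) a1 a2 a5 b3 b4 b6; field.
have E2 : dot (dxi n2 p) (deta n1 p) =
    dot (n2 p) (dxi P p) * dot (n1 p) (deta Q p) / h p.
  by rewrite (dot_expansion _ _ nfr) a3 a4 a6 b1 b2 b5; field.
rewrite E1 E2 {E1 E2}.
rewrite (det4_frame (dxi P p) (deta Q p) nfr) [Defs.dot (n2 p) (deta Q p)]dotC.
rewrite [Defs.dot (n1 p) (dxi P p)]dotC [Defs.dot (n2 p) (dxi P p)]dotC.
rewrite [Defs.dot (n1 p) (deta Q p)]dotC.
move: D2 h0; move: (det4 _ _ _ _) (h p) (_ - etap _ * _) => D k w D2 k0.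
move: (Defs.dot _ (n1 p)) (Defs.dot _ (n2 p)) (Defs.dot _ (n2 p)) (Defs.dot _ (n1 p)).
move=> r1 r2 r3 r4 wD w2.
have wD1 : w * D = 1.
  have wD2 : (w * D) ^+ 2 = 1 by rewrite -w2 !exprMn D2 mulrC.
  have : (w * D - 1) * (w * D + 1) = 0.
    by transitivity ((w * D) ^+ 2 - 1); [ring|rewrite wD2 subrr].
  have n0 : w * D + 1 != 0 by apply: lt0r_neq0; apply: addr_gt0 wD ltr01.
  by move=> /eqP; rewrite mulf_eq0 (negPf n0) orbF subr_eq0 => /eqP.
have wk : w * k ^+ 2 = D by rewrite -D2 expr2 mulrA wD1 mul1r.
by rewrite -wk; field.
Qed.

End NormalCurvature.

(** * Surfaces in canonical coordinates *)

Section SmoothVectors.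
Variable R : realType.
Implicit Types (U : set (R * R)) (F G H : R * R -> 'cV[R]_4).

Lemma smooth_cross4 U F G H : open U ->
  smooth_on U F -> smooth_on U G -> smooth_on U H ->
  smooth_on U (fun q => cross4 (F q) (G q) (H q)).
Proof.
move=> oU sF sG sH.
have cF i := smooth_coord i 0 oU sF; have cG i := smooth_coord i 0 oU sG.
have cH i := smooth_coord i 0 oU sH.
have minor i j k : smooth_on U
    (fun q => det3f (fun s t => ([:: F q; G q; H q]`_t) ([:: i; j; k]`_s) 0)).
  have mul2 (a b c d : R * R -> R) : smooth_on U a -> smooth_on U b ->
      smooth_on U c -> smooth_on U d -> smooth_on U (fun q => a q * b q - c q * d q).
    by move=> *; apply: smoothB => //; exact: smoothM.
  rewrite /det3f /=; apply: smoothD => //; first apply: smoothB => //;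
    by apply: smoothM => //; exact: mul2.
apply: smooth_mx => // i j.
pose m i j k q := det3f (fun s t => ([:: F q; G q; H q]`_t) ([:: i; j; k]`_s) 0).
pose c := [:: m i41 i42 i43; m i40 i42 i43; m i40 i41 i43; m i40 i41 i42].
apply: (@smooth_on_eq _ _ _ (nth (fun=> 0) c i)) => // [q _|].
  by rewrite mxE; case: i => [[|[|[|[|k]]]] Hk].
by case: i => [[|[|[|[|k]]]] Hk] //=; exact: minor.
Qed.

End SmoothVectors.

(** For a surface in canonical coordinates [unit_normal] and [unit_binormal] form an
    orthonormal basis of the normal plane. Its first vector is half the normal part
    of x_{xi xi}, and [unit_normal'] is its analogue for eta; the sign of the second
    vector is fixed by the orientation. The three are locked so that linearity lemmas
    do not rewrite inside them. *)
HB.lock Definition unit_normal (R : realType) (x : R * R -> 'cV[R]_4) q : 'cV[R]_4 :=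
  2^-1 *: normal_part (dxi x q) (deta x q) (null_metric x q) (dxi (dxi x) q).
HB.lock Definition unit_normal' (R : realType) (x : R * R -> 'cV[R]_4) q : 'cV[R]_4 :=
  2^-1 *: normal_part (dxi x q) (deta x q) (null_metric x q) (deta (deta x) q).
HB.lock Definition unit_binormal (R : realType) (x : R * R -> 'cV[R]_4) q : 'cV[R]_4 :=
  (null_metric x q)^-1 *: cross4 (dxi x q) (deta x q) (unit_normal x q).

Section MovingFrame.
Variables (R : realType) (x : R * R -> 'cV[R]_4) (U : set (R * R)).
Hypotheses (oU : open U) (sx : smooth_on U x) (iso : isothermal x U).

Notation dot a b := (@Defs.dot R a b : R).
Notation P := (dxi x).
Notation Q := (deta x).
Notation h p := (null_metric x p).
Notation nor q := (normal_part (dxi x q) (deta x q) (null_metric x q)).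

Lemma unit_normalE : unit_normal x = fun q => 2^-1 *: nor q (dxi P q).
Proof. by rewrite unit_normal.unlock. Qed.

Lemma unit_normal'E : unit_normal' x = fun q => 2^-1 *: nor q (deta Q q).
Proof. by rewrite unit_normal'.unlock. Qed.

Lemma unit_binormalE :
  unit_binormal x = fun q => (h q)^-1 *: cross4 (P q) (Q q) (unit_normal x q).
Proof. by rewrite unit_binormal.unlock. Qed.

Let sP : smooth_on U P. Proof. exact: smooth_dxi. Qed.
Let sQ : smooth_on U Q. Proof. exact: smooth_deta. Qed.
Let sh : smooth_on U (null_metric x). Proof. exact: smooth_dot. Qed.
Let h0 p (Up : U p) : h p != 0.
Proof. by have [[_ _ _]] := isothermal_null sx iso Up. Qed.

Lemma smooth_normal_part (F : R * R -> 'cV[R]_4) : smooth_on U F ->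
  smooth_on U (fun q => nor q (F q)).
Proof.
move=> sF; have sV := smoothV oU h0 sh.
have sD (G : R * R -> 'cV[R]_4) : smooth_on U G ->
  smooth_on U (fun q => dot (F q) (G q) / h q).
  by move=> sG; apply: smoothM => //; exact: smooth_dot.
have sT : smooth_on U (fun q => tangent_part (P q) (Q q) (h q) (F q)).
  by apply: smoothD => //; apply: smoothZ => //; exact: sD.
apply: (@smooth_on_eq _ _ _
   (fun q => F q + (-1) *: tangent_part (P q) (Q q) (h q) (F q))) => //.
  by move=> q _; rewrite scaleN1r.
by apply: smoothD => //; apply: smoothZ => //; exact: smooth_cst.
Qed.

Lemma smooth_unit_normal : smooth_on U (unit_normal x).
Proof.
rewrite unit_normalE.
apply: smoothZ => //; first exact: smooth_cst.
by apply: smooth_normal_part; exact: smooth_dxi.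
Qed.

Lemma smooth_unit_normal' : smooth_on U (unit_normal' x).
Proof.
rewrite unit_normal'E; apply: smoothZ => //; first exact: smooth_cst.
by apply: smooth_normal_part; exact: smooth_deta.
Qed.

Lemma smooth_unit_binormal : smooth_on U (unit_binormal x).
Proof.
rewrite unit_binormalE.
apply: smoothZ => //; first exact: smoothV.
by apply: smooth_cross4 => //; exact: smooth_unit_normal.
Qed.

Lemma moving_frame q : U q ->
  dot (nor q (dxi P q)) (nor q (dxi P q)) = -4 ->
  null_frame (P q) (Q q) (unit_normal x q) (unit_binormal x q) (h q).
Proof.
move=> Uq e; have [nPQ _] := isothermal_null sx iso Uq.
have [nP nQ] := normal_part_orth (dxi P q) nPQ.
rewrite unit_binormalE; apply: null_frame_cross4 => //.
- by rewrite unit_normalE dotZl nP mulr0.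
- by rewrite unit_normalE dotZl nQ mulr0.
- by rewrite unit_normalE dotZl dotZr e; field.
Qed.

End MovingFrame.

Section Characterization.
Variables (R : realType).
Implicit Types (x : R * R -> 'cV[R]_4) (U : set (R * R)) (K kappa : R * R -> R).

Notation dot a b := (@Defs.dot R a b : R).

(** The equations that a surface in canonical coordinates satisfies, free of any
    choice of frames. *)
Definition canonical_equations x U K kappa : Prop := forall p, U p ->
  let P := dxi x p in let Q := deta x p in let h := null_metric x p in
  let A := dxi (dxi x) p in let C := deta (deta x) p in
  let N := normal_part P Q h in
  [/\ deta (dxi x) p = 0, dot (N A) (N A) = -4, dot (N C) (N C) = -4,
      K p = - (h * dot A C - dot A Q * dot P C) / h ^+ 3 &
      kappa p = - det4 P Q A C / h ^+ 3].

Lemma canonical_surface_equations x U K kappa :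
  canonical_minimal_surface_with x U K kappa ->
  [/\ domain U, smooth_on U x, isothermal x U & canonical_equations x U K kappa].
Proof.
move=> [[[dU [sx imm] tl] mini] st [iso can] gc nc]; have [oU _] := dU.
split=> // p Up.
have mini' q : U q -> deta (dxi x) q = 0.
  move=> Uq; have [V [X1 [X2 [oV Vq VU fr H0]]]] := mini q Uq.
  have [[_ _ _ h0] _] := isothermal_null sx iso Uq.
  move: H0; rewrite (mean_curvatureE oU sx iso oV VU fr Vq).
  by move/eqP; rewrite scaler_eq0 invr_eq0 (negPf h0) => /eqP.
have [NA NC] := (Phi'perp_dot oU sx iso Up).1 (can p Up).
split=> //; first exact: mini'.
- have [V [X1 [X2 [oV Vp VU fr ->]]]] := gc p Up.
  rewrite (gauss_formula oU sx iso oV VU mini' Vp fr).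
  by rewrite (deta_dxi_h oU sx mini' Up) (dxi_h oU sx mini' Up) (deta_h oU sx mini' Up).
- have [V [X1 [X2 [n1 [n2 [[oV Vp] VU [fr nf] ro ->]]]]]] := nc p Up.
  exact: (normal_formula oU sx iso oV VU mini' nf Vp fr (ro p Vp)).
Qed.

(** All geometric quantities are evaluated in one frame on the whole of U. Its tangent
    vectors have the components (1, -b) and (1, b) with b = 1 / (2 h) along P and Q,
    which makes the frame smooth without a square root of h. *)
Lemma canonical_surface_intro x U K kappa :
  domain U -> smooth_on U x -> isothermal x U -> canonical_equations x U K kappa ->
  canonical_minimal_surface_with x U K kappa.
Proof.
move=> dU sx iso eqs; have [oU _] := dU.
have mini q : U q -> deta (dxi x) q = 0 by move=> /eqs[].
have nPQ q : U q -> null_pair (dxi x q) (deta x q) (null_metric x q).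
  by move=> Uq; have [] := isothermal_null sx iso Uq.
have h0 q : U q -> null_metric x q != 0 by move=> /nPQ[].
have sh : smooth_on U (null_metric x).
  by apply: smooth_dot => //; [exact: smooth_dxi|exact: smooth_deta].
pose b q := (2 * null_metric x q)^-1.
have sb : smooth_on U b.
  apply: smoothV => // [q /h0 ?|]; first by rewrite mulf_neq0.
  by apply: smoothM => //; exact: smooth_cst.
pose X1 q := (1 - b q, 1 + b q); pose X2 q := (1 + b q, 1 - b q).
have sX1 : smooth_on U X1.
  by apply: smooth_pair => //; [apply: smoothB|apply: smoothD] => //; exact: smooth_cst.
have sX2 : smooth_on U X2.
  by apply: smooth_pair => //; [apply: smoothD|apply: smoothB] => //; exact: smooth_cst.
have xe q : [/\ xip (X1 q) = 1, etap (X1 q) = - b q, xip (X2 q) = 1 & etap (X2 q) = b q].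
  by split; rewrite /xip /etap /=; field.
have fr : tangent_frame x U X1 X2.
  split=> // q Uq; have [e1 e2 e3 e4] := xe q.
  rewrite !(pushE sx) // e1 e2 e3 e4 !(null_pair_dot _ _ _ _ (nPQ q Uq)) /b.
  by split; field; exact: h0.
have nf : normal_frame x U (unit_normal x) (unit_binormal x).
  split; [exact: smooth_unit_normal|exact: smooth_unit_binormal|move=> q Uq].
  have [_ NA _ _ _] := eqs q Uq.
  have [_ nPQ1 lPQ1 [nn ll nl]] := moving_frame sx iso Uq NA.
  by split=> //; apply/(normal_spaceE sx _ Uq).
have ro q : U q ->
    right_oriented (push x X1 q) (push x X2 q) (unit_normal x q) (unit_binormal x q).
  move=> Uq; have [_ NA _ _ _] := eqs q Uq.
  have [_ _ _ [_ ll _]] := moving_frame sx iso Uq NA.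
  have [e1 e2 e3 e4] := xe q.
  rewrite /right_oriented -/(det4 _ _ _ _) !(pushE sx) // det4_combine e1 e2 e3 e4.
  move: ll; rewrite -dot_cross4 {1}unit_binormalE dotZl => ll.
  have hq := h0 q Uq.
  suff -> : (1 * b q - - b q * 1) * dot (cross4 (dxi x q) (deta x q) (unit_normal x q))
    (unit_binormal x q) = 1 by [].
  by apply: etrans ll; rewrite /b; field.
split.
- split; last first.
    move=> p Up; exists U, X1, X2; split=> //.
    by rewrite (mean_curvatureE oU sx iso oU (fun _ => id) fr Up) mini // scaler0.
  split=> //.
    split=> // p Up v; rewrite (derive_null _ (smooth_differentiable sx Up)) => E.
    have [||e1 e2] := @null_pair_orth0 _ _ _ _ (xip v) (etap v) (nPQ p Up).
    + by rewrite E dot0l.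
    + by rewrite E dot0l.
    case: v e1 e2 {E} => v1 v2; rewrite /xip /etap /= => e1 e2.
    by congr pair; lra.
  move=> p Up; have [e1 e2 e3] := iso p Up; exists (du x p), (dv x p).
  by split; [exists (1, 0)|exists (0, 1)|exact: e3|rewrite -oppr_lt0 -e1].
- move=> p Up; have [_ NA NC _ _] := eqs p Up.
  rewrite ((Phi'perp_dot oU sx iso Up).2 (conj NA NC)) opprK /Dplus /= /dnorm2 /=.
  by rewrite expr1n expr0n subr0.
- split=> // p Up; have [_ NA NC _ _] := eqs p Up.
  exact: (Phi'perp_dot oU sx iso Up).2.
- move=> p Up; exists U, X1, X2; split=> //; have [_ _ _ -> _] := eqs p Up.
  rewrite (gauss_formula oU sx iso oU (fun _ => id) mini Up fr).
  by rewrite (deta_dxi_h oU sx mini Up) (dxi_h oU sx mini Up) (deta_h oU sx mini Up).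
- move=> p Up; exists U, X1, X2, (unit_normal x), (unit_binormal x); split=> //.
  have [_ _ _ _ ->] := eqs p Up.
  by rewrite (normal_formula oU sx iso oU (fun _ => id) mini nf Up fr (ro p Up)).
Qed.

End Characterization.

(** * The structure equations of the moving frame *)

Section StructureEquations.
Variables (R : realType) (x : R * R -> 'cV[R]_4) (U : set (R * R)).
Variables (K kappa : R * R -> R).
Hypotheses (oU : open U) (sx : smooth_on U x) (iso : isothermal x U).
Hypothesis eqs : canonical_equations x U K kappa.

Notation dot a b := (@Defs.dot R a b : R).
Notation P := (dxi x).
Notation Q := (deta x).
Notation A := (dxi (dxi x)).
Notation C := (deta (deta x)).
Notation h := (null_metric x).
Notation n := (unit_normal x).
Notation l := (unit_binormal x).

Notation m := (unit_normal' x).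

Let sP : smooth_on U P. Proof. exact: smooth_dxi. Qed.
Let sQ : smooth_on U Q. Proof. exact: smooth_deta. Qed.
Let sA : smooth_on U A. Proof. exact: smooth_dxi. Qed.
Let sC : smooth_on U C. Proof. exact: smooth_deta. Qed.
Let sh : smooth_on U h. Proof. exact: smooth_dot. Qed.
Let sn : smooth_on U n. Proof. exact: smooth_unit_normal. Qed.
Let sl : smooth_on U l. Proof. exact: smooth_unit_binormal. Qed.
Let sm : smooth_on U m. Proof. exact: smooth_unit_normal'. Qed.

Let mini q : U q -> deta P q = 0. Proof. by case/eqs. Qed.
Let fr q : U q -> null_frame (P q) (Q q) (n q) (l q) (h q).
Proof. by move=> Uq; have [_ NA _ _ _] := eqs Uq; exact: (moving_frame sx iso Uq NA). Qed.

Let D (W : normedModType R) (f : R * R -> W) q : smooth_on U f -> U q -> differentiable f q.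
Proof. exact: smooth_differentiable. Qed.

Let AE p : U p -> A p = 2 *: n p + (dxi h p / h p) *: P p.
Proof.
move=> Up; rewrite (dxi_h oU sx mini Up) unit_normalE scalerA divff // scale1r.
rewrite /normal_part /tangent_part (dxiP_P oU sx iso Up) mul0r scale0r addr0.
by rewrite subrK.
Qed.

Let CE p : U p -> C p = 2 *: m p + (deta h p / h p) *: Q p.
Proof.
move=> Up; rewrite (deta_h oU sx mini Up) unit_normal'E scalerA divff // scale1r.
rewrite /normal_part /tangent_part (detaQ_Q oU sx iso Up) mul0r scale0r add0r.
by rewrite [Defs.dot (P p) _]dotC subrK.
Qed.

Let mPQ p : U p -> dot (m p) (P p) = 0 /\ dot (m p) (Q p) = 0.
Proof.
move=> Up; have [nPQ _ _ _] := fr Up.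
have [e1 e2] := normal_part_orth (C p) nPQ.
by rewrite unit_normal'E !dotZl e1 e2 mulr0.
Qed.

Let mm p : U p -> dot (m p) (m p) = -1.
Proof. by move=> Up; have [_ _ NC _ _] := eqs Up; rewrite unit_normal'E dotZl dotZr NC; field. Qed.

(** The two curvatures are, up to the common factor, the components of m in the
    orthonormal frame (n, l). *)
Let KE p : U p -> K p = - 4 * dot (n p) (m p) / h p ^+ 2.
Proof.
move=> Up; have [_ _ _ -> _] := eqs Up; have [nPQ _ _ _] := fr Up.
rewrite unit_normal'E unit_normalE dotZl dotZr (dot_normal_part _ _ nPQ).
rewrite (dxiP_P oU sx iso Up) [Defs.dot (C p) (P p)]dotC.
by have [_ _ _ h0] := nPQ; field.
Qed.

Lemma moving_frame_det4 p : U p -> det4 (P p) (Q p) (n p) (l p) = h p.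
Proof.
move=> Up; have [[_ _ _ h0] _ _ [_ ll _]] := fr Up.
move: ll; rewrite {1}unit_binormalE dotZl dot_cross4 => ll.
by rewrite -[RHS]mulr1 -ll mulrA divff // mul1r.
Qed.

Let kappaE p : U p -> kappa p = - 4 * dot (l p) (m p) / h p ^+ 2.
Proof.
move=> Up; have [_ _ _ _ ->] := eqs Up; have fp := fr Up.
have [[PP QQ PQ h0] [nP nQ] [lP lQ] [nn ll nl]] := fp.
have [mP mQ] := mPQ Up.
rewrite (det4_frame _ _ fp) (AE Up) (CE Up) !dotDl !dotZl nn nl.
rewrite [Defs.dot (P p) (l p)]dotC lP [Defs.dot (P p) (n p)]dotC nP.
rewrite [Defs.dot (Q p) (l p)]dotC lQ [Defs.dot (Q p) (n p)]dotC nQ.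
rewrite (moving_frame_det4 Up).
by rewrite [Defs.dot (m p) (l p)]dotC; field.
Qed.

Let c2s2 p : U p -> dot (n p) (m p) ^+ 2 - dot (l p) (m p) ^+ 2 = 1.
Proof.
move=> Up; have fp := fr Up; have [mP mQ] := mPQ Up.
have := dot_expansion (m p) (m p) fp; rewrite mm // mP mQ.
rewrite [Defs.dot (m p) (n p)]dotC [Defs.dot (m p) (l p)]dotC.
move: (Defs.dot (n p) _) (Defs.dot (l p) _) => a b.
rewrite mulr0 addr0 mul0r => /(congr1 -%R); rewrite opprK => ->; ring.
Qed.

(** The unit normal vector m has its components on a hyperbola. Therefore the metric is
    determined by the two curvatures. *)
Lemma null_metric_curvature p : U p -> (K p ^+ 2 - kappa p ^+ 2) * h p ^+ 4 = 16.
Proof.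
move=> Up; have [[_ _ _ h0] _ _ _] := fr Up.
transitivity (16 * (dot (n p) (m p) ^+ 2 - dot (l p) (m p) ^+ 2) : R).
  by rewrite KE // kappaE //; field.
by rewrite c2s2 // mulr1.
Qed.

Lemma curvature_dot p : U p ->
  dot (n p) (m p) = - K p * h p ^+ 2 / 4 /\ dot (l p) (m p) = - kappa p * h p ^+ 2 / 4.
Proof.
move=> Up; have [[_ _ _ h0] _ _ _] := fr Up.
by rewrite KE // kappaE //; split; field.
Qed.

Let nP q : U q -> dot (n q) (P q) = 0. Proof. by move/fr=> [_ []]. Qed.
Let nQ q : U q -> dot (n q) (Q q) = 0. Proof. by move/fr=> [_ []]. Qed.
Let lP q : U q -> dot (l q) (P q) = 0. Proof. by move/fr=> [_ _ []]. Qed.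
Let lQ q : U q -> dot (l q) (Q q) = 0. Proof. by move/fr=> [_ _ []]. Qed.
Let nn q : U q -> dot (n q) (n q) = -1. Proof. by move/fr=> [_ _ _ []]. Qed.
Let ll q : U q -> dot (l q) (l q) = 1. Proof. by move/fr=> [_ _ _ []]. Qed.
Let nl q : U q -> dot (n q) (l q) = 0. Proof. by move/fr=> [_ _ _ []]. Qed.

(** n is half of dxi P up to a multiple of P, and both P and dxi P are constant in
    the direction eta. *)
Let deta_n p : U p -> exists k, deta n p = k *: P p.
Proof.
move=> Up; pose g q := - (2^-1 * (dot (A q) (Q q) / h q)).
have sg : smooth_on U g.
  apply: smoothN => //; apply: smoothM => //; first exact: smooth_cst.
  by apply: smoothM => //; [exact: smooth_dot|apply: smoothV => // q /fr[[]]].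
have E q : U q -> n q = 2^-1 *: A q + g q *: P q.
  move=> Uq; rewrite unit_normalE /normal_part /tangent_part (dxiP_P oU sx iso Uq).
  by apply/colP => i; rewrite /g !mxE; ring.
have e0 : deta A p = 0.
  rewrite detaE (dxiE P) (derive_swap_vec _ _ oU Up sP).
  transitivity ('D_((1, 1) : R * R) (fun=> 0 : 'cV[R]_4) p); last exact: derive_cst.
  by apply: derive_eq_on oU Up _ => q Uq; have := mini Uq; rewrite (detaE P).
exists (deta g p); rewrite detaE (derive_eq_on _ oU Up E).
have dc : differentiable (fun _ : R * R => 2^-1 : R) p := differentiable_cst _ _.
rewrite (derive_add _ (differentiable_scale dc (D sA Up))
   (differentiable_scale (D sg Up) (D sP Up))).
rewrite (derive_scale _ dc (D sA Up)) (derive_scale _ (D sg Up) (D sP Up)) derive_cst.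
have -> : 'D_((1, -1) : R * R) A p = 0 by rewrite -e0 (detaE A).
have -> : 'D_((1, -1) : R * R) P p = 0 by rewrite -(mini Up) (detaE P).
by rewrite !scaler0 scale0r !add0r addr0 (detaE g).
Qed.

Let dxi_m p : U p -> exists k, dxi m p = k *: Q p.
Proof.
move=> Up; pose g q := - (2^-1 * (dot (C q) (P q) / h q)).
have sg : smooth_on U g.
  apply: smoothN => //; apply: smoothM => //; first exact: smooth_cst.
  by apply: smoothM => //; [exact: smooth_dot|apply: smoothV => // q /fr[[]]].
have E q : U q -> m q = 2^-1 *: C q + g q *: Q q.
  move=> Uq; rewrite unit_normal'E /normal_part /tangent_part (detaQ_Q oU sx iso Uq).
  by apply/colP => i; rewrite /g !mxE; ring.
have q0 q : U q -> 'D_((1, 1) : R * R) Q q = 0.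
  by move=> Uq; rewrite -(mini Uq) -(dxi_eta oU sx Uq) (dxiE Q).
have e0 : 'D_((1, 1) : R * R) C p = 0.
  rewrite (detaE Q) (derive_swap_vec _ _ oU Up sQ).
  transitivity ('D_((1, -1) : R * R) (fun=> 0 : 'cV[R]_4) p); last exact: derive_cst.
  exact: derive_eq_on oU Up q0.
exists (dxi g p); rewrite dxiE (derive_eq_on _ oU Up E).
have dc : differentiable (fun _ : R * R => 2^-1 : R) p := differentiable_cst _ _.
rewrite (derive_add _ (differentiable_scale dc (D sC Up))
   (differentiable_scale (D sg Up) (D sQ Up))).
rewrite (derive_scale _ dc (D sC Up)) (derive_scale _ (D sg Up) (D sQ Up)) derive_cst.
by rewrite e0 (q0 p Up) !scaler0 scale0r !add0r addr0 (dxiE g).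
Qed.

(** The equations of Gauss and Weingarten for the moving frame (P, Q, n, l). All
    their coefficients are expressed by h and the components c, s of m. *)
Lemma structure_equations (h' c s : R * R -> R) p : U p ->
  (forall q, U q -> h q = h' q) ->
  (forall q, U q -> dot (n q) (m q) = c q) ->
  (forall q, U q -> dot (l q) (m q) = s q) ->
  let om := c p * dxi s p - s p * dxi c p in
  [/\ [/\ A p = 2 *: n p + (dxi h' p / h' p) *: P p,
          C p = 2 *: (- c p *: n p + s p *: l p) + (deta h' p / h' p) *: Q p,
          deta P p = 0 & dxi Q p = 0],
      dxi n p = (2 / h' p) *: Q p + om *: l p, deta n p = - (2 * c p / h' p) *: P p,
      dxi l p = om *: n p & deta l p = - (2 * s p / h' p) *: P p].
Proof.
move=> Up hE cE sE om; have fp := fr Up; have [[_ _ _ h0] _ _ _] := fp.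
have mE : m p = - c p *: n p + s p *: l p.
  rewrite {1}(frame_expansion (m p) fp); have [-> ->] := mPQ Up.
  rewrite !mul0r !scale0r add0r sub0r [Defs.dot (m p) _]dotC cE //.
  by rewrite [Defs.dot (m p) _]dotC sE // scaleNr.
have [x1 x2 e1 e2] := normal_field_derivs oU sx oU (fun _ => id) mini Up sn nP nQ.
have [y1 y2 f1 f2] := normal_field_derivs oU sx oU (fun _ => id) mini Up sl lP lQ.
have hx : dxi h' p = dxi h p.
  by rewrite !dxiE; apply: derive_eq_on oU Up _ => q /hE ->.
have he : deta h' p = deta h p.
  by rewrite !detaE; apply: derive_eq_on oU Up _ => q /hE ->.
have nnx : dot (dxi n p) (n p) = 0.
  by rewrite (dxiE n); exact: (dot_self_derive oU _ Up (D sn Up) nn).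
have lle : dot (deta l p) (l p) = 0.
  by rewrite (detaE l); exact: (dot_self_derive oU _ Up (D sl Up) ll).
have llx : dot (dxi l p) (l p) = 0.
  by rewrite (dxiE l); exact: (dot_self_derive oU _ Up (D sl Up) ll).
have lnx : dot (dxi l p) (n p) = - dot (dxi n p) (l p).
  rewrite (dxiE n) (dxiE l) [RHS]/= [in RHS]dotC.
  have ln q : U q -> dot (l q) (n q) = 0 by move=> Uq; rewrite dotC nl.
  exact: (derive_orth oU (1, 1) Up (D sl Up) (D sn Up) ln).
have nA : dot (n p) (A p) = -2.
  by rewrite (AE Up) dotDr !dotZr (nn Up) (nP Up) mulr0 addr0; ring.
have lA : dot (l p) (A p) = 0.
  by rewrite (AE Up) dotDr !dotZr [Defs.dot (l p) (n p)]dotC (nl Up) (lP Up); ring.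
have nC : dot (n p) (C p) = 2 * c p.
  by rewrite (CE Up) dotDr !dotZr (cE p Up) (nQ Up) mulr0 addr0.
have lC : dot (l p) (C p) = 2 * s p.
  by rewrite (CE Up) dotDr !dotZr (sE p Up) (lQ Up) mulr0 addr0.
have nle : dot (deta n p) (l p) = 0.
  by have [k ->] := deta_n Up; rewrite dotZl dotC (lP Up) mulr0.
have nne : dot (deta n p) (n p) = 0.
  by have [k ->] := deta_n Up; rewrite dotZl dotC (nP Up) mulr0.
have lne : dot (deta l p) (n p) = 0.
  have ln q : U q -> dot (l q) (n q) = 0 by move=> Uq; rewrite dotC nl.
  have := derive_orth oU (1, -1) Up (D sl Up) (D sn Up) ln.
  move: nle; rewrite (detaE n) (detaE l) => nle ->.
  by rewrite dotC nle oppr0.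
have cx : dxi c p = dot (dxi n p) (l p) * s p.
  transitivity ('D_((1, 1) : R * R) (fun q => dot (n q) (m q)) p).
    by rewrite dxiE; apply: derive_eq_on oU Up _ => q /cE ->.
  rewrite (derive_dot _ (D sn Up) (D sm Up)).
  have [k] := dxi_m Up; rewrite (dxiE m) => ->; rewrite dotZr nQ // mulr0 addr0.
  move: nnx; rewrite (dxiE n) => nnx.
  by rewrite mE dotDr !dotZr nnx; ring.
have sx' : dxi s p = dot (dxi n p) (l p) * c p.
  transitivity ('D_((1, 1) : R * R) (fun q => dot (l q) (m q)) p).
    by rewrite dxiE; apply: derive_eq_on oU Up _ => q /sE ->.
  rewrite (derive_dot _ (D sl Up) (D sm Up)).
  have [k] := dxi_m Up; rewrite (dxiE m) => ->; rewrite dotZr lQ // mulr0 addr0.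
  move: llx lnx; rewrite (dxiE l) => llx lnx.
  by rewrite mE dotDr !dotZr llx lnx; ring.
have omE : om = dot (dxi n p) (l p).
  rewrite /om cx sx' -[RHS]mulr1; have := c2s2 Up; rewrite cE // sE // => <-.
  by ring.
rewrite hx he -(hE p Up); split.
- split; [exact: AE|by rewrite -mE; exact: CE|exact: mini|].
  by rewrite (dxi_eta oU sx Up) mini.
- rewrite [LHS](frame_expansion _ fp) x1 x2 nnx nA opprK mul0r !scale0r add0r subr0.
  by rewrite omE.
- rewrite [LHS](frame_expansion _ fp) e1 e2 nne nle nC mul0r !scale0r !addr0 subr0.
  by rewrite mulNr.
- rewrite [LHS](frame_expansion _ fp) y1 y2 llx lnx lA oppr0 mul0r !scale0r.
  by rewrite !add0r addr0 scaleNr opprK omE.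
- rewrite [LHS](frame_expansion _ fp) f1 f2 lne lle lC mul0r !scale0r !addr0 subr0.
  by rewrite mulNr.
Qed.

End StructureEquations.

(** * Rigidity *)

Section LinearMaps.
Variable R : realType.
Notation dot a b := (@Defs.dot R a b : R).

Lemma linear_matrix (f : 'cV[R]_4 -> 'cV[R]_4) :
  (forall (k : R) a b, f (k *: a + b) = k *: f a + f b) ->
  exists A : 'M[R]_4, forall w, A *m w = f w.
Proof.
move=> fL; have f0 : f 0 = 0.
  have := fL (-1) 0 0; rewrite scaleN1r oppr0 addr0 scaleN1r addNr.
  by [].
exists (\matrix_(i, j) (f (delta_mx j 0)) i 0) => w; apply/colP => i.
rewrite mxE sum_ord4 !mxE.
have -> : w = w i40 0 *: delta_mx i40 0 + (w i41 0 *: delta_mx i41 0 +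
    (w i42 0 *: delta_mx i42 0 + (w i43 0 *: delta_mx i43 0 + 0))).
  rewrite {1}(matrix_sum_delta w) sum_ord4 addr0 !addrA !big_ord_recl !big_ord0.
  by rewrite !addr0.
rewrite !fL f0 !mxE /=; ring.
Qed.

Lemma derive_mulmx (A : 'M[R]_4) (F : R * R -> 'cV[R]_4) p v :
  differentiable F p -> 'D_v (fun q => A *m F q) p = A *m 'D_v F p.
Proof.
move=> dF; have dFi i : differentiable (fun q => F q i 0) p := differentiable_coordf i 0 dF.
have mulE w : A *m w = w i40 0 *: col i40 A + w i41 0 *: col i41 A
    + w i42 0 *: col i42 A + w i43 0 *: col i43 A.
  by apply/colP => i; rewrite !mxE sum_ord4; ring.
rewrite mulE !(derive_coord _ _ (diff_derivable dF)).
rewrite (_ : (fun q => A *m F q) = (fun q => F q i40 0 *: col i40 A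
    + F q i41 0 *: col i41 A + F q i42 0 *: col i42 A + F q i43 0 *: col i43 A));
  last by apply/funext => q; exact: mulE.
have dcol i : differentiable (fun q => F q i 0 *: col i A) p.
  exact: differentiable_scale (dFi i) (differentiable_cst _ _).
have e i : 'D_v (fun q => F q i 0 *: col i A) p = 'D_v (fun q => F q i 0) p *: col i A.
  rewrite (derive_scale _ (dFi i) (differentiable_cst _ _)) derive_cst.
  by rewrite scaler0 addr0.
have d1 := differentiableD (dcol i40) (dcol i41).
have d2 := differentiableD d1 (dcol i42).
by rewrite (derive_add _ d2 (dcol i43)) (derive_add _ d1 (dcol i42))
  (derive_add _ (dcol i40) (dcol i41)) !e.
Qed.

Lemma differentiable_mulmx (A : 'M[R]_4) (F : R * R -> 'cV[R]_4) p :
  differentiable F p -> differentiable (fun q => A *m F q) p.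
Proof.
move=> dF; apply: differentiable_mx => i j.
rewrite (_ : (fun q => _) = fun q => A i i40 * F q i40 j + A i i41 * F q i41 j
    + A i i42 * F q i42 j + A i i43 * F q i43 j); last first.
  by apply/funext => q; rewrite mxE sum_ord4.
have d k : differentiable (fun q => A i k * F q k j) p.
  by apply: differentiableM; [exact: differentiable_cst|exact: differentiable_coordf].
exact: differentiableD (differentiableD (differentiableD (d _) (d _)) (d _)) (d _).
Qed.

Lemma derive_dotr (w : 'cV[R]_4) (F : R * R -> 'cV[R]_4) p v : differentiable F p ->
  'D_v (fun q => dot w (F q)) p = dot w ('D_v F p).
Proof.
move=> dF; have dw : differentiable (fun _ : R * R => w) p := differentiable_cst _ _.
by rewrite (derive_dot _ dw dF) derive_cst dot0l add0r.
Qed.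

Lemma differentiable_dotr (w : 'cV[R]_4) (F : R * R -> 'cV[R]_4) p :
  differentiable F p -> differentiable (fun q => dot w (F q)) p.
Proof. by move=> dF; apply: differentiable_dot dF; exact: differentiable_cst. Qed.

End LinearMaps.

Section FrameTransport.
Variable R : realType.
Notation dot a b := (@Defs.dot R a b : R).
Implicit Types (P Q n l w : 'cV[R]_4) (h : R).

(** The linear map that carries the null frame (P, Q, n, l) to (P', Q', n', l'). *)
Definition frame_map P Q n l h P' Q' n' l' w : 'cV[R]_4 :=
  (dot w Q / h) *: P' + (dot w P / h) *: Q' - dot w n *: n' + dot w l *: l'.

Lemma frame_map_linear P Q n l h P' Q' n' l' (k : R) a b :
  frame_map P Q n l h P' Q' n' l' (k *: a + b) =
  k *: frame_map P Q n l h P' Q' n' l' a + frame_map P Q n l h P' Q' n' l' b.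
Proof.
rewrite /frame_map !dotDl !dotZl; apply/colP => i; rewrite !mxE; ring.
Qed.

Lemma frame_map_frame P Q n l h P' Q' n' l' : null_frame P Q n l h ->
  let f := frame_map P Q n l h P' Q' n' l' in
  [/\ f P = P', f Q = Q', f n = n' & f l = l'].
Proof.
move=> [[PP QQ PQ h0] [nP nQ] [lP lQ] [nn ll nl]]; rewrite /frame_map.
rewrite PP QQ PQ nP nQ lP lQ nn ll nl [Defs.dot Q P]dotC PQ.
rewrite [Defs.dot P n]dotC [Defs.dot P l]dotC [Defs.dot Q n]dotC [Defs.dot Q l]dotC.
rewrite [Defs.dot l n]dotC nP nQ lP lQ nl divff // mul0r.
by split; apply/colP => i; rewrite !mxE; ring.
Qed.

Lemma frame_map_dot P Q n l h P' Q' n' l' w w' :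
  null_frame P Q n l h -> null_frame P' Q' n' l' h ->
  let f := frame_map P Q n l h P' Q' n' l' in dot (f w) (f w') = dot w w'.
Proof.
move=> fr [[PP QQ PQ h0] [nP nQ] [lP lQ] [nn ll nl]] f.
rewrite (dot_expansion w w' fr) /f /frame_map !dotDl !dotDr !dotNl !dotNr !dotZl !dotZr.
rewrite PP QQ PQ nP nQ lP lQ nn ll nl [Defs.dot Q' P']dotC PQ.
rewrite [Defs.dot P' n']dotC [Defs.dot P' l']dotC [Defs.dot Q' n']dotC.
rewrite [Defs.dot Q' l']dotC [Defs.dot l' n']dotC nP nQ lP lQ nl.
by field.
Qed.

Lemma dot_frame_map P Q n l h P' Q' n' l' w w' :
  dot (frame_map P Q n l h P' Q' n' l' w) w' =
  (dot w Q * dot w' P' + dot w P * dot w' Q') / h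
  - dot w n * dot w' n' + dot w l * dot w' l'.
Proof.
rewrite /frame_map !dotDl !dotNl !dotZl.
by rewrite [Defs.dot P' _]dotC [Defs.dot Q' _]dotC [Defs.dot n' _]dotC
  [Defs.dot l' _]dotC; ring.
Qed.

Lemma derive_frame_map (P Q n l P' Q' n' l' : R * R -> 'cV[R]_4) (h : R * R -> R)
    w w' p v :
  differentiable P p -> differentiable Q p -> differentiable n p ->
  differentiable l p -> differentiable P' p -> differentiable Q' p ->
  differentiable n' p -> differentiable l' p -> differentiable h p -> h p != 0 ->
  'D_v (fun q => (dot w (Q q) * dot w' (P' q) + dot w (P q) * dot w' (Q' q)) * (h q)^-1
     - dot w (n q) * dot w' (n' q) + dot w (l q) * dot w' (l' q)) p =
  (dot w ('D_v Q p) * dot w' (P' p) + dot w (Q p) * dot w' ('D_v P' p)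
   + (dot w ('D_v P p) * dot w' (Q' p) + dot w (P p) * dot w' ('D_v Q' p))) / h p
  - (dot w (Q p) * dot w' (P' p) + dot w (P p) * dot w' (Q' p)) * 'D_v h p / h p ^+ 2
  - (dot w ('D_v n p) * dot w' (n' p) + dot w (n p) * dot w' ('D_v n' p))
  + (dot w ('D_v l p) * dot w' (l' p) + dot w (l p) * dot w' ('D_v l' p)).
Proof.
move=> dP dQ dn dl dP' dQ' dn' dl' dh h0.
have eP := differentiable_dotr w dP; have eQ := differentiable_dotr w dQ.
have en := differentiable_dotr w dn; have el := differentiable_dotr w dl.
have eP' := differentiable_dotr w' dP'; have eQ' := differentiable_dotr w' dQ'.
have en' := differentiable_dotr w' dn'; have el' := differentiable_dotr w' dl'.
have dk : differentiable (fun q => (h q)^-1) p by exact: differentiableV.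
have d1 := differentiableM eQ eP'; have d2 := differentiableM eP eQ'.
have d3 := differentiableD d1 d2; have d4 := differentiableM d3 dk.
have d5 := differentiableM en en'; have d6 := differentiableB d4 d5.
rewrite (derive_add _ d6 (differentiableM el el')) (derive_sub _ d4 d5).
rewrite (derive_mul _ d3 dk) (derive_add _ d1 d2) (derive_inv _ dh h0).
rewrite (derive_mul _ eQ eP') (derive_mul _ eP eQ') (derive_mul _ en en').
rewrite (derive_mul _ el el').
rewrite (derive_dotr w v dP) (derive_dotr w v dQ) (derive_dotr w v dn).
rewrite (derive_dotr w v dl) (derive_dotr w' v dP') (derive_dotr w' v dQ').
rewrite (derive_dotr w' v dn') (derive_dotr w' v dl').
by rewrite mulNr mulrN mulrA.
Qed.

End FrameTransport.

Section Rigidity.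
Variables (R : realType) (x y : R * R -> 'cV[R]_4) (U : set (R * R)).
Variables (K kappa : R * R -> R).
Notation dot a b := (@Defs.dot R a b : R).

Lemma lt0_expr4_inj (a b : R) : a < 0 -> b < 0 -> a ^+ 4 = b ^+ 4 -> a = b.
Proof.
move=> a0 b0 E; have ab : a + b != 0 by apply: ltr0_neq0; lra.
have ab2 : a ^+ 2 + b ^+ 2 != 0.
  by rewrite gt_eqF // addr_gt0 // exprn_even_gt0 //= lt_eqF.
have : (a - b) * ((a + b) * (a ^+ 2 + b ^+ 2)) = 0.
  by transitivity (a ^+ 4 - b ^+ 4); [ring|rewrite E subrr].
by move=> /eqP; rewrite !mulf_eq0 (negPf ab) (negPf ab2) !orbF subr_eq0 => /eqP.
Qed.

Lemma null_metric_unique p : open U ->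
  smooth_on U x -> isothermal x U -> canonical_equations x U K kappa ->
  smooth_on U y -> isothermal y U -> canonical_equations y U K kappa -> U p ->
  null_metric y p = null_metric x p.
Proof.
move=> oU sx isx ex sy isy ey Up.
have Ex := null_metric_curvature oU sx isx ex Up.
have Ey := null_metric_curvature oU sy isy ey Up.
have nx := isothermal_lt0 sx isx Up; have ny := isothermal_lt0 sy isy Up.
have K0 : K p ^+ 2 - kappa p ^+ 2 != 0.
  by apply: contraTneq (oner_neq0 R) => K0; move: Ex; rewrite K0 mul0r; lra.
have E : null_metric y p ^+ 4 = null_metric x p ^+ 4.
  by apply: (mulfI K0); apply: etrans Ey (esym Ex).
exact: lt0_expr4_inj ny nx E.
Qed.

(** Rigidity: the linear map that carries the moving frame of x to that of y is
    independent of the point, because both frames obey the same structure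
    equations, whose coefficients are determined by the two curvatures. *)
Lemma canonical_surface_rigid (t0 : R * R) : domain U -> U t0 ->
  smooth_on U x -> isothermal x U -> canonical_equations x U K kappa ->
  smooth_on U y -> isothermal y U -> canonical_equations y U K kappa ->
  exists (A : 'M[R]_4) (b : 'cV[R]_4),
    SO22 A /\ forall p, U p -> y p = A *m x p + b.
Proof.
move=> [oU cU] U0 sx isx ex sy isy ey.
pose h := null_metric x.
pose c q := - K q * h q ^+ 2 / 4; pose s q := - kappa q * h q ^+ 2 / 4.
have hy q : U q -> null_metric y q = h q.
  by move=> Uq; apply: null_metric_unique.
have cx q : U q -> dot (unit_normal x q) (unit_normal' x q) = c q.
  by move=> Uq; have [] := curvature_dot oU sx isx ex Uq.
have scx q : U q -> dot (unit_binormal x q) (unit_normal' x q) = s q.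
  by move=> Uq; have [] := curvature_dot oU sx isx ex Uq.
have cy q : U q -> dot (unit_normal y q) (unit_normal' y q) = c q.
  by move=> Uq; have [-> _] := curvature_dot oU sy isy ey Uq; rewrite hy.
have scy q : U q -> dot (unit_binormal y q) (unit_normal' y q) = s q.
  by move=> Uq; have [_ ->] := curvature_dot oU sy isy ey Uq; rewrite hy.
have strx q (Uq : U q) := structure_equations oU sx isx ex Uq (fun _ _ => erefl _) cx scx.
have stry q (Uq : U q) := structure_equations oU sy isy ey Uq hy cy scy.
have frx q : U q -> null_frame (dxi x q) (deta x q) (unit_normal x q) (unit_binormal x q) (h q).
  by move=> Uq; have [_ NA _ _ _] := ex q Uq; exact: (moving_frame sx isx Uq NA).
have fry q : U q -> null_frame (dxi y q) (deta y q) (unit_normal y q) (unit_binormal y q) (h q).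
  by move=> Uq; have [_ NA _ _ _] := ey q Uq; rewrite -hy //; exact: (moving_frame sy isy Uq NA).
have sP := smooth_dxi oU sx; have sQ := smooth_deta oU sx.
have sP' := smooth_dxi oU sy; have sQ' := smooth_deta oU sy.
have sn := smooth_unit_normal oU sx isx; have sl := smooth_unit_binormal oU sx isx.
have sn' := smooth_unit_normal oU sy isy; have sl' := smooth_unit_binormal oU sy isy.
have sh : smooth_on U h by exact: smooth_dot.
pose f q := frame_map (dxi x q) (deta x q) (unit_normal x q) (unit_binormal x q) (h q)
   (dxi y q) (deta y q) (unit_normal y q) (unit_binormal y q).
(* The matrix coefficients of f; they are constant by the structure equations. *)
pose B w w' q := (dot w (deta x q) * dot w' (dxi y q)
    + dot w (dxi x q) * dot w' (deta y q)) * (h q)^-1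
    - dot w (unit_normal x q) * dot w' (unit_normal y q)
    + dot w (unit_binormal x q) * dot w' (unit_binormal y q).
have BE w w' q : dot (f q w) w' = B w w' q by rewrite /f dot_frame_map.
have sB w w' : smooth_on U (B w w').
  have sw (z : 'cV[R]_4) F : smooth_on U F -> smooth_on U (fun q => dot z (F q)).
    by move=> sF; apply: smooth_dot => //; exact: smooth_cst.
  have sV := smoothV oU (fun q Uq => let: And4 _ _ _ h0 := let: And4 nP _ _ _ := frx q Uq in nP in h0) sh.
  apply: smoothD => //; last by apply: smoothM => //; exact: sw.
  apply: smoothB => //; last by apply: smoothM => //; exact: sw.
  by apply: smoothM => //; apply: smoothD => //; apply: smoothM => //; exact: sw.
have D (W : normedModType R) (g : R * R -> W) q : smooth_on U g -> U q -> differentiable g q.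
  exact: smooth_differentiable.
have dB w w' q v : U q -> 'D_v (B w w') q = 0.
  move=> Uq; rewrite (derive_nullR _ (D _ _ _ (sB w w') Uq)).
  have [[_ _ _ h0] _ _ _] := frx q Uq.
  have dBE := fun v => derive_frame_map w w' v (D _ _ _ sP Uq) (D _ _ _ sQ Uq)
    (D _ _ _ sn Uq) (D _ _ _ sl Uq) (D _ _ _ sP' Uq) (D _ _ _ sQ' Uq)
    (D _ _ _ sn' Uq) (D _ _ _ sl' Uq) (D _ _ _ sh Uq) h0.
  have [[a1 a2 a3 a4] a5 a6 a7 a8] := strx q Uq.
  have [[b1 b2 b3 b4] b5 b6 b7 b8] := stry q Uq.
  have x1 (W : normedModType R) (F : R * R -> W) : 'D_((1, 1) : R * R) F q = dxi F q.
    by rewrite dxiE.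
  have x2 (W : normedModType R) (F : R * R -> W) : 'D_((1, -1) : R * R) F q = deta F q.
    by rewrite detaE.
  have e1 : dxi (B w w') q = 0.
    rewrite (dxiE (B w w')); apply: etrans (dBE (1, 1)) _.
    rewrite !x1 a1 a4 a5 a7 b1 b4 b5 b7 !(dotDr, dotZr, dot0r).
    move: h0; rewrite -/h.
    move: (h q) (dxi h q) (_ - s q * _) => k k1 om.
    move: (Defs.dot _ _) (Defs.dot _ _) (Defs.dot _ _) (Defs.dot _ _).
    move=> r1 r2 r3 r4.
    move: (Defs.dot _ _) (Defs.dot _ _) (Defs.dot _ _) (Defs.dot _ _).
    by move=> r5 r6 r7 r8 k0; field.
  have e2 : deta (B w w') q = 0.
    rewrite (detaE (B w w')); apply: etrans (dBE (1, -1)) _.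
    rewrite !x2 a2 a3 a6 a8 b2 b3 b6 b8 !(dotDr, dotZr, dot0r).
    move: h0; rewrite -/h.
    move: (h q) (deta h q) (c q) (s q) => k k1 c1 s1.
    move: (Defs.dot _ _) (Defs.dot _ _) (Defs.dot _ _) (Defs.dot _ _).
    move=> r1 r2 r3 r4.
    move: (Defs.dot _ _) (Defs.dot _ _) (Defs.dot _ _) (Defs.dot _ _).
    by move=> r5 r6 r7 r8 k0; field.
  by rewrite e1 e2 !mulr0 addr0.
have Bcst w w' q : U q -> B w w' q = B w w' t0.
  move=> Uq; apply: (constant_connected oU cU _ _ U0 Uq).
    by move=> r Ur; exact: D.
  by move=> r v Ur; exact: dB.
have [A AE] := linear_matrix (fun k a b => frame_map_linear (dxi x t0) (deta x t0)
   (unit_normal x t0) (unit_binormal x t0) (h t0) (dxi y t0) (deta y t0)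
   (unit_normal y t0) (unit_binormal y t0) k a b).
have Af q w : U q -> A *m w = f q w.
  move=> Uq; apply: dot_eq => w'; rewrite AE.
  by apply: etrans (BE w w' t0) _; rewrite -(Bcst w w' q Uq) -BE.
exists A, (y t0 - A *m x t0); split.
  split=> [a b|]; first by rewrite !AE; exact: frame_map_dot (frx t0 U0) (fry t0 U0).
  have [e1 e2 e3 e4] := frame_map_frame (dxi y t0) (deta y t0)
    (unit_normal y t0) (unit_binormal y t0) (frx t0 U0).
  have := det4_mul A (dxi x t0) (deta x t0) (unit_normal x t0) (unit_binormal x t0).
  rewrite !AE e1 e2 e3 e4 (moving_frame_det4 sx isx ex U0).
  rewrite (moving_frame_det4 sy isy ey U0) hy // => E.
  have [[_ _ _ h0] _ _ _] := frx t0 U0.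
  by apply: (mulIf h0); rewrite -E mul1r.
have transport q : U q -> A *m dxi x q = dxi y q /\ A *m deta x q = deta y q.
  move=> Uq; rewrite !(Af q) //.
  by have [e1 e2 _ _] := frame_map_frame (dxi y q) (deta y q)
    (unit_normal y q) (unit_binormal y q) (frx q Uq).
have dyx q v : U q -> 'D_v (fun r => y r - A *m x r) q = 0.
  move=> Uq; have dx := D _ _ _ sx Uq; have dy := D _ _ _ sy Uq.
  have dAx : differentiable (fun r => A *m x r) q by exact: differentiable_mulmx.
  have [e1 e2] := transport q Uq.
  rewrite (derive_sub _ dy dAx) (derive_mulmx _ _ dx) (derive_null _ dx).
  by rewrite (derive_null _ dy) mulmxDr -!scalemxAr e1 e2 subrr.
have dyx' q : U q -> differentiable (fun r => y r - A *m x r) q.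
  move=> Uq; apply: differentiableB; first exact: D sy Uq.
  by apply: differentiable_mulmx; exact: D sx Uq.
move=> p Up.
suff : y p - A *m x p = y t0 - A *m x t0 by move=> <-; rewrite addrC subrK.
apply/colP => i.
apply: (@constant_connected _ U (fun r => (y r - A *m x r) i 0) oU cU _ _ _ _ U0 Up).
  by move=> r Ur; exact: differentiable_coordf (dyx' r Ur).
move=> r v Ur; rewrite -derive_coord; last exact: diff_derivable (dyx' r Ur).
by rewrite dyx // mxE.
Qed.

End Rigidity.

(** * Squares in null coordinates *)

Section Diamond.
Variable R : realType.
Implicit Types (o p q v : R * R) (e r s : R).

(** A square with sides along the null directions. *)
Definition diamond o r : set (R * R) :=
  [set p | `|p.1 + p.2 - (o.1 + o.2)| < r /\ `|p.1 - p.2 - (o.1 - o.2)| < r].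

Lemma diamond_center o r : 0 < r -> diamond o r o.
Proof. by move=> r0; split; rewrite subrr normr0. Qed.

Lemma norm_convex_lt (a b r s : R) : 0 <= s <= 1 -> `|a| < r -> `|b| < r ->
  `|a + s * (b - a)| < r.
Proof.
move=> /andP[s0 s1] ar br; pose M := Num.max `|a| `|b|.
have Mr : M < r by rewrite gt_max ar br.
apply: le_lt_trans Mr; have -> : a + s * (b - a) = (1 - s) * a + s * b by ring.
apply: le_trans (ler_normD _ _) _; rewrite !normrM (ger0_norm s0).
rewrite [`|1 - s|]ger0_norm ?subr_ge0 //.
have -> : M = (1 - s) * M + s * M by ring.
have aM : `|a| <= M by rewrite le_max lexx.
have bM : `|b| <= M by rewrite le_max lexx orbT.
by apply: lerD; apply: ler_wpM2l; rewrite ?subr_ge0.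
Qed.

Lemma diamond_convex o r p q s : 0 <= s <= 1 ->
  diamond o r p -> diamond o r q -> diamond o r (p + s *: (q - p)).
Proof.
move=> s01 [p1 p2] [q1 q2]; split.
  rewrite (_ : _ - _ = (p.1 + p.2 - (o.1 + o.2)) +
     s * ((q.1 + q.2 - (o.1 + o.2)) - (p.1 + p.2 - (o.1 + o.2)))).
    exact: norm_convex_lt.
  by rewrite pair_scale2 /=; ring.
rewrite (_ : _ - _ - _ = (p.1 - p.2 - (o.1 - o.2)) +
   s * ((q.1 - q.2 - (o.1 - o.2)) - (p.1 - p.2 - (o.1 - o.2)))).
  exact: norm_convex_lt.
by rewrite pair_scale2 /=; ring.
Qed.

(** It is the union of the segments from its center. *)
Lemma diamond_connected o r : 0 < r -> connected (diamond o r).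
Proof.
move=> r0.
pose seg q := (fun s : R => o + s *: (q - o)) @` `[0, 1].
have -> : diamond o r = \bigcup_(q in diamond o r) seg q.
  apply/seteqP; split => q.
    move=> Dq; exists q => //; exists 1; first by rewrite /= in_itv /= ler01 lexx.
    by rewrite scale1r addrC subrK.
  move=> [z Dz [s /=]]; rewrite in_itv /= => s01 <-.
  by apply: diamond_convex => //; exact: diamond_center.
apply: bigcup_connected.
  exists o => q Dq; exists 0; first by rewrite /= in_itv /= ler01 lexx.
  by rewrite scale0r addr0.
move=> q Dq; apply: connected_continuous_connected; first exact: segment_connected.
apply: continuous_subspaceT => s.
apply: differentiable_continuous.
have [d _] := @is_diffD _ _ _ (cst o) (fun t : R => t *: (q - o)) _ _ s
  (is_diff_cst _ _) (is_diff_scalel _ _).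
exact: d.
Qed.

Lemma diamond_open o r : open (diamond o r).
Proof.
rewrite openE => p [p1 p2]; rewrite /interior.
pose e := Num.min (r - `|p.1 + p.2 - (o.1 + o.2)|) (r - `|p.1 - p.2 - (o.1 - o.2)|) / 2.
have e0 : 0 < e by rewrite divr_gt0 // lt_min !subr_gt0 p1 p2.
apply/nbhs_ballP; exists e => //= q [q1 q2].
have e1 : 2 * e <= r - `|p.1 + p.2 - (o.1 + o.2)|.
  by rewrite /e mulrC divfK // ge_min lexx.
have e2 : 2 * e <= r - `|p.1 - p.2 - (o.1 - o.2)|.
  by rewrite /e mulrC divfK // ge_min lexx orbT.
move: q1 q2; rewrite -!ball_normE /ball_ /= => q1 q2; split.
  have -> : q.1 + q.2 - (o.1 + o.2) =
    (p.1 + p.2 - (o.1 + o.2)) - ((p.1 - q.1) + (p.2 - q.2)) by ring.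
  apply: le_lt_trans (ler_normB _ _) _.
  have := ler_normD (p.1 - q.1) (p.2 - q.2); lra.
have -> : q.1 - q.2 - (o.1 - o.2) =
  (p.1 - p.2 - (o.1 - o.2)) - ((p.1 - q.1) - (p.2 - q.2)) by ring.
apply: le_lt_trans (ler_normB _ _) _.
have := ler_normB (p.1 - q.1) (p.2 - q.2); lra.
Qed.

Lemma diamond_nbhs o (U : set (R * R)) : nbhs o U ->
  exists2 r, 0 < r & diamond o r `<=` U.
Proof.
move=> /nbhs_ballP[r /= r0 rU]; exists r => // p [p1 p2]; apply: rU.
split; rewrite -ball_normE /ball_ /=.
  have -> : o.1 - p.1 = - ((p.1 + p.2 - (o.1 + o.2)) + (p.1 - p.2 - (o.1 - o.2))) / 2.
    by field.
  rewrite normrM normrN [`|2^-1|]ger0_norm //.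
  by have := ler_normD (p.1 + p.2 - (o.1 + o.2)) (p.1 - p.2 - (o.1 - o.2)); lra.
have -> : o.2 - p.2 = - ((p.1 + p.2 - (o.1 + o.2)) - (p.1 - p.2 - (o.1 - o.2))) / 2.
  by field.
rewrite normrM normrN [`|2^-1|]ger0_norm //.
by have := ler_normB (p.1 + p.2 - (o.1 + o.2)) (p.1 - p.2 - (o.1 - o.2)); lra.
Qed.

Lemma diamondS o r r' : r' <= r -> diamond o r' `<=` diamond o r.
Proof. by move=> rr p [p1 p2]; split; apply: lt_le_trans rr. Qed.

(** The projection along (1, -e) to the null line of o with direction (1, e). *)
Definition null_proj e o p : R * R :=
  ((p.1 + e * p.2 + (o.1 - e * o.2)) / 2, e * (p.1 + e * p.2 - (o.1 - e * o.2)) / 2).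

Lemma null_proj_in e o r p : e = 1 \/ e = -1 -> 0 < r ->
  diamond o r p -> diamond o r (null_proj e o p).
Proof.
move=> e1 r0 [p1 p2]; case: e1 => ->; split; rewrite /null_proj /=.
- by rewrite [X in `|X|](_ : _ = p.1 + p.2 - (o.1 + o.2)) //; field.
- by rewrite [X in `|X|](_ : _ = 0) ?normr0 //; field.
- by rewrite [X in `|X|](_ : _ = 0) ?normr0 //; field.
- by rewrite [X in `|X|](_ : _ = p.1 - p.2 - (o.1 - o.2)) //; field.
Qed.

(** The segment from p to its projection has direction (1, -e). *)
Lemma null_proj_const e o r (f : R * R -> R) p : e = 1 \/ e = -1 -> 0 < r ->
  (forall q, diamond o r q -> differentiable f q) ->
  (forall q, diamond o r q -> 'D_(1, - e) f q = 0) ->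
  diamond o r p -> f (null_proj e o p) = f p.
Proof.
move=> e1 r0 df f0 Dp; have Dq := null_proj_in e1 r0 Dp.
have E : null_proj e o p - p = (- (p.1 - e * p.2 - (o.1 - e * o.2)) / 2) *: (1, - e).
  by case: e1 => ->; rewrite pair_scale2 /null_proj [LHS]surjective_pairing /=;
    congr pair; field.
apply: constant_segment => s s01; have Ds := diamond_convex s01 Dp Dq.
  exact: df.
rewrite E deriveE; last by rewrite -E; exact: df.
rewrite linearZ /= -deriveE; last by rewrite -E; exact: df.
by rewrite -E f0 // scaler0.
Qed.

End Diamond.

(** * Liouville's equation *)

Section NullProjection.
Variable R : realType.
Implicit Types (o p q v : R * R) (e r : R) (f : R * R -> R).

Lemma differentiable_null_coord e p :
  differentiable (fun q : R * R => q.1 + e * q.2) p.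
Proof.
apply: differentiableD; first by have [] := is_diff_fst p.
apply: differentiableM; first exact: differentiable_cst.
by have [] := is_diff_snd p.
Qed.

Lemma derive_null_coord e p v :
  'D_v (fun q : R * R => q.1 + e * q.2) p = v.1 + e * v.2.
Proof.
have [d1 _] := is_diff_fst p; have [d2 _] := is_diff_snd p.
have dc := differentiable_cst e p.
rewrite (derive_add _ d1 (differentiableM dc d2)) (derive_mul _ dc d2) derive_cst.
rewrite mul0r add0r.
have did : differentiable (id : R * R -> R * R) p by exact: ex_diff.
rewrite (derive_fst v did) (derive_snd v did).
by rewrite derive_id.
Qed.

Lemma differentiable_null_proj e o p : differentiable (null_proj e o) p.
Proof.
have d := differentiable_null_coord e p.
apply: differentiable_pair; apply: differentiableM (differentiable_cst _ _).
  by apply: differentiableD => //; exact: differentiable_cst.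
apply: differentiableM; first exact: differentiable_cst.
by apply: differentiableB => //; exact: differentiable_cst.
Qed.

Lemma derive_null_proj e o f p v :
  'D_v (f \o null_proj e o) p =
  'D_(((v.1 + e * v.2) / 2) *: ((1, e) : R * R)) f (null_proj e o p).
Proof.
pose F (k : R) := k^-1 *: ((f \o null_proj e o) (k *: v + p) - (f \o null_proj e o) p).
pose G (k : R) := k^-1 *: (f (k *: (((v.1 + e * v.2) / 2) *: ((1, e) : R * R))
   + null_proj e o p) - f (null_proj e o p)).
have FG : F = G.
  apply/funext => k; rewrite /F /G /=; congr (_ *: (f _ - _)).
  rewrite !pair_scale2 /null_proj [RHS]surjective_pairing /=.
  by congr pair; field.
exact: (congr1 (fun H : R -> R => lim (H @ 0^')) FG).
Qed.

Lemma smooth_null_proj e o r f : e = 1 \/ e = -1 -> 0 < r ->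
  smooth_on (diamond o r) f -> smooth_on (diamond o r) (f \o null_proj e o).
Proof.
move=> e1 r0; have oU := @diamond_open R o r.
move=> sf k; elim: k f sf => [|k IHk] f sf; have dfp p : diamond o r p ->
    differentiable (f \o null_proj e o) p.
- move=> Dp; apply: differentiable_comp; first exact: differentiable_null_proj.
  by apply: smooth_differentiable sf _; exact: null_proj_in.
- by move=> p /dfp /differentiable_continuous.
- move=> Dp; apply: differentiable_comp; first exact: differentiable_null_proj.
  by apply: smooth_differentiable sf _; exact: null_proj_in.
have sg v : smooth_on (diamond o r)
    (fun q => 'D_(((v.1 + e * v.2) / 2) *: ((1, e) : R * R)) f q).
  exact: smooth_derive.
apply/Ck_onSP; split; first exact: dfp.
- apply: Ck_on_eq oU _ (IHk _ (sg (1, 0))) => q Uq.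
  by rewrite /du derive_null_proj.
- apply: Ck_on_eq oU _ (IHk _ (sg (0, 1))) => q Uq.
  by rewrite /dv derive_null_proj.
Qed.

End NullProjection.

Section Liouville.
Variable R : realType.
Implicit Types (o p q v : R * R) (r k : R).

Let x1 (g : R * R -> R) p : 'D_((1, 1) : R * R) g p = dxi g p.
Proof. by rewrite dxiE. Qed.

Let x2 (g : R * R -> R) p : 'D_((1, -1) : R * R) g p = deta g p.
Proof. by rewrite detaE. Qed.

Let D U (g : R * R -> R) p : smooth_on U g -> U p -> differentiable g p.
Proof. exact: smooth_differentiable. Qed.

Lemma dxi_deta_product U (a1 a2 b1 b2 f : R * R -> R) p : open U ->
  smooth_on U a1 -> smooth_on U a2 -> smooth_on U b1 -> smooth_on U b2 ->
  (forall q, U q -> deta a1 q = 0 /\ deta a2 q = 0) ->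
  (forall q, U q -> dxi b1 q = 0 /\ dxi b2 q = 0) ->
  (forall q, U q -> f q = a1 q * b1 q + a2 q * b2 q) -> U p ->
  [/\ dxi f p = dxi a1 p * b1 p + dxi a2 p * b2 p,
      deta f p = a1 p * deta b1 p + a2 p * deta b2 p &
      dxi (deta f) p = dxi a1 p * deta b1 p + dxi a2 p * deta b2 p].
Proof.
move=> oU s1 s2 t1 t2 a0 b0 fE.
have DfE v q : U q -> 'D_v f q = 'D_v a1 q * b1 q + a1 q * 'D_v b1 q
    + ('D_v a2 q * b2 q + a2 q * 'D_v b2 q).
  move=> Uq; rewrite (derive_eq_on v oU Uq fE).
  have c1 := D s1 Uq; have c2 := D s2 Uq; have d1 := D t1 Uq; have d2 := D t2 Uq.
  by rewrite (derive_add _ (differentiableM c1 d1) (differentiableM c2 d2))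
    (derive_mul _ c1 d1) (derive_mul _ c2 d2).
have fe q : U q -> deta f q = a1 q * deta b1 q + a2 q * deta b2 q.
  move=> Uq; rewrite -x2 DfE // !x2; have [-> ->] := a0 q Uq; ring.
move=> Up; have [z1 z2] := b0 p Up; split; last 2 first.
- exact: fe.
- have e1 := smooth_deta oU t1; have e2 := smooth_deta oU t2.
  have c1 := D s1 Up; have c2 := D s2 Up; have d1 := D e1 Up; have d2 := D e2 Up.
  rewrite -x1 (derive_eq_on (1, 1) oU Up fe).
  rewrite (derive_add _ (differentiableM c1 d1) (differentiableM c2 d2)).
  rewrite (derive_mul _ c1 d1) (derive_mul _ c2 d2) !x1.
  have zero (b : R * R -> R) : smooth_on U b -> (forall q, U q -> dxi b q = 0) -> dxi (deta b) p = 0.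
    move=> sb b0'; rewrite (dxi_swap oU Up sb) -x2 (derive_eq_on (1, -1) oU Up b0').
    exact: derive_cst.
  rewrite (zero b1 t1) ?(zero b2 t2) ?mulr0 ?addr0 //.
    by move=> q /b0[].
  by move=> q /b0[].
- by rewrite -x1 DfE // !x1 z1 z2; ring.
Qed.

(** For a sum of this form f f_{xi eta} - f_xi f_eta is the product of the Wronskians
    of (a1, a2) and of (b1, b2). *)
Lemma wronskian_factor U k (f a1 a2 b1 b2 : R * R -> R) p : open U ->
  smooth_on U f -> smooth_on U a1 -> smooth_on U a2 -> smooth_on U b1 ->
  smooth_on U b2 ->
  (forall q, U q -> deta a1 q = 0 /\ deta a2 q = 0) ->
  (forall q, U q -> dxi b1 q = 0 /\ dxi b2 q = 0) ->
  (forall q, U q -> f q = a1 q * b1 q + a2 q * b2 q) -> k != 0 ->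
  (forall q, U q -> f q * dxi (deta f) q - dxi f q * deta f q = k) ->
  (forall q, U q -> a1 q * dxi a2 q - a2 q * dxi a1 q = k) -> U p ->
  b1 p * deta b2 p - b2 p * deta b1 p = 1.
Proof.
move=> oU sf s1 s2 t1 t2 a0 b0 fE k0 fk w Up.
have [e1 e2 e3] := dxi_deta_product oU s1 s2 t1 t2 a0 b0 fE Up.
apply: (mulfI k0); rewrite mulr1 -{1}(w p Up) -[RHS](fk p Up) e1 e2 e3 (fE p Up).
ring.
Qed.

(** A solution of Liouville's equation (ln f)_{xi eta} = k / f^2 is a sum of two
    products of functions of one variable: f_{xi xi} / f depends on xi only, so
    that as a function of xi both f and f_eta solve the same linear equation of
    order two, of which f( . , eta0) and f_eta( . , eta0) form a basis. *)
Lemma liouville_factor o r k (f : R * R -> R) : 0 < r -> k != 0 ->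
  smooth_on (diamond o r) f -> (forall p, diamond o r p -> f p != 0) ->
  (forall p, diamond o r p -> f p * dxi (deta f) p - dxi f p * deta f p = k) ->
  exists a1 a2 b1 b2 : R * R -> R,
    [/\ smooth_on (diamond o r) a1, smooth_on (diamond o r) a2,
        smooth_on (diamond o r) b1 & smooth_on (diamond o r) b2] /\
    forall p, diamond o r p ->
      [/\ deta a1 p = 0, deta a2 p = 0, dxi b1 p = 0 & dxi b2 p = 0] /\
      [/\ f p = a1 p * b1 p + a2 p * b2 p,
          a1 p * dxi a2 p - a2 p * dxi a1 p = k &
          b1 p * deta b2 p - b2 p * deta b1 p = 1].
Proof.
move=> r0 k0 sf f0 fk; set U := diamond o r in sf f0 fk *.
have oU : open U := @diamond_open R o r.
(* A p has the same xi as p and the same eta as o. *)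
pose A := null_proj 1 o; have AU p : U p -> U (A p).
  by move=> Up; apply: null_proj_in => //; left.
have sc (g : R * R -> R) : smooth_on U g -> smooth_on U (g \o A).
  by move=> sg; apply: smooth_null_proj => //; left.
have dcomp (g : R * R -> R) p : smooth_on U g -> U p -> dxi (g \o A) p = dxi g (A p).
  move=> sg Up; rewrite !dxiE derive_null_proj /=; congr ('D__ _ _).
  by rewrite mul1r divff // scale1r.
have ecomp (g : R * R -> R) p : deta (g \o A) p = 0.
  rewrite detaE derive_null_proj /= mul1r subrr mul0r scale0r; exact: derive0.
have sx := smooth_dxi oU sf; have se := smooth_deta oU sf.
have sxx := smooth_dxi oU sx; have sxe := smooth_dxi oU se.
have fxe p : U p -> deta (dxi f) p = dxi (deta f) p.
  by move=> Up; rewrite (dxi_swap oU Up sf).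
have fxxe p : U p -> deta (dxi (dxi f)) p = dxi (dxi (deta f)) p.
  move=> Up; rewrite -(dxi_swap oU Up sx) -[LHS]x1 -[RHS]x1.
  exact: derive_eq_on oU Up fxe.
have star p : U p -> f p * dxi (dxi (deta f)) p = dxi (dxi f) p * deta f p.
  move=> Up.
  have d1 := differentiableM (D sf Up) (D sxe Up).
  have d2 := differentiableM (D sx Up) (D se Up).
  have := derive_eq_on (1, 1) oU Up fk; rewrite derive_cst (derive_sub _ d1 d2).
  rewrite (derive_mul _ (D sf Up) (D sxe Up)).
  rewrite (derive_mul _ (D sx Up) (D se Up)) !x1.
  move: (f p) (dxi f p) (deta f p) (dxi (deta f) p) (dxi (dxi f) p).
  by move: (dxi (dxi (deta f)) p) => *; lra.
have ratio p : U p -> dxi (dxi f) p * f (A p) = f p * dxi (dxi f) (A p).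
  move=> Up; have sV := smoothV oU f0 sf.
  have sg : smooth_on U (fun q => dxi (dxi f) q * (f q)^-1) by exact: smoothM.
  have := @null_proj_const _ 1 o r (fun q => dxi (dxi f) q * (f q)^-1) p
    (or_introl erefl) r0 (fun q Uq => D sg Uq) _ Up.
  rewrite -/A => E; have {}E := E _.
  have fp := f0 p Up; have fA := f0 _ (AU p Up).
  have : dxi (dxi f) (A p) / f (A p) = dxi (dxi f) p / f p.
    apply: E => q Uq.
    rewrite (derive_mul _ (D sxx Uq) (D sV Uq)) (derive_inv _ (D sf Uq) (f0 q Uq)).
    rewrite !x2 fxxe //; have := star q Uq; have := f0 q Uq.
    move: (f q) (dxi (dxi (deta f)) q) (dxi (dxi f) q) (deta f q) => a b c d a0 e.
    have -> : b * a^-1 + c * (- d / a ^+ 2) = (a * b - c * d) / a ^+ 2 by field.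
    by rewrite e subrr mul0r.
  move: (f (A p)) (f p) (dxi (dxi f) (A p)) (dxi (dxi f) p) fA fp => a b c d a0 b0 e.
  have -> : d = c / a * b by rewrite e divfK.
  by field.
have ratio' p : U p -> f p * dxi (dxi (deta f)) (A p) = dxi (dxi f) p * deta f (A p).
  move=> Up; have fA := f0 _ (AU p Up); apply: (mulfI fA).
  have s1 := star _ (AU p Up); have r1 := ratio p Up.
  transitivity (f p * (f (A p) * dxi (dxi (deta f)) (A p))); first by ring.
  by rewrite s1 mulrA -r1; ring.
pose F (g : R * R -> R) := g \o A.
(* Cramer's rule for f = b1 f(., eta0) + b2 f_eta(., eta0) and the xi-derivative of
   this equation, a system with determinant k. *)
pose b1 p := k^-1 * (f p * F (dxi (deta f)) p - dxi f p * F (deta f) p).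
pose b2 p := k^-1 * (dxi f p * F f p - f p * F (dxi f) p).
have sb1 : smooth_on U b1.
  apply: smoothM => //; first exact: smooth_cst.
  by apply: smoothB => //; apply: smoothM => //; exact: sc.
have sb2 : smooth_on U b2.
  apply: smoothM => //; first exact: smooth_cst.
  by apply: smoothB => //; apply: smoothM => //; exact: sc.
exists (F f), (F (deta f)), b1, b2; split; first by split=> //; exact: sc.
have zb p : U p -> dxi b1 p = 0 /\ dxi b2 p = 0.
  move=> Up.
  have dk : differentiable (fun _ : R * R => k^-1) p := differentiable_cst _ _.
  have d1 := D sf Up; have d2 := D sx Up.
  have e1 : dxi (F f) p = dxi f (A p) by exact: dcomp.
  have e2 : dxi (F (deta f)) p = dxi (deta f) (A p) by exact: dcomp.
  have e3 : dxi (F (dxi f)) p = dxi (dxi f) (A p) by exact: dcomp.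
  have e4 : dxi (F (dxi (deta f))) p = dxi (dxi (deta f)) (A p) by exact: dcomp.
  have g1 := D (sc _ sf) Up; have g2 := D (sc _ sx) Up.
  have g3 := D (sc _ se) Up; have g4 := D (sc _ sxe) Up.
  split.
    rewrite -x1 (derive_mul _ dk (differentiableB (differentiableM d1 g4) (differentiableM d2 g3))).
    rewrite (derive_sub _ (differentiableM d1 g4) (differentiableM d2 g3)).
    rewrite (derive_mul _ d1 g4) (derive_mul _ d2 g3) derive_cst !x1 e4 e2.
    by rewrite ratio' // /F /=; ring.
  rewrite -x1 (derive_mul _ dk (differentiableB (differentiableM d2 g1) (differentiableM d1 g2))).
  rewrite (derive_sub _ (differentiableM d2 g1) (differentiableM d1 g2)).
  rewrite (derive_mul _ d2 g1) (derive_mul _ d1 g2) derive_cst !x1 e1 e3.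
  by rewrite ratio // /F /=; ring.
have w p : U p -> F f p * dxi (F (deta f)) p - F (deta f) p * dxi (F f) p = k.
  move=> Up; have e1 : dxi (F f) p = dxi f (A p) by exact: dcomp.
  have e2 : dxi (F (deta f)) p = dxi (deta f) (A p) by exact: dcomp.
  by rewrite e1 e2 -(fk _ (AU p Up)) /F /=; ring.
have fab q : U q -> f q = F f q * b1 q + F (deta f) q * b2 q.
  move=> Uq; have kA := fk _ (AU q Uq); apply: (mulfI k0).
  rewrite -{1}kA /b1 /b2 /F /=; move: k0.
  move: (f q) (dxi f q) (f (A q)) (dxi f (A q)) (deta f (A q)) (dxi (deta f) (A q)).
  by move=> a b c d e' g k0'; field.
have ea q : deta (F f) q = 0 /\ deta (F (deta f)) q = 0 by split; exact: ecomp.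
move=> p Up; split; first by have [] := zb p Up; have [] := ea p.
split; [exact: fab|exact: w|].
have sF1 := sc _ sf; have sF2 := sc _ se.
exact: (wronskian_factor oU sf sF1 sF2 sb1 sb2 (fun q _ => ea q) zb fab k0 fk w Up).
Qed.

End Liouville.

(** * Integration in null coordinates *)

Section Integration.
Variable R : realType.
Implicit Types (o p q v : R * R) (e r : R).

Lemma continuous_antiderivative (phi : R -> R) (a b : R) : a < b ->
  (forall s, a <= s <= b -> {for s, continuous phi}) ->
  exists Phi : R -> R, forall s, a < s < b -> is_derive s 1 Phi (phi s).
Proof.
move=> ab cphi.
have cw : {within `[a, b], continuous phi}.
  apply: continuous_in_subspaceT => s; rewrite inE /= in_itv /=; exact: cphi.
have int : (@lebesgue_measure R).-integrable `[a, b] (EFin \o phi).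
  by apply: continuous_compact_integrable => //; exact: segment_compact.
exists (fun y => (\int[lebesgue_measure]_(t in [set` `[a, y]]) (phi t))%R).
move=> s /andP[as_ sb].
have [|d E] := @continuous_FTC1_closed R phi a s b sb int as_.
  by apply: cphi; rewrite !ltW.
by apply: DeriveDef; [exact: d|rewrite -derive1E; exact: E].
Qed.

(** G integrates g along a null line through o. The interval of integration has to
    be compact, whence the smaller diamond. *)
Lemma null_primitive e o r (g : R * R -> R) : e = 1 \/ e = -1 -> 0 < r ->
  smooth_on (diamond o r) g ->
  (forall q, diamond o r q -> 'D_(1, - e) g q = 0) ->
  exists G : R * R -> R, smooth_on (diamond o (r / 2)) G /\
    forall q v, diamond o (r / 2) q -> 'D_v G q = (v.1 + e * v.2) / 2 * g q.
Proof.
move=> e1 r0 sg g0.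
have r2 : 0 < r / 2 by rewrite divr_gt0.
pose l q := q.1 + e * q.2; pose m := o.1 - e * o.2.
pose gam (s : R) : R * R := ((s + m) / 2, e * (s - m) / 2).
have gamD s : `|s - l o| < r -> diamond o r (gam s).
  rewrite /l /gam /m => sr; case: e1 sr => -> sr; split => /=.
  - by rewrite [X in `|X|](_ : _ = s - (o.1 + 1 * o.2)) //; field.
  - by rewrite [X in `|X|](_ : _ = 0) ?normr0 //; field.
  - by rewrite [X in `|X|](_ : _ = 0) ?normr0 //; field.
  - by rewrite [X in `|X|](_ : _ = s - (o.1 + -1 * o.2)) //; field.
have dgam s : differentiable gam s.
  have did : differentiable (id : R -> R) s by exact: ex_diff.
  apply: differentiable_pair; apply: differentiableM (differentiable_cst _ _).
    by apply: differentiableD did (differentiable_cst _ _).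
  apply: differentiableM (differentiable_cst _ _) _.
  exact: differentiableB did (differentiable_cst _ _).
pose phi s := g (gam s).
have cphi s : l o - r / 2 <= s <= l o + r / 2 -> {for s, continuous phi}.
  move=> sr; apply: differentiable_continuous; apply: differentiable_comp (dgam s) _.
  apply: smooth_differentiable sg _; apply: gamD.
  by rewrite ltr_norml; apply/andP; split; lra.
have ab : l o - r / 2 < l o + r / 2 by lra.
have [Phi PhiP] := continuous_antiderivative ab cphi.
have lr q : diamond o (r / 2) q -> l o - r / 2 < l q < l o + r / 2.
  rewrite /l => -[]; rewrite !ltr_norml => /andP[a1 a2] /andP[b1 b2].
  by case: e1 => ->; apply/andP; split; lra.
have gl q : diamond o (r / 2) q -> phi (l q) = g q.
  move=> Dq; have Dr : diamond o r q by apply: diamondS Dq; lra.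
  apply: (null_proj_const e1 r0 _ g0 Dr) => z; exact: smooth_differentiable.
have dl q := differentiable_null_coord e q.
have DG q v : diamond o (r / 2) q ->
    'D_v (fun z => 2^-1 * Phi (l z)) q = (v.1 + e * v.2) / 2 * g q.
  move=> Dq; have iP := PhiP _ (lr q Dq).
  have dP : differentiable (Phi \o l) q := differentiable_chain iP (dl q).
  rewrite (derive_mul _ (differentiable_cst _ _) dP) derive_cst mul0r add0r.
  rewrite (derive_chain v iP (dl q)) gl // derive_null_coord.
  by rewrite mulrCA mulrC [2^-1 * _]mulrC.
exists (fun z => 2^-1 * Phi (l z)); split=> //.
have oU := @diamond_open R o (r / 2).
have sg2 : smooth_on (diamond o (r / 2)) g by apply: smooth_onS sg; apply: diamondS; lra.
apply: smooth_intro.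
- move=> q Dq; apply: differentiableM (differentiable_cst _ _) _.
  exact: differentiable_chain (PhiP _ (lr q Dq)) (dl q).
- apply: (@smooth_on_eq _ _ _ (fun q => (1 + e * 0) / 2 * g q)) => //.
    by move=> q Dq; rewrite /du DG.
  by apply: smoothM => //; exact: smooth_cst.
- apply: (@smooth_on_eq _ _ _ (fun q => (0 + e * 1) / 2 * g q)) => //.
    by move=> q Dq; rewrite /dv DG.
  by apply: smoothM => //; exact: smooth_cst.
Qed.

(** A primitive of P in xi plus a primitive of Q in eta. *)
Lemma null_potential o r (P Q : R * R -> 'cV[R]_4) : 0 < r ->
  smooth_on (diamond o r) P -> smooth_on (diamond o r) Q ->
  (forall q, diamond o r q -> deta P q = 0) ->
  (forall q, diamond o r q -> dxi Q q = 0) ->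
  exists x : R * R -> 'cV[R]_4, smooth_on (diamond o (r / 2)) x /\
    forall q, diamond o (r / 2) q -> dxi x q = P q /\ deta x q = Q q.
Proof.
move=> r0 sP sQ eP xQ; have oU := @diamond_open R o r.
have pot i : exists G : R * R -> R, smooth_on (diamond o (r / 2)) G /\
    forall q v, diamond o (r / 2) q -> 'D_v G q = (v.1 + 1 * v.2) / 2 * P q i 0.
  apply: null_primitive (smooth_coord i 0 oU sP) _ => // [|q Dq]; first by left.
  rewrite -derive_coord; last exact: smooth_derivable sP Dq.
  by have := eP q Dq; rewrite detaE => ->; rewrite mxE.
have pot' i : exists G : R * R -> R, smooth_on (diamond o (r / 2)) G /\
    forall q v, diamond o (r / 2) q -> 'D_v G q = (v.1 + -1 * v.2) / 2 * Q q i 0.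
  apply: null_primitive (smooth_coord i 0 oU sQ) _ => // [|q Dq]; first by right.
  rewrite opprK -derive_coord; last exact: smooth_derivable sQ Dq.
  by have := xQ q Dq; rewrite dxiE => ->; rewrite mxE.
pose G i := projT1 (cid (pot i)); pose H i := projT1 (cid (pot' i)).
have GP i := projT2 (cid (pot i)); have HP i := projT2 (cid (pot' i)).
have oV := @diamond_open R o (r / 2).
have sx : smooth_on (diamond o (r / 2)) (fun q => \col_i (G i q + H i q)).
  apply: smooth_mx => // i j.
  apply: (@smooth_on_eq _ _ _ (fun q => G i q + H i q)) => //.
    by move=> q _; rewrite mxE.
  by apply: smoothD => //; [have [] := GP i|have [] := HP i].
exists (fun q => \col_i (G i q + H i q)); split=> // q Dq.
have Dx v : 'D_v (fun q => \col_i (G i q + H i q)) q =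
    ((v.1 + v.2) / 2) *: P q + ((v.1 - v.2) / 2) *: Q q.
  apply/colP => i; rewrite derive_coord; last exact: smooth_derivable sx Dq.
  rewrite (_ : (fun z => _) = (fun z => G i z + H i z)); last first.
    by apply/funext => z; rewrite mxE.
  have [sG dG] := GP i; have [sH dH] := HP i.
  rewrite (derive_add _ (smooth_differentiable sG Dq) (smooth_differentiable sH Dq)).
  by rewrite dG // dH // !mxE mul1r mulN1r.
rewrite dxiE detaE !Dx /=; split.
  by rewrite divff // scale1r subrr mul0r scale0r addr0.
by rewrite subrr mul0r scale0r add0r opprK divff // scale1r.
Qed.

End Integration.

(** * Null vectors as matrices of rank one *)

Section TensorVectors.
Variable R : realType.
Notation dot a b := (@Defs.dot R a b : R).

(** The scalar square is a multiple of the determinant under a linear isomorphism with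
    the 2 by 2 matrices; [tens] is the vector of the matrix of rank one with
    entries u_i v_j. *)
Definition tens (u1 u2 v1 v2 : R) : 'cV[R]_4 :=
  \col_i [:: u1 * v1 - u2 * v2; u1 * v1 + u2 * v2;
             u1 * v2 + u2 * v1; u2 * v1 - u1 * v2]`_i.

Lemma dot_tens (u1 u2 v1 v2 w1 w2 z1 z2 : R) :
  dot (tens u1 u2 v1 v2) (tens w1 w2 z1 z2) =
  2 * (u1 * w2 - u2 * w1) * (v1 * z2 - v2 * z1).
Proof. by rewrite dotE !mxE /=; ring. Qed.

Lemma det4_tens (u1 u2 v1 v2 p1 p2 q1 q2 w1 w2 z1 z2 r1 r2 s1 s2 : R) :
  det4 (tens u1 u2 v1 v2) (tens w1 w2 z1 z2)
    (tens p1 p2 v1 v2 + tens u1 u2 q1 q2) (tens r1 r2 z1 z2 + tens w1 w2 s1 s2) =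
  4 * ((u1 * p2 - u2 * p1) * (w1 * r2 - w2 * r1) * (v1 * z2 - v2 * z1) ^+ 2
        - (v1 * q2 - v2 * q1) * (z1 * s2 - z2 * s1) * (u1 * w2 - u2 * w1) ^+ 2).
Proof. by rewrite det4E sum_ord4 /det3f /bump /= !inord4 !mxE /=; ring. Qed.

Lemma tens_bilinear u1 u2 v1 v2 : tens u1 u2 v1 v2 =
  (u1 * v1) *: tens 1 0 1 0 + (u2 * v2) *: tens 0 1 0 1
  + ((u1 * v2) *: tens 1 0 0 1 + (u2 * v1) *: tens 0 1 1 0).
Proof. by apply/colP => -[[|[|[|[|i]]]] ?] //; rewrite !mxE /=; ring. Qed.

Lemma smooth_tens U (u1 u2 v1 v2 : R * R -> R) : open U ->
  smooth_on U u1 -> smooth_on U u2 -> smooth_on U v1 -> smooth_on U v2 ->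
  smooth_on U (fun q => tens (u1 q) (u2 q) (v1 q) (v2 q)).
Proof.
move=> oU s1 s2 t1 t2.
have term (a b : R * R -> R) (w : 'cV[R]_4) : smooth_on U a -> smooth_on U b ->
    smooth_on U (fun q => (a q * b q) *: w).
  by move=> sa sb; apply: smoothZ => //; [exact: smoothM|exact: smooth_cst].
have -> : (fun q => tens (u1 q) (u2 q) (v1 q) (v2 q)) = fun q =>
    (u1 q * v1 q) *: tens 1 0 1 0 + (u2 q * v2 q) *: tens 0 1 0 1
    + ((u1 q * v2 q) *: tens 1 0 0 1 + (u2 q * v1 q) *: tens 0 1 1 0).
  by apply/funext => q; exact: tens_bilinear.
by apply: smoothD => //; apply: smoothD => //; exact: term.
Qed.

Lemma derive_tens (u1 u2 v1 v2 : R * R -> R) p v :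
  differentiable u1 p -> differentiable u2 p ->
  differentiable v1 p -> differentiable v2 p ->
  'D_v (fun q => tens (u1 q) (u2 q) (v1 q) (v2 q)) p =
  tens ('D_v u1 p) ('D_v u2 p) (v1 p) (v2 p) + tens (u1 p) (u2 p) ('D_v v1 p) ('D_v v2 p).
Proof.
move=> d1 d2 e1 e2.
have dt (a b : R * R -> R) (w : 'cV[R]_4) : differentiable a p -> differentiable b p ->
    differentiable (fun q => (a q * b q) *: w) p.
  move=> da db; apply: differentiable_scale (differentiableM da db) _.
  exact: differentiable_cst.
have Dt (a b : R * R -> R) (w : 'cV[R]_4) : differentiable a p -> differentiable b p ->
    'D_v (fun q => (a q * b q) *: w) p = ('D_v a p * b p + a p * 'D_v b p) *: w.
  move=> da db.
  rewrite (derive_scale v (differentiableM da db) (differentiable_cst w _)).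
  by rewrite derive_cst scaler0 addr0 (derive_mul _ da db).
have -> : (fun q => tens (u1 q) (u2 q) (v1 q) (v2 q)) = fun q =>
    (u1 q * v1 q) *: tens 1 0 1 0 + (u2 q * v2 q) *: tens 0 1 0 1
    + ((u1 q * v2 q) *: tens 1 0 0 1 + (u2 q * v1 q) *: tens 0 1 1 0).
  by apply/funext => q; exact: tens_bilinear.
have f1 := dt _ _ (tens 1 0 1 0) d1 e1; have f2 := dt _ _ (tens 0 1 0 1) d2 e2.
have f3 := dt _ _ (tens 1 0 0 1) d1 e2; have f4 := dt _ _ (tens 0 1 1 0) d2 e1.
rewrite (derive_add v (differentiableD f1 f2) (differentiableD f3 f4)).
rewrite (derive_add v f1 f2) (derive_add v f3 f4).
rewrite (Dt _ _ _ d1 e1) (Dt _ _ _ d2 e2) (Dt _ _ _ d1 e2) (Dt _ _ _ d2 e1).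
move: ('D_v u1 p) ('D_v u2 p) ('D_v v1 p) ('D_v v2 p) => a b c d.
by apply/colP => -[[|[|[|[|i]]]] ?] //; rewrite !mxE /=; ring.
Qed.

End TensorVectors.

(** * Surfaces from solutions of Liouville's equation *)

Section Construction.
Variable R : realType.
Implicit Types (o p q : R * R).
Notation dot a b := (@Defs.dot R a b : R).

(** The vectors c and d are the derivatives of a and b, so that A and C are those of P
    and Q. The quarter turns of the factors of Q make the determinants in [dot_tens]
    the pairings f1 and f2, and everything else is a Wronskian. *)
Lemma tens_null_curves (a1 a2 a3 a4 b1 b2 b3 b4 c1 c2 c3 c4 d1 d2 d3 d4 k f1 f2 : R) :
  let P := tens a1 a2 a3 a4 in let Q := tens b2 (- b1) (- b4) b3 in
  let A := tens c1 c2 a3 a4 + tens a1 a2 c3 c4 in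
  let C := tens d2 (- d1) (- b4) b3 + tens b2 (- b1) (- d4) d3 in
  a1 * c2 - a2 * c1 = k -> a3 * c4 - a4 * c3 = k ->
  b1 * d2 - b2 * d1 = 1 -> b3 * d4 - b4 * d3 = 1 ->
  f1 = a1 * b1 + a2 * b2 -> f2 = a3 * b3 + a4 * b4 ->
  [/\ [/\ dot P P = 0, dot Q Q = 0, dot A P = 0 & dot C Q = 0],
      dot P Q = - (2 * f1 * f2), dot A A = - (4 * k ^+ 2), dot C C = -4 &
      dot P Q * dot A C - dot A Q * dot P C = 4 * k * (f1 ^+ 2 + f2 ^+ 2) /\
      det4 P Q A C = 4 * k * (f2 ^+ 2 - f1 ^+ 2)].
Proof.
move=> P Q A C wa wa' wb wb' -> ->.
rewrite /P /Q /A /C det4_tens !(dotDl, dotDr) !dot_tens; split.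
- by split; ring.
- ring.
- by rewrite expr2 -{1}wa -wa'; ring.
- apply: etrans (_ : - 4 * (b1 * d2 - b2 * d1) * (b3 * d4 - b4 * d3) = _).
    by ring.
  by rewrite wb wb' !mulr1.
- split.
  + apply: etrans (_ : 4 * ((a1 * c2 - a2 * c1) * (b1 * d2 - b2 * d1)
        * (a3 * b3 + a4 * b4) ^+ 2 + (a3 * c4 - a4 * c3) * (b3 * d4 - b4 * d3)
        * (a1 * b1 + a2 * b2) ^+ 2) = _); first by ring.
    by rewrite wa wa' wb wb'; ring.
  + apply: etrans (_ : 4 * ((a1 * c2 - a2 * c1) * (b1 * d2 - b2 * d1)
        * (a3 * b3 + a4 * b4) ^+ 2 - (a3 * c4 - a4 * c3) * (b3 * d4 - b4 * d3)
        * (a1 * b1 + a2 * b2) ^+ 2) = _); first by ring.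
    by rewrite wa wa' wb wb'; ring.
Qed.

(** The factorizations of f1 and f2 give two curves of matrices of rank one, P(xi) and
    Q(eta). Being null curves, they are the null derivatives of a surface. *)
Lemma liouville_surface o r k (f1 f2 K kappa : R * R -> R) : 0 < r -> k ^+ 2 = 1 ->
  smooth_on (diamond o r) f1 -> smooth_on (diamond o r) f2 ->
  (forall p, diamond o r p -> 0 < f1 p /\ 0 < f2 p) ->
  (forall p, diamond o r p -> f1 p * dxi (deta f1) p - dxi f1 p * deta f1 p = k) ->
  (forall p, diamond o r p -> f2 p * dxi (deta f2) p - dxi f2 p * deta f2 p = k) ->
  (forall p, diamond o r p ->
     K p = k * (f1 p ^+ 2 + f2 p ^+ 2) / (2 * (f1 p * f2 p) ^+ 3) /\
     kappa p = k * (f2 p ^+ 2 - f1 p ^+ 2) / (2 * (f1 p * f2 p) ^+ 3)) ->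
  exists x, canonical_minimal_surface_with x (diamond o (r / 2)) K kappa.
Proof.
move=> r0 k2 s1 s2 fp e1 e2 KE; set V := diamond o r in s1 s2 fp e1 e2 KE.
have k0 : k != 0 by apply/eqP => z; move: k2; rewrite z expr0n /=; lra.
have n1 p : V p -> f1 p != 0 by move=> /fp[/lt0r_neq0].
have n2 p : V p -> f2 p != 0 by move=> /fp[_ /lt0r_neq0].
have [a1 [a2 [b1 [b2 [[sa1 sa2 sb1 sb2] F1]]]]] := liouville_factor r0 k0 s1 n1 e1.
have [a3 [a4 [b3 [b4 [[sa3 sa4 sb3 sb4] F2]]]]] := liouville_factor r0 k0 s2 n2 e2.
have oV : open V := @diamond_open R o r.
have D f : smooth_on V f -> forall p, V p -> differentiable (f : R * R -> R) p.
  by move=> sf p Vp; exact: smooth_differentiable sf Vp.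
pose P q := tens (a1 q) (a2 q) (a3 q) (a4 q).
pose Q q := tens (b2 q) (- b1 q) (- b4 q) (b3 q).
have sP : smooth_on V P by exact: smooth_tens.
have sQ : smooth_on V Q by apply: smooth_tens => //; exact: smoothN.
have DP v p : V p -> 'D_v P p = tens ('D_v a1 p) ('D_v a2 p) (a3 p) (a4 p)
    + tens (a1 p) (a2 p) ('D_v a3 p) ('D_v a4 p).
  by move=> Vp; apply: derive_tens; exact: D.
have DQ v p : V p -> 'D_v Q p = tens ('D_v b2 p) (- 'D_v b1 p) (- b4 p) (b3 p)
    + tens (b2 p) (- b1 p) (- 'D_v b4 p) ('D_v b3 p).
  move=> Vp; have d1 := D _ sb1 p Vp; have d4 := D _ sb4 p Vp.
  rewrite (derive_tens v (D _ sb2 p Vp) (differentiableN d1) (differentiableN d4)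
    (D _ sb3 p Vp)).
  by rewrite (derive_opp v d1) (derive_opp v d4).
have t0l u1 u2 : tens 0 0 u1 u2 = 0 :> 'cV[R]_4.
  by apply/colP => -[[|[|[|[|i]]]] ?] //; rewrite !mxE /=; ring.
have t0r u1 u2 : tens u1 u2 0 0 = 0 :> 'cV[R]_4.
  by apply/colP => -[[|[|[|[|i]]]] ?] //; rewrite !mxE /=; ring.
have DPxi p : V p -> dxi P p = tens (dxi a1 p) (dxi a2 p) (a3 p) (a4 p)
    + tens (a1 p) (a2 p) (dxi a3 p) (dxi a4 p).
  by rewrite !dxiE; exact: DP.
have DQeta p : V p -> deta Q p = tens (deta b2 p) (- deta b1 p) (- b4 p) (b3 p)
    + tens (b2 p) (- b1 p) (- deta b4 p) (deta b3 p).
  by rewrite !detaE; exact: DQ.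
have eP p : V p -> deta P p = 0.
  move=> Vp; have [[z1 z2 _ _] _] := F1 p Vp; have [[z3 z4 _ _] _] := F2 p Vp.
  rewrite detaE; apply: etrans (DP _ p Vp) _; move: z1 z2 z3 z4; rewrite !detaE.
  by move=> -> -> -> ->; rewrite t0l t0r addr0.
have xQ p : V p -> dxi Q p = 0.
  move=> Vp; have [[_ _ z1 z2] _] := F1 p Vp; have [[_ _ z3 z4] _] := F2 p Vp.
  rewrite dxiE; apply: etrans (DQ _ p Vp) _; move: z1 z2 z3 z4; rewrite !dxiE.
  by move=> -> -> -> ->; rewrite oppr0 t0l t0r addr0.
have [x [sx xE]] := null_potential r0 sP sQ eP xQ.
set U := diamond o (r / 2) in sx xE *.
have UV : U `<=` V by apply: diamondS; lra.
have oU : open U := @diamond_open R o (r / 2).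
have dU : domain U by split=> //; apply: diamond_connected; lra.
exists x.
have frame p (Up : U p) := let Vp := UV p Up in
  let: conj _ (And3 g1 wa1 wb1) := F1 p Vp in
  let: conj _ (And3 g2 wa2 wb2) := F2 p Vp in
  tens_null_curves wa1 wa2 wb1 wb2 g1 g2.
apply: canonical_surface_intro => //.
- move=> p Up; have [[PP QQ _ _] PQ _ _ _] := frame p Up.
  have [p1 p2] := fp p (UV p Up); have [Px Qx] := xE p Up.
  have dx := smooth_differentiable sx Up.
  rewrite (du_null dx) (dv_null dx) Px Qx -/(P p) -/(Q p) in PP QQ PQ *.
  rewrite !(dotDl, dotDr, dotNl, dotNr, dotZl, dotZr) PP QQ [Defs.dot (Q p) _]dotC PQ.
  split; [ring|ring|].
  have := mulr_gt0 p1 p2; lra.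
- move=> p Up; have [[PP QQ AP CQ] PQ AA CC [KK det]] := frame p Up.
  have [Px Qx] := xE p Up; have Vp := UV p Up.
  have xA : dxi (dxi x) p = tens (dxi a1 p) (dxi a2 p) (a3 p) (a4 p)
      + tens (a1 p) (a2 p) (dxi a3 p) (dxi a4 p).
    by rewrite -(DPxi p Vp); apply: dxi_eq_on oU Up _ => q /xE[].
  have xC : deta (deta x) p = tens (deta b2 p) (- deta b1 p) (- b4 p) (b3 p)
      + tens (b2 p) (- b1 p) (- deta b4 p) (deta b3 p).
    by rewrite -(DQeta p Vp); apply: deta_eq_on oU Up _ => q /xE[].
  have xeta : deta (dxi x) p = 0.
    by rewrite -[RHS](eP p Vp); apply: deta_eq_on oU Up _ => q /xE[].
  have [p1 p2] := fp p Vp; have f10 := n1 p Vp; have f20 := n2 p Vp.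
  have nPQ : null_pair (P p) (Q p) (dot (P p) (Q p)).
    split=> //; rewrite PQ oppr_eq0 !mulf_neq0 //.
  have [KE1 KE2] := KE p Vp.
  rewrite /null_metric Px Qx xA xC.
  rewrite -/(P p) -/(Q p) in PP QQ AP CQ PQ AA CC KK det *.
  split=> //.
  + by rewrite (dot_normal_part _ _ nPQ) AP AA k2 !mul0r mulr0 addr0 mul0r subr0 mulr1.
  + by rewrite (dot_normal_part _ _ nPQ) CQ CC !mulr0 mul0r addr0 mul0r subr0.
  + by rewrite KK PQ KE1; field; rewrite f10 f20.
  + by rewrite det PQ KE2; field; rewrite f10 f20.
Qed.

End Construction.

(** * Decoupling the equations of the two curvatures *)

Section Decoupling.
Variable R : realType.
Implicit Types (U : set (R * R)) (p q : R * R) (f g w : R * R -> R).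

Lemma hlaplacian_null U f p : open U -> U p -> smooth_on U f ->
  hlaplacian f p = dxi (deta f) p.
Proof.
move=> oU Up sf; have s1 := smooth_du sf; have s2 := smooth_dv sf.
have d1 := smooth_differentiable s1 Up; have d2 := smooth_differentiable s2 Up.
have -> : dxi (deta f) p = dxi (fun q => du f q - dv f q) p.
  apply: dxi_eq_on oU Up _ => q Uq; exact: deta_uv (smooth_differentiable sf Uq).
have -> : dxi (fun q => du f q - dv f q) p = dxi (du f) p - dxi (dv f) p.
  by rewrite !dxiE; exact: derive_sub.
rewrite (dxi_uv d1) (dxi_uv d2).
have e : du (dv f) p = dv (du f) p by exact: derive_swap oU Up sf.
rewrite /hlaplacian e.
by move: (du _ _) (dv (du f) p) (dv _ _) => a b c; ring.
Qed.

Lemma dxi_deta_lin U f g (a b : R) p : open U -> U p ->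
  smooth_on U f -> smooth_on U g ->
  dxi (deta (fun q => a * f q + b * g q)) p =
  a * dxi (deta f) p + b * dxi (deta g) p.
Proof.
move=> oU Up sf sg.
have lin (F G : R * R -> R) q v : smooth_on U F -> smooth_on U G -> U q ->
    'D_v (fun z => a * F z + b * G z) q = a * 'D_v F q + b * 'D_v G q.
  move=> sF sG Uq; have dF := smooth_differentiable sF Uq.
  have dG := smooth_differentiable sG Uq.
  have da := differentiable_cst a q; have db := differentiable_cst b q.
  rewrite (derive_add v (differentiableM da dF) (differentiableM db dG)).
  by rewrite (derive_mul v da dF) (derive_mul v db dG) !derive_cst !mul0r !add0r.
have -> : dxi (deta (fun q => a * f q + b * g q)) p =
    dxi (fun q => a * deta f q + b * deta g q) p.
  by apply: dxi_eq_on oU Up _ => q Uq; rewrite !detaE; exact: lin.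
have s1 := smooth_deta oU sf; have s2 := smooth_deta oU sg.
by rewrite dxiE; apply: etrans (lin _ _ _ _ s1 s2 Up) _; rewrite !dxiE.
Qed.

(** Liouville's equation for f = exp w says that f^2 w_{xi eta} is constant. *)
Lemma exp_wronskian U w p : open U -> U p -> smooth_on U w ->
  let f q := expR (w q) in
  f p * dxi (deta f) p - dxi f p * deta f p = f p ^+ 2 * dxi (deta w) p.
Proof.
move=> oU Up sw f; have sf : smooth_on U f by exact: smooth_exp.
have Df q v : U q -> 'D_v f q = f q * 'D_v w q.
  by move=> Uq; apply: (derive_chain v (is_derive_expR _) (smooth_differentiable sw Uq)).
have e1 q : U q -> dxi f q = f q * dxi w q by move=> Uq; rewrite !dxiE; exact: Df.
have e2 q : U q -> deta f q = f q * deta w q by move=> Uq; rewrite !detaE; exact: Df.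
have -> : dxi (deta f) p = dxi (fun q => f q * deta w q) p.
  exact: dxi_eq_on oU Up e2.
have dw := smooth_differentiable (smooth_deta oU sw) Up.
have -> : dxi (fun q => f q * deta w q) p = dxi f p * deta w p + f p * dxi (deta w) p.
  by rewrite !dxiE; exact: derive_mul (smooth_differentiable sf Up) dw.
by rewrite e1 // e2 //; ring.
Qed.

(** With u1 = ln |K + kappa| and u2 = ln |K - kappa| the system couples u1 and u2. The
    combinations w1 = - 3/8 u1 + 1/8 u2 and w2 = 1/8 u1 - 3/8 u2 satisfy one equation
    each, namely Liouville's equation for f1 = exp w1 and f2 = exp w2. The sign k
    makes the arguments of the logarithms positive. *)
Lemma curvature_liouville U (K kappa : R * R -> R) (k : R) : open U -> k ^+ 2 = 1 ->
  smooth_on U K -> smooth_on U kappa ->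
  (forall p, U p -> 0 < k * (K p + kappa p) /\ 0 < k * (K p - kappa p)) ->
  (forall p, U p ->
     `|K p ^+ 2 - kappa p ^+ 2| `^ 4^-1
       * hlaplacian (fun q => ln `|K q ^+ 2 - kappa q ^+ 2|) p = - 8 * K p) ->
  (forall p, U p ->
     `|K p ^+ 2 - kappa p ^+ 2| `^ 4^-1
       * hlaplacian (fun q => ln `|(K q + kappa q) / (K q - kappa q)|) p
     = - 4 * kappa p) ->
  exists f1 f2 : R * R -> R,
    [/\ smooth_on U f1, smooth_on U f2, forall p, U p -> 0 < f1 p /\ 0 < f2 p,
        forall p, U p -> f1 p * dxi (deta f1) p - dxi f1 p * deta f1 p = k /\
                         f2 p * dxi (deta f2) p - dxi f2 p * deta f2 p = k &
        forall p, U p ->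
          K p = k * (f1 p ^+ 2 + f2 p ^+ 2) / (2 * (f1 p * f2 p) ^+ 3) /\
          kappa p = k * (f2 p ^+ 2 - f1 p ^+ 2) / (2 * (f1 p * f2 p) ^+ 3)].
Proof.
move=> oU k2 sK sk pos eq1 eq2.
pose u1 q := ln (k * (K q + kappa q)); pose u2 q := ln (k * (K q - kappa q)).
have s1 : smooth_on U u1.
  apply: smooth_ln => // [q /pos[]//|].
  by apply: smoothM => //; [exact: smooth_cst|exact: smoothD].
have s2 : smooth_on U u2.
  apply: smooth_ln => // [q /pos[]//|].
  by apply: smoothM => //; [exact: smooth_cst|exact: smoothB].
(* All exponentials in the proof are monomials in X and Y. *)
pose X q := expR (u1 q / 8); pose Y q := expR (u2 q / 8).
have X8 q : U q -> k * (K q + kappa q) = X q ^+ 8.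
  by move=> /pos[a _]; rewrite /X -expRM_natl [8 * _]mulrC divfK // /u1 lnK.
have Y8 q : U q -> k * (K q - kappa q) = Y q ^+ 8.
  by move=> /pos[_ a]; rewrite /Y -expRM_natl [8 * _]mulrC divfK // /u2 lnK.
have KE q : U q -> K q = k * (X q ^+ 8 + Y q ^+ 8) / 2.
  move=> Uq; rewrite -(X8 q Uq) -(Y8 q Uq) -mulrDr mulrA -expr2 k2 mul1r.
  by field.
have kE q : U q -> kappa q = k * (X q ^+ 8 - Y q ^+ 8) / 2.
  move=> Uq; rewrite -(X8 q Uq) -(Y8 q Uq) -mulrBr mulrA -expr2 k2 mul1r.
  by field.
have X0 q : X q != 0 by rewrite gt_eqF ?expR_gt0.
have Y0 q : Y q != 0 by rewrite gt_eqF ?expR_gt0.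
have k0 : k != 0 by apply/eqP => z; move: k2; rewrite z expr0n /=; lra.
have e1 q : U q -> ln `|K q ^+ 2 - kappa q ^+ 2| = 1 * u1 q + 1 * u2 q.
  move=> Uq; have [a b] := pos q Uq.
  rewrite !mul1r /u1 /u2 -lnM ?posrE //.
  have -> : K q ^+ 2 - kappa q ^+ 2 = k * (K q + kappa q) * (k * (K q - kappa q)).
    by rewrite mulrACA -expr2 k2; ring.
  by rewrite gtr0_norm // mulr_gt0.
have e2 q : U q -> ln `|(K q + kappa q) / (K q - kappa q)| = 1 * u1 q + -1 * u2 q.
  move=> Uq; have [a b] := pos q Uq.
  rewrite mul1r mulN1r /u1 /u2 -ln_div ?posrE //.
  have -> : (K q + kappa q) / (K q - kappa q) =
      (k * (K q + kappa q)) / (k * (K q - kappa q)).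
    by rewrite -mulf_div divff // mul1r.
  by rewrite gtr0_norm // divr_gt0.
have E q : U q -> `|K q ^+ 2 - kappa q ^+ 2| `^ 4^-1 = X q ^+ 2 * Y q ^+ 2.
  move=> Uq; have [a b] := pos q Uq.
  have : 0 < `|K q ^+ 2 - kappa q ^+ 2|.
    rewrite normr_gt0 (_ : _ - _ = k * (K q + kappa q) * (k * (K q - kappa q))).
      by rewrite gt_eqF // mulr_gt0.
    by rewrite mulrACA -expr2 k2; ring.
  move=> /lt0r_neq0 n0; rewrite /powR (negPf n0) e1 // -exprMn -expRD -expRM_natl.
  by congr expR; field.
have lap (g : R * R -> R) (c : R) p : U p -> (forall q, U q -> g q = 1 * u1 q + c * u2 q) ->
    hlaplacian g p = dxi (deta u1) p + c * dxi (deta u2) p.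
  move=> Up ge.
  have sc : smooth_on U (fun q => 1 * u1 q + c * u2 q).
    by apply: smoothD => //; apply: smoothM => //; exact: smooth_cst.
  have sg : smooth_on U g by apply: (smooth_on_eq oU _ sc) => q /ge ->.
  rewrite (hlaplacian_null oU Up sg).
  have -> : dxi (deta g) p = dxi (deta (fun q => 1 * u1 q + c * u2 q)) p.
    by apply: (dxi_eq_on oU Up) => q Uq; exact: (deta_eq_on oU Uq ge).
  by rewrite (dxi_deta_lin _ _ oU Up s1 s2) mul1r.
pose w1 q := - (3 / 8) * u1 q + 8^-1 * u2 q; pose w2 q := 8^-1 * u1 q + - (3 / 8) * u2 q.
have sw1 : smooth_on U w1.
  by apply: smoothD => //; apply: smoothM => //; exact: smooth_cst.
have sw2 : smooth_on U w2.
  by apply: smoothD => //; apply: smoothM => //; exact: smooth_cst.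
have f1E q : expR (w1 q) = (X q ^+ 3)^-1 * Y q.
  by rewrite /X /Y -expRM_natl -expRN -expRD; congr expR; rewrite /w1; field.
have f2E q : expR (w2 q) = X q * (Y q ^+ 3)^-1.
  by rewrite /X /Y -expRM_natl -expRN -expRD; congr expR; rewrite /w2; field.
exists (fun q => expR (w1 q)), (fun q => expR (w2 q)); split.
- exact: smooth_exp.
- exact: smooth_exp.
- by move=> p _; rewrite !expR_gt0.
- move=> p Up; rewrite (exp_wronskian oU Up sw1) (exp_wronskian oU Up sw2).
  rewrite (dxi_deta_lin _ _ oU Up s1 s2) (dxi_deta_lin _ _ oU Up s1 s2) f1E f2E.
  have := eq1 p Up; rewrite E // (lap _ 1 p Up e1) KE //.
  have := eq2 p Up; rewrite E // (lap _ (-1) p Up e2) kE //.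
  have := X0 p; have := Y0 p; move: (X p) (Y p) => a b b0 a0.
  move: (dxi (deta u1) p) (dxi (deta u2) p) => l1 l2 m2 m1.
  (* The two equations, solved for l1 and l2. *)
  have l1E : l1 = - (k * (3 * a ^+ 8 + b ^+ 8)) / (a ^+ 2 * b ^+ 2).
    apply: (mulfI (_ : a ^+ 2 * b ^+ 2 != 0)); first by rewrite mulf_neq0 ?expf_neq0.
    rewrite [RHS]mulrC divfK ?mulf_neq0 ?expf_neq0 //; lra.
  have l2E : l2 = - (k * (a ^+ 8 + 3 * b ^+ 8)) / (a ^+ 2 * b ^+ 2).
    apply: (mulfI (_ : a ^+ 2 * b ^+ 2 != 0)); first by rewrite mulf_neq0 ?expf_neq0.
    rewrite [RHS]mulrC divfK ?mulf_neq0 ?expf_neq0 //; lra.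
  by rewrite l1E l2E; split; field; rewrite a0 b0.
- move=> p Up; rewrite KE // kE // f1E f2E.
  have := X0 p; have := Y0 p; move: (X p) (Y p) => a b b0 a0.
  by split; field; rewrite a0 b0.
Qed.

End Decoupling.

(** * Existence and uniqueness *)

Section Existence.
Variable R : realType.
Implicit Types (D U : set (R * R)) (p q o : R * R).

(** By K^2 - kappa^2 > 0 the factors K + kappa and K - kappa have a common sign, which
    is constant near o. *)
Lemma signed_diamond D (K kappa : R * R -> R) o : open D ->
  smooth_on D K -> smooth_on D kappa ->
  (forall p, D p -> 0 < K p ^+ 2 - kappa p ^+ 2) -> D o ->
  exists k r, [/\ k ^+ 2 = 1, 0 < r, diamond o r `<=` D &
    forall p, diamond o r p -> 0 < k * (K p + kappa p) /\ 0 < k * (K p - kappa p)].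
Proof.
move=> oD sK sk pos Do.
have fact p : K p ^+ 2 - kappa p ^+ 2 = (K p + kappa p) * (K p - kappa p) by ring.
have n0 : K o + kappa o != 0.
  by apply/eqP => z; have := pos o Do; rewrite fact z mul0r ltxx.
have [k k2 ko] : exists2 k : R, k ^+ 2 = 1 & 0 < k * (K o + kappa o).
  case: (ltgtP (K o + kappa o) 0) n0 => // c _.
    by exists (-1); [rewrite sqrrN expr1n|rewrite mulN1r oppr_gt0].
  by exists 1; [rewrite expr1n|rewrite mul1r].
have sg : smooth_on D (fun q => k * (K q + kappa q)).
  by apply: smoothM => //; [exact: smooth_cst|exact: smoothD].
have [r r0 rD] : exists2 r, 0 < r &
    diamond o r `<=` D `&` [set p | 0 < k * (K p + kappa p)].
  apply: diamond_nbhs; apply: filterI; first exact: open_nbhs_nbhs.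
  exact: (cvgr_gt _ (differentiable_continuous (smooth_differentiable sg Do)) _ ko).
exists k, r; split=> // [p /rD[]//|p /rD[Dp kp]]; split=> //.
rewrite -(pmulr_rgt0 _ kp) mulrACA -fact -expr2 k2 mul1r; exact: pos.
Qed.

Lemma canonical_surface_exists D (K kappa : R * R -> R) o : open D ->
  smooth_on D K -> smooth_on D kappa ->
  (forall p, D p -> 0 < K p ^+ 2 - kappa p ^+ 2) ->
  (forall p, D p ->
     `|K p ^+ 2 - kappa p ^+ 2| `^ 4^-1
       * hlaplacian (fun q => ln `|K q ^+ 2 - kappa q ^+ 2|) p = - 8 * K p) ->
  (forall p, D p ->
     `|K p ^+ 2 - kappa p ^+ 2| `^ 4^-1
       * hlaplacian (fun q => ln `|(K q + kappa q) / (K q - kappa q)|) p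
     = - 4 * kappa p) -> D o ->
  exists U x, [/\ U o, U `<=` D & canonical_minimal_surface_with x U K kappa].
Proof.
move=> oD sK sk pos eq1 eq2 Do.
have [k [r [k2 r0 VD Vk]]] := signed_diamond oD sK sk pos Do.
have [f1 [f2 [s1 s2 fp fk fK]]] := curvature_liouville (@diamond_open R o r) k2
  (smooth_onS VD sK) (smooth_onS VD sk) Vk (fun p Vp => eq1 p (VD p Vp))
  (fun p Vp => eq2 p (VD p Vp)).
have [x xS] := liouville_surface r0 k2 s1 s2 fp (fun p Vp => (fk p Vp).1)
  (fun p Vp => (fk p Vp).2) fK.
exists (diamond o (r / 2)), x; split=> //; first by apply: diamond_center; lra.
by apply: subset_trans VD; apply: diamondS; lra.
Qed.

End Existence.

Theorem theorem7p7 (R : realType) (D : set (R * R)) (K kappa : R * R -> R)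
  (D_domain : domain D)
  (K_smooth : smooth_on D K) (kappa_smooth : smooth_on D kappa)
  (Kkappa_gt0 : forall p, D p -> 0 < K p ^+ 2 - kappa p ^+ 2)
  (eq1 : forall p, D p ->
     `|K p ^+ 2 - kappa p ^+ 2| `^ 4^-1
       * hlaplacian (fun q => ln `|K q ^+ 2 - kappa q ^+ 2|) p
     = - 8 * K p)
  (eq2 : forall p, D p ->
     `|K p ^+ 2 - kappa p ^+ 2| `^ 4^-1
       * hlaplacian (fun q => ln `|(K q + kappa q) / (K q - kappa q)|) p
     = - 4 * kappa p)
  (t0 : R * R) (Dt0 : D t0) :
  (exists (U : set (R * R)) (x : R * R -> 'cV[R]_4),
     [/\ U t0, U `<=` D & canonical_minimal_surface_with x U K kappa])
  /\
  (forall (U : set (R * R)) (x y : R * R -> 'cV[R]_4),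
     U t0 -> U `<=` D ->
     canonical_minimal_surface_with x U K kappa ->
     canonical_minimal_surface_with y U K kappa ->
     exists (A : 'M[R]_4) (b : 'cV[R]_4),
       SO22 A /\ forall p, U p -> y p = A *m x p + b).
Proof.
have [oD _] := D_domain; split.
  exact: canonical_surface_exists oD K_smooth kappa_smooth Kkappa_gt0 eq1 eq2 Dt0.
move=> U x y Ut0 _ /canonical_surface_equations[dU sx ix ex].
move=> /canonical_surface_equations[_ sy iy ey].
exact: canonical_surface_rigid dU Ut0 sx ix ex sy iy ey.
Qed.
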